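(* Let $(M,g)$ be an oriented Riemannian four-manifold. Then the following hold: (1) $TM\oplus\Lambda^+$ is a spin vector bundle, and the locally defined spinor bundles $\Sigma M=\Sigma^+M\oplus\Sigma^-M$ of $TM$ and $\Sigma\Lambda^+$ of $\Lambda^+$ define an honest (globally defined) spinor bundle $\Sigma M\otimes_{\mathbb{C}}\Sigma\Lambda^+$ over $M$; (2) $\Sigma^+M\otimes_{\mathbb{C}}\Sigma\Lambda^+\cong\Sigma^+M\otimes_{\mathbb{C}}\Sigma^+M\cong\mathrm{End}_{\mathbb{C}}(\Sigma^+M)$; (3) the section $\mathrm{Id}_{\Sigma^+M}\in\Gamma(\mathrm{End}_{\mathbb{C}}(\Sigma^+M))$ is parallel with respect to the connection induced by the Levi-Civita connection of $g$.
   Context: $\Lambda^2T^*M=\Lambda^+\oplus\Lambda^-$ is the decomposition into the $\pm1$-eigenbundles of the Hodge star operator. An oriented Euclidean vector bundle is spin if its bundle of oriented orthonormal frames admits a lift to the spin group (i.e. its second Stiefel–Whitney class vanishes). Let $\lambda_n\colon\mathrm{Spin}(n)\to\mathrm{SO}(n)$ be the standard double cover. There is an isomorphism $\mathrm{Spin}(4)\cong\mathrm{Spin}(3)\times\mathrm{Spin}(3)$; let $\mathrm{pr}_+$ and $\mathrm{pr}_-$ be the projections to the first and second factor. They induce homomorphisms $\widehat{\mathrm{pr}}_\pm\colon\mathrm{SO}(4)\to\mathrm{SO}(3)$ with $\widehat{\mathrm{pr}}_\pm\circ\lambda_4=\lambda_3\circ\mathrm{pr}_\pm$. Let $\mathrm{Fr}\to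 M$ be the principal $\mathrm{SO}(4)$-bundle of oriented orthonormal frames of $(M,g)$; for a representation $\rho$ of $\mathrm{SO}(4)$, $\mathrm{Ass}(\mathrm{Fr},\rho)$ denotes the associated vector bundle, with the connection induced by the Levi-Civita connection on $\mathrm{Fr}$. Then $TM=\mathrm{Ass}(\mathrm{Fr},\mathrm{Id}_{\mathrm{SO}(4)})$ and, with the factors of $\mathrm{Spin}(4)$ labelled appropriately, $\Lambda^\pm=\mathrm{Ass}(\mathrm{Fr},\widehat{\mathrm{pr}}_\pm)$. Let $\Delta_n$ be the complex spin representation of $\mathrm{Spin}(n)$, and $\Delta_4=\Delta_4^+\oplus\Delta_4^-$ the decomposition into half-spin representations, where, with the Clifford convention $v\cdot v=-\langle v,v\rangle$, the volume element $e_1e_2e_3e_4$ acts as $-1$ on $\Delta_4^+$ and as $+1$ on $\Delta_4^-$. Locally on $M$ (where $\mathrm{Fr}$ lifts to a principal $\mathrm{Spin}(4)$-bundle), $\Sigma M=\Sigma^+M\oplus\Sigma^-M$ is the bundle associated to $\Delta_4=\Delta_4^+\oplus\Delta_4^-$, and $\Sigma\Lambda^+$ is the bundle associated to $\Delta_3\circ\mathrm{pr}_+$. A tensor product of such locally defined bundles (such as $\Sigma M\otimes\Sigma\Lambda^+$, $\Sigma^+M\otimes\Sigma^+M$ or $\mathrm{End}_{\mathbb{C}}(\Sigma^+M)$) is an honest vector bundle over $M$ when the corresponding representation of $\mathrm{Spin}(4)$ descends to $\mathrm{SO}(4)$; it is then the bundle associated to $\mathrm{Fr}$ via the descended representation,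 equipped with the connection induced by the Levi-Civita connection. The symbol $\cong$ between such bundles denotes an isomorphism of complex vector bundles induced by an isomorphism of the underlying representations (hence compatible with the induced connections). *)

(* Defs.v *)
From HB Require Import structures.
From mathcomp Require Import all_boot all_order all_algebra ring.

Set Implicit Arguments.
Unset Strict Implicit.
Unset Printing Implicit Defensive.

Import Order.TTheory GRing.Theory Num.Theory.

Local Open Scope ring_scope.

(* Clifford algebra Cl_n of R^n with v * v = - <v, v>, as the space with     *)
(* basis e_S = e_(i1) ... e_(ik) for S = {i1 < ... < ik}; the product is     *)
(* e_A * e_B = csign A B e_(A symdiff B), each pair (i, j) in A x B with     *)
(* j < i (a transposition) or j = i (e_i * e_i = -1) contributing -1.        *)

Section Clifford.
Variables (R : comNzRingType) (n : nat).
Implicit Types A B C S : {set 'I_n}.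

Definition symdiff A B : {set 'I_n} := [set i | (i \in A) (+) (i \in B)].

Definition csign A B : R :=
  \prod_(i in A) \prod_(j in B) (if (j <= i)%N then -1 else 1).

Definition clifford := {ffun {set 'I_n} -> R}.

HB.instance Definition _ := GRing.Zmodule.on clifford.

Implicit Types a b c : clifford.

Definition cl1 : clifford := [ffun S => (S == set0)%:R].

Definition clmul a b : clifford :=
  [ffun S => \sum_A csign A (symdiff A S) * (a A * b (symdiff A S))].

Lemma symdiffA A B C : symdiff A (symdiff B C) = symdiff (symdiff A B) C.
Proof. by apply/setP => i; rewrite !inE addbA. Qed.

Lemma symdiffC A B : symdiff A B = symdiff B A.
Proof. by apply/setP => i; rewrite !inE addbC. Qed.

Lemma symdiffK A : involutive (symdiff A).
Proof. by move=> B; apply/setP => i; rewrite !inE addbA addbb. Qed.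

Lemma symdiff0 A : symdiff A set0 = A.
Proof. by apply/setP => i; rewrite !inE addbF. Qed.

Lemma symdiffv A : symdiff A A = set0.
Proof. by apply/setP => i; rewrite !inE addbb. Qed.

Lemma prod_symdiff (f : 'I_n -> R) A B : (forall i, f i * f i = 1) ->
  \prod_(i in symdiff A B) f i = (\prod_(i in A) f i) * \prod_(i in B) f i.
Proof.
move=> f2; rewrite big_mkcond [in RHS]big_mkcond /= [X in _ * X]big_mkcond /=.
rewrite -big_split; apply: eq_bigr => i _; rewrite inE.
by case: (i \in A); case: (i \in B); rewrite /= ?mulr1 ?mul1r.
Qed.

Let sgn2 (b : bool) : (if b then -1 else 1 : R) * (if b then -1 else 1) = 1.
Proof. by case: b; rewrite ?mulrNN mulr1. Qed.

Let csign2 A i :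
  (\prod_(j in A) (if (j <= i)%N then -1 else 1 : R)) *
  (\prod_(j in A) (if (j <= i)%N then -1 else 1)) = 1.
Proof. by rewrite -big_split big1 // => j _; exact: sgn2. Qed.

Lemma csignDl A B C : csign (symdiff A B) C = csign A C * csign B C.
Proof. by apply: prod_symdiff => i; exact: csign2. Qed.

Lemma csignDr A B C : csign A (symdiff B C) = csign A B * csign A C.
Proof.
rewrite /csign -big_split; apply: eq_bigr => i _.
by apply: prod_symdiff => j; exact: sgn2.
Qed.

Lemma csign0l A : csign set0 A = 1.
Proof. by rewrite /csign big_set0. Qed.

Lemma csign0r A : csign A set0 = 1.
Proof. by rewrite /csign big1 // => i _; rewrite big_set0. Qed.

Lemma clmulA : associative clmul.
Proof.
move=> a b c; apply/ffunP => S; rewrite !ffunE.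
under eq_bigr do rewrite ffunE !mulr_sumr.
under [RHS]eq_bigr do rewrite ffunE mulr_suml mulr_sumr.
rewrite [RHS]exchange_big; apply: eq_bigr => A _ /=.
rewrite [RHS](reindex_inj (inv_inj (symdiffK A))) /=.
apply: eq_bigr => B _; rewrite symdiffK.
rewrite symdiffA [symdiff B A]symdiffC; set X := symdiff (symdiff A B) S.
have -> : symdiff A S = symdiff B X.
  by rewrite /X [symdiff A B]symdiffC -symdiffA symdiffK.
rewrite csignDl csignDr; ring.
Qed.

Lemma clmul1l : left_id cl1 clmul.
Proof.
move=> a; apply/ffunP => S; rewrite !ffunE (bigD1 set0) //= ffunE eqxx mul1r.
rewrite csign0l mul1r symdiffC symdiff0 big1 ?addr0 // => A /negPf A0.
by rewrite ffunE A0 mul0r mulr0.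
Qed.

Lemma clmul1r : right_id cl1 clmul.
Proof.
move=> a; apply/ffunP => S; rewrite !ffunE (bigD1 S) //= ffunE symdiffv eqxx.
rewrite mulr1 csign0r mul1r big1 ?addr0 // => A AS; rewrite ffunE.
case: eqP => [AS0|]; last by rewrite !mulr0.
by rewrite -[S](symdiffK A) AS0 symdiff0 eqxx in AS.
Qed.

Lemma clmulDl : left_distributive clmul +%R.
Proof.
move=> a b c; apply/ffunP => S; rewrite !ffunE -big_split.
by apply: eq_bigr => A _; rewrite ffunE mulrDl mulrDr.
Qed.

Lemma clmulDr : right_distributive clmul +%R.
Proof.
move=> a b c; apply/ffunP => S; rewrite !ffunE -big_split.
by apply: eq_bigr => A _; rewrite ffunE !mulrDr.
Qed.

Lemma cl1_neq0 : cl1 != 0.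
Proof. by apply/eqP => /ffunP /(_ set0) /eqP; rewrite !ffunE eqxx oner_eq0. Qed.

HB.instance Definition _ := GRing.Zmodule_isNzRing.Build clifford
  clmulA clmul1l clmul1r clmulDl clmulDr cl1_neq0.

Definition clvec (v : 'rV[R]_n) : clifford :=
  [ffun S => \sum_(i | S == [set i]) v 0 i].

Definition clvol : clifford := [ffun S : {set 'I_n} => (S == setT)%:R].

Definition clrev a : clifford := [ffun S : {set 'I_n} => (-1) ^+ 'C(#|S|, 2) * a S].

Lemma symdiff1_eq (i j : 'I_n) S :
  (symdiff [set i] S == [set j]) = (S == symdiff [set i] [set j]).
Proof. by rewrite -(inj_eq (inv_inj (symdiffK [set i]))) symdiffK. Qed.

Lemma csign1 (i j : 'I_n) : csign [set i] [set j] = if (j <= i)%N then -1 else 1.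
Proof. by rewrite /csign !big_set1. Qed.

Lemma clvec_sqr (v : 'rV[R]_n) :
  clvec v * clvec v = [ffun S => - (\sum_i v 0 i ^+ 2) * (S == set0)%:R].
Proof.
apply/ffunP => S; rewrite !ffunE.
pose F (i j : 'I_n) := if S == symdiff [set i] [set j]
  then csign [set i] [set j] * (v 0 i * v 0 j) else 0.
transitivity (\sum_i \sum_j F i j).
  under eq_bigr do rewrite !ffunE mulr_suml mulr_sumr.
  rewrite (exchange_big_dep predT) //=; apply: eq_bigr => i _.
  rewrite big_pred1_eq mulr_sumr mulr_sumr big_mkcond /=.
  apply: eq_bigr => j _; rewrite symdiff1_eq /F; case: eqP => // ->.
  by rewrite symdiffK.
have split_F i : \sum_j F i j =
    F i i + (\sum_(j : 'I_n | (j < i)%N) F i j + \sum_(j : 'I_n | (i < j)%N) F i j).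
  rewrite (bigD1 i) //=; congr (_ + _).
  rewrite (bigID (fun j : 'I_n => (j < i)%N)) /=; congr (_ + _);
  apply: eq_bigl => j; rewrite -(inj_eq val_inj) /=; by case: ltngtP.
rewrite (eq_bigr _ (fun i _ => split_F i)) !big_split /=.
rewrite [X in _ + (_ + X)](exchange_big_dep predT) //= -big_split /=.
rewrite [X in _ + X]big1 ?addr0; last first.
  move=> i _; rewrite -big_split big1 //= => j ji; rewrite /F symdiffC.
  case: eqP => _; last by rewrite addr0.
  by rewrite !csign1 (ltnW ji) leqNgt ji /= mulN1r mul1r [v 0 j * _]mulrC addNr.
rewrite mulNr mulr_suml -sumrN; apply: eq_bigr => i _.
by rewrite /F symdiffv csign1 leqnn expr2; case: eqP; rewrite ?mulr1 ?mulN1r ?mulr0 ?oppr0.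
Qed.

End Clifford.

From mathcomp Require Import all_classical all_reals all_analysis.
From mathcomp.real_closed Require Import complex mxtens.

Import numFieldNormedType.Exports.
Local Open Scope classical_set_scope.

Section Spin.
Variable R : realType.
Local Notation C := R[i].
Local Notation Cl n := (clifford R n).

Definition spin (n : nat) : set (Cl n) :=
  [set a : Cl n | exists s : seq 'rV[R]_n, [/\ ~~ odd (size s),
     (forall v, v \in s -> \sum_i v 0 i ^+ 2 = 1) & a = \prod_(v <- s) clvec v]].

Definition SO (n : nat) : set 'M[R]_n :=
  [set A : 'M[R]_n | A^T *m A = 1%:M /\ \det A = 1].

(* The double cover: v |-> a v a^-1, where a^-1 = clrev a for a in Spin(n). *)
Definition spin_cover (n : nat) (a : Cl n) : 'M[R]_n :=
  \matrix_(i, j) (a * clvec (delta_mx 0 j) * clrev a) [set i]%SET.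

(* The factor pr_+ : Spin(4) -> Spin(3), as the restriction of the algebra   *)
(* morphism from the even part of Cl_4 to that of Cl_3 which kills the ideal *)
(* generated by 1 + e1e2e3e4: it sends e_i e_j to e_i e_j for i, j <= 3 and  *)
(* e3e4, e1e4, e2e4 to e1e2, e2e3, e3e1. Thus the anti-self-dual e1e2 - e3e4 *)
(* is killed, so that the induced SO(4) -> SO(3) is the action on the        *)
(* self-dual forms. The other factor pr_- is obtained with + in place of -.  *)
Definition pr_plus (a : Cl 4) : Cl 3 :=
  [ffun S : {set 'I_3} =>
     (a - a * clvol R 4) [set widen_ord (leqnSn 3) i | i in S]%SET].

(* Extension to Cl_n of e_i |-> gamma i (gamma a family of Clifford matrices).*)
Definition cl_rep (n N : nat) (gamma : 'I_n -> 'M[C]_N) (a : Cl n) : 'M[C]_N :=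
  \sum_S (a S)%:C%C *: \big[mulmx/1%:M]_(i < n | i \in S) gamma i.

Definition clifford_matrices (n N : nat) (gamma : 'I_n -> 'M[C]_N) :=
  forall i j, gamma i *m gamma j + gamma j *m gamma i =
    (- 2 * (i == j)%:R)%:M.

(* Delta_3: the unit quaternions, with gamma_1 gamma_2 gamma_3 = -1. *)
Definition gamma3 (i : 'I_3) : 'M[C]_2 :=
  let e : seq (seq C) :=
    tnth [tuple [:: [:: 'i; 0]; [:: 0; - 'i]];
                [:: [:: 0; 1]; [:: -1; 0]];
                [:: [:: 0; 'i]; [:: 'i; 0]]]%C i in
  \matrix_(r, c) nth 0 (nth [::] e r) c.

(* Delta_4 in chiral form: even elements act by block diagonal matrices, and *)
(* the first summand C^2 is Delta_4^+, where e1e2e3e4 acts as -1 (vol4E).    *)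
Definition gamma4 (i : 'I_4) : 'M[C]_(2 + 2) :=
  match fintype.split (i : 'I_(3 + 1)) with
  | inl j => block_mx 0 (gamma3 j) (gamma3 j) 0
  | inr _ => block_mx 0 (- 1%:M) 1%:M 0
  end.

Definition vol4 : 'M[C]_(2 + 2) := block_mx (- 1%:M) 0 0 1%:M.

(* Delta_7, as the graded tensor product of Delta_4 and Delta_3. *)
Definition gamma7 (i : 'I_7) : 'M[C]_((2 + 2) * 2) :=
  match fintype.split (i : 'I_(4 + 3)) with
  | inl j => gamma4 j *t 1%:M
  | inr j => vol4 *t gamma3 j
  end.

Definition Delta3 : Cl 3 -> 'M[C]_2 := cl_rep gamma3.
Definition Delta4 : Cl 4 -> 'M[C]_(2 + 2) := cl_rep gamma4.
Definition Delta7 : Cl 7 -> 'M[C]_((2 + 2) * 2) := cl_rep gamma7.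
Definition Delta4_plus (a : Cl 4) : 'M[C]_2 := ulsubmx (Delta4 a).

Lemma gamma3P : clifford_matrices gamma3.
Proof.
move=> i j; apply/matrixP => r c; rewrite !mxE !big_ord_recr !big_ord0 /= !mxE /=.
case: i => [[|[|[|//]]] ?]; case: j => [[|[|[|//]]] ?];
  case: r => [[|[|//]] ?]; case: c => [[|[|//]] ?];
  apply/eqP; rewrite eq_complex /=; apply/andP; split; apply/eqP => /=; ring.
Qed.

Lemma gamma4l (j : 'I_3) :
  gamma4 (lshift 1 j) = block_mx 0 (gamma3 j) (gamma3 j) 0.
Proof. by rewrite /gamma4 (unsplitK (inl j)). Qed.

Lemma gamma4r (j : 'I_1) : gamma4 (rshift 3 j) = block_mx 0 (- 1%:M) 1%:M 0.
Proof. by rewrite /gamma4 (unsplitK (inr j)). Qed.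

Lemma gamma4P : clifford_matrices gamma4.
Proof.
have ll (k l : 'I_3) : (lshift 1 k == lshift 1 l :> 'I_4) = (k == l).
  exact: inj_eq (@lshift_inj _ _) _ _.
have lr (k : 'I_3) (l : 'I_1) : (lshift 1 k == rshift 3 l :> 'I_4) = false.
  exact: eq_lrshift.
have rl (k : 'I_3) (l : 'I_1) : (rshift 3 l == lshift 1 k :> 'I_4) = false.
  by rewrite eq_sym lr.
move=> i j; case: (split_ordP (i : 'I_(3 + 1))) => k ->;
  case: (split_ordP (j : 'I_(3 + 1))) => l ->; rewrite ?gamma4l ?gamma4r;
  rewrite !mulmx_block !(mul0mx, mulmx0, addr0, add0r) add_block_mx !addr0;
  rewrite ?(mulmxN, mulNmx, mulmx1, mul1mx).
- by rewrite gamma3P ll -scalar_mx_block.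
- by rewrite lr mulr0 raddf0 -[RHS]block_mx0 ?subrr ?addNr.
- by rewrite rl mulr0 raddf0 -[RHS]block_mx0 ?subrr ?addNr.
- rewrite [k]ord1 [l]ord1 eqxx mulr1.
  by rewrite scalar_mx_block -opprD -raddfD -raddfN.
Qed.

Lemma gamma3_prod :
  gamma3 0 *m gamma3 1 *m gamma3 (lift 0 (lift 0 0)) = - 1%:M.
Proof.
apply/matrixP => r c; rewrite !mxE !big_ord_recr !big_ord0 /= !mxE /=.
rewrite !big_ord_recr !big_ord0 /= !mxE /=.
by case: r => [[|[|//]] ?]; case: c => [[|[|//]] ?];
  apply/eqP; rewrite eq_complex /=; apply/andP; split; apply/eqP => /=; ring.
Qed.

Lemma vol4E : Delta4 (clvol R 4) = vol4.
Proof.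
rewrite /Delta4 /cl_rep (bigD1 [set: 'I_4]%SET) //= big1 ?addr0; last first.
  by move=> S /negPf ST; rewrite ffunE ST scale0r.
rewrite ffunE eqxx scale1r.
under eq_bigl do rewrite finset.in_setT.
rewrite 4!big_ord_recl big_ord0 mulmx1.
pose f k := gamma4 (lshift 1 (k : 'I_3)).
pose g := gamma4 (rshift 3 ord0).
have -> : gamma4 ord0 = f 0 by congr gamma4; exact: val_inj.
have -> : gamma4 (lift ord0 ord0) = f 1 by congr gamma4; exact: val_inj.
have -> : gamma4 (lift ord0 (lift ord0 ord0)) = f (lift 0 (lift 0 0)).
  by congr gamma4; exact: val_inj.
have -> : gamma4 (lift ord0 (lift ord0 (lift ord0 ord0))) = g.
  by congr gamma4; exact: val_inj.
rewrite !mulmxA /f /g !gamma4l gamma4r /vol4.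
rewrite !mulmx_block !(mul0mx, mulmx0, addr0, add0r).
by rewrite gamma3_prod mulmxN !mulmx1 opprK.
Qed.

Lemma vol4_gamma4 i : vol4 *m gamma4 i = - (gamma4 i *m vol4).
Proof.
case: (split_ordP (i : 'I_(3 + 1))) => k ->; rewrite ?gamma4l ?gamma4r /vol4;
  rewrite !mulmx_block !(mul0mx, mulmx0, addr0, add0r) opp_block_mx !oppr0;
  by rewrite !(mulmxN, mulNmx, mulmx1, mul1mx, opprK).
Qed.

Lemma vol4_sqr : vol4 *m vol4 = 1%:M.
Proof.
rewrite mulmx_block !(mul0mx, mulmx0, addr0, add0r) mulmxN mulNmx opprK !mulmx1.
by rewrite -scalar_mx_block.
Qed.

Lemma gamma7P : clifford_matrices gamma7.
Proof.
have ll (k l : 'I_4) : (lshift 3 k == lshift 3 l :> 'I_7) = (k == l).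
  exact: (inj_eq (@lshift_inj 4 3)).
have rr (k l : 'I_3) : (rshift 4 k == rshift 4 l :> 'I_7) = (k == l).
  exact: (inj_eq (@rshift_inj 4 3)).
have lr (k : 'I_4) (l : 'I_3) : (lshift 3 k == rshift 4 l :> 'I_7) = false.
  exact: eq_lrshift.
have rl (k : 'I_4) (l : 'I_3) : (rshift 4 l == lshift 3 k :> 'I_7) = false.
  by rewrite eq_sym lr.
have tens1 (a : C) : (a%:M : 'M[C]_(2 + 2)) *t (1%:M : 'M[C]_2) = a%:M.
  apply/matrixP => r c; case: (mxtens_indexP r) => r1 r2.
  case: (mxtens_indexP c) => c1 c2; rewrite tensmxE !mxE.
  rewrite (inj_eq (can_inj (@mxtens_indexK _ _))) xpair_eqE.
  by case: eqP; case: eqP; rewrite ?mulr1n ?mulr0n ?mulr1 ?mulr0 ?mul0r.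
have tens1' (a : C) : (1%:M : 'M[C]_(2 + 2)) *t (a%:M : 'M[C]_2) = a%:M.
  rewrite -tens1; apply/matrixP => r c; rewrite !mxE.
  by case: eqP; case: eqP; rewrite ?mulr1n ?mulr0n ?mulr1 ?mulr0 ?mul0r ?mul1r.
have tensDl (A B : 'M[C]_(2 + 2)) (D : 'M[C]_2) : A *t D + B *t D = (A + B) *t D.
  by apply/matrixP => r c; rewrite !mxE mulrDl.
have tensDr (A : 'M[C]_(2 + 2)) (B D : 'M[C]_2) : A *t B + A *t D = A *t (B + D).
  by apply/matrixP => r c; rewrite !mxE mulrDr.
have tens0 (D : 'M[C]_2) : (0 : 'M[C]_(2 + 2)) *t D = 0.
  by apply/matrixP => r c; rewrite !mxE mul0r.
have gl (k : 'I_4) : gamma7 (lshift 3 k) = gamma4 k *t 1%:M.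
  by rewrite /gamma7 (unsplitK (inl k)).
have gr (k : 'I_3) : gamma7 (rshift 4 k) = vol4 *t gamma3 k.
  by rewrite /gamma7 (unsplitK (inr k)).
move=> i j; case: (split_ordP (i : 'I_(4 + 3))) => k ->;
  case: (split_ordP (j : 'I_(4 + 3))) => l ->; rewrite ?gl ?gr !tensmx_mul.
- by rewrite mulmx1 tensDl gamma4P ll tens1.
- rewrite mulmx1 mul1mx tensDl vol4_gamma4 subrr tens0 lr.
  by rewrite mulr0 raddf0.
- rewrite mulmx1 mul1mx tensDl vol4_gamma4 addNr tens0 rl.
  by rewrite mulr0 raddf0.
- by rewrite tensDr vol4_sqr gamma3P rr tens1'.
Qed.

End Spin.

Section Smooth.
Variable R : realType.

Fixpoint Cdiff (k n : nat) (U : set 'rV[R]_n.+1) (f : 'rV[R]_n.+1 -> R) : Prop :=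
  if k is k'.+1 then
    (forall x, U x -> differentiable f x) /\
    forall i, Cdiff k' U (fun x => 'D_(delta_mx 0 i) f x)
  else forall x, U x -> {for x, continuous f}.

Definition Cinfty (n : nat) (U : set 'rV[R]_n.+1) (f : 'rV[R]_n.+1 -> R) :=
  forall k, Cdiff k U f.

(* A chart i is the homeomorphism coord i : cdom i -> coord i @` cdom i onto *)
(* an open subset of R^4, with inverse param i.                              *)
Record oriented_manifold4 := OrientedManifold4 {
  carrier :> topologicalType;
  chart : Type;
  cdom : chart -> set carrier;
  coord : chart -> carrier -> 'rV[R]_4;
  param : chart -> 'rV[R]_4 -> carrier;
  (* d x_i / d x_j at the point p *)
  jac := fun (i j : chart) (p : carrier) => \matrix_(a, b)
    'D_(delta_mx 0 b) (fun y => coord i (param j y) 0 a) (coord j p) : 'M[R]_4;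
  carrier_hausdorff : hausdorff_space carrier;
  carrier_second_countable : @second_countable carrier;
  cdom_open : forall i, open (cdom i);
  cdom_cover : forall p, exists i, cdom i p;
  image_open : forall i, open (coord i @` cdom i);
  coordK : forall i p, cdom i p -> param i (coord i p) = p;
  coord_continuous : forall i, {within cdom i, continuous (coord i)};
  param_continuous : forall i,
    {within coord i @` cdom i, continuous (param i)};
  transition_smooth : forall i j a,
    Cinfty (coord j @` (cdom i `&` cdom j)) (fun y => coord i (param j y) 0 a);
  transition_oriented : forall i j p, cdom i p -> cdom j p ->
    0 < \det (jac i j p)
}.

Variable M : oriented_manifold4.

Definition smooth (A : set M) (f : M -> R) :=
  forall i : chart M, Cinfty (coord i @` (A `&` cdom i)) (f \o param i).

Definition smooth_mx (m n : nat) (A : set M) (f : M -> 'M[R]_(m, n)) :=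
  forall r c, smooth A (fun p => f p r c).

Definition smooth_cmx (m n : nat) (A : set M) (f : M -> 'M[R[i]]_(m, n)) :=
  smooth_mx A (fun p => map_mx (@Re R) (f p)) /\
  smooth_mx A (fun p => map_mx (@Im R) (f p)).

(* Partial derivative in the m-th coordinate of the chart i. *)
Definition pd (i : chart M) (m : 'I_4) (f : M -> R) (p : M) : R :=
  'D_(delta_mx 0 m) (f \o param i) (coord i p).

Definition pd_mx (m n : nat) (i : chart M) (l : 'I_4) (f : M -> 'M[R]_(m, n))
    (p : M) : 'M[R]_(m, n) :=
  \matrix_(r, c) pd i l (fun q => f q r c) p.

Definition pd_cmx (m n : nat) (i : chart M) (l : 'I_4)
    (f : M -> 'M[R[i]]_(m, n)) (p : M) : 'M[R[i]]_(m, n) :=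
  \matrix_(r, c) (pd i l (fun q => Re (f q r c)) p +i*
                  pd i l (fun q => Im (f q r c)) p)%C.

End Smooth.

Record oriented_riemannian4 (R : realType) := OrientedRiemannian4 {
  rmanifold :> oriented_manifold4 R;
  metric : chart rmanifold -> rmanifold -> 'M[R]_4;
  metric_smooth : forall i, smooth_mx (cdom i) (metric i);
  metric_sym : forall i p, cdom i p -> (metric i p)^T = metric i p;
  metric_pos : forall i p, cdom i p -> forall v : 'cV[R]_4, v != 0 ->
    0 < (v^T *m metric i p *m v) 0 0;
  metric_change : forall i j p, cdom i p -> cdom j p ->
    metric j p = (jac i j p)^T *m metric i p *m jac i j p
}.

Section Frames.
Variables (R : realType) (M : oriented_riemannian4 R).

(* The columns of E are the components, in the chart i, of an oriented       *)
(* orthonormal basis of the tangent space at p.                              *)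
Definition oriented_orthonormal (i : chart M) (p : M) (E : 'M[R]_4) :=
  E^T *m metric i p *m E = 1%:M /\ 0 < \det E.

(* Local smooth sections of Fr. The principal bundle Fr is used through the  *)
(* SO(4)-cocycle fr_trans of all its local sections: e' = e . fr_trans e e'. *)
Record frame := Frame {
  fr_chart : chart M;
  fr_dom : set M;
  fr_mx : M -> 'M[R]_4;
  fr_open : open fr_dom;
  fr_sub : fr_dom `<=` cdom fr_chart;
  fr_smooth : smooth_mx fr_dom fr_mx;
  fr_on : forall p, fr_dom p -> oriented_orthonormal fr_chart p (fr_mx p)
}.

Definition fr_trans (e e' : frame) (p : M) : 'M[R]_4 :=
  (fr_mx e p)^T *m metric (fr_chart e) p *m
  (jac (fr_chart e) (fr_chart e') p *m fr_mx e' p).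

Definition christoffel (i : chart M) (m : 'I_4) (p : M) : 'M[R]_4 :=
  \matrix_(k, l) (2^-1 * \sum_r invmx (metric i p) k r *
    (pd i m (fun q => metric i q r l) p + pd i l (fun q => metric i q r m) p
     - pd i r (fun q => metric i q m l) p)).

(* so(4)-valued form of the Levi-Civita connection in the frame e, evaluated *)
(* on the m-th coordinate field:                                             *)
(* nabla_m e_b = \sum_a (levi_civita e m) a b e_a.                           *)
Definition levi_civita (e : frame) (m : 'I_4) (p : M) : 'M[R]_4 :=
  invmx (fr_mx e p) *m (pd_mx (fr_chart e) m (fr_mx e) p +
                        christoffel (fr_chart e) m p *m fr_mx e p).

End Frames.

Section TangentPlusSelfdual.
Variables (R : realType) (M : oriented_riemannian4 R).

Definition levi_civita_symbol (i j k l : 'I_4) : R :=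
  \det (\matrix_(r < 4, c < 4) (tnth [tuple i; j; k; l] r == c)%:R).

(* A 2-form \sum_(i < j) W i j dx^i /\ dx^j is its skew-symmetric matrix W;  *)
(* raise G W has the indices raised by the metric G.                         *)
Definition raise (G W : 'M[R]_4) : 'M[R]_4 := invmx G *m W *m (invmx G)^T.

Definition form_inner (G W Z : 'M[R]_4) : R :=
  2^-1 * \sum_i \sum_j raise G W i j * Z i j.

Definition hodge (G W : 'M[R]_4) : 'M[R]_4 :=
  \matrix_(k, l) (2^-1 * Num.sqrt (\det G) *
    \sum_i \sum_j raise G W i j * levi_civita_symbol i j k l).

Definition selfdual (G W : 'M[R]_4) := W^T = - W /\ hodge G W = W.

Definition sum_inner (G : 'M[R]_4) (x y : 'cV[R]_4 * 'M[R]_4) : R :=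
  (x.1^T *m G *m y.1) 0 0 + form_inner G x.2 y.2.

(* Expression in the chart i of the element written x in the chart j. *)
Definition sum_change (i j : chart M) (p : M) (x : 'cV[R]_4 * 'M[R]_4) :=
  (jac i j p *m x.1, (jac j i p)^T *m x.2 *m jac j i p).

(* Components of (X, W) in the basis e_1, ..., e_4, eta_1, eta_2, eta_3 for  *)
(* an oriented orthonormal basis e (the columns of E), where                 *)
(* eta_1 = e^12 + e^34, eta_2 = e^13 - e^24, eta_3 = e^14 + e^23.            *)
Definition sum_coord (E : 'M[R]_4) (x : 'cV[R]_4 * 'M[R]_4) : 'cV[R]_7 :=
  \col_c match fintype.split (c : 'I_(4 + 3)) with
         | inl i => (invmx E *m x.1) i 0
         | inr j => (E^T *m x.2 *m E) 0 (lift 0 j)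
         end.

Record sum_frame := SumFrame {
  sf_chart : chart M;
  sf_dom : set M;
  sf_elt : 'I_7 -> M -> 'cV[R]_4 * 'M[R]_4;
  sf_open : open sf_dom;
  sf_sub : sf_dom `<=` cdom sf_chart;
  sf_smooth1 : forall a, smooth_mx sf_dom (fun p => (sf_elt a p).1);
  sf_smooth2 : forall a, smooth_mx sf_dom (fun p => (sf_elt a p).2);
  sf_selfdual : forall p a, sf_dom p ->
    selfdual (metric sf_chart p) (sf_elt a p).2;
  sf_orthonormal : forall p a b, sf_dom p ->
    sum_inner (metric sf_chart p) (sf_elt a p) (sf_elt b p) = (a == b)%:R;
  sf_oriented : forall p E, sf_dom p -> oriented_orthonormal sf_chart p E ->
    0 < \det (\matrix_(c, a) sum_coord E (sf_elt a p) c 0)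
}.

Definition sf_trans (f f' : sum_frame) (p : M) : 'M[R]_7 :=
  \matrix_(a, b) sum_inner (metric (sf_chart f) p) (sf_elt f a p)
    (sum_change (sf_chart f) (sf_chart f') p (sf_elt f' b p)).

End TangentPlusSelfdual.

Section Bundles.
Variables (R : realType) (M : oriented_manifold4 R).
Local Notation C := R[i].

(* The bundle of oriented orthonormal frames of an oriented Euclidean vector *)
(* bundle, given by its local sections: f' = f . fb_trans f f'.              *)
Record frame_bundle (n : nat) := FrameBundle {
  fb_section : Type;
  fb_dom : fb_section -> set M;
  fb_trans : fb_section -> fb_section -> M -> 'M[R]_n
}.

(* A lift of a frame bundle to the spin group: a lift to Spin(n) of the      *)
(* transition functions between local frames whose domains cover M.          *)
Record spin_structure (n : nat) (P : frame_bundle n) := SpinStructure {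
  ss_index : Type;
  ss_frame : ss_index -> fb_section P;
  ss_trans : ss_index -> ss_index -> M -> clifford R n;
  ss_dom := fun k => fb_dom (ss_frame k);
  ss_cover : forall p, exists k, ss_dom k p;
  ss_smooth : forall k l S,
    smooth (ss_dom k `&` ss_dom l) (fun p => ss_trans k l p S);
  ss_spin : forall k l p, ss_dom k p -> ss_dom l p -> spin (ss_trans k l p);
  ss_lift : forall k l p, ss_dom k p -> ss_dom l p ->
    spin_cover (ss_trans k l p) = fb_trans (ss_frame k) (ss_frame l) p;
  ss_cocycle : forall k l m p, ss_dom k p -> ss_dom l p -> ss_dom m p ->
    ss_trans k l p * ss_trans l m p = ss_trans k m p
}.

Definition is_spin (n : nat) (P : frame_bundle n) := inhabited (spin_structure P).

(* Here the fibre is a space of matrices, column vectors in particular; the  *)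
(* vector v in the trivialisation l is vb_trans k l p v in k.                *)
Record vbundle := VBundle {
  vb_index : Type;
  vb_dom : vb_index -> set M;
  vb_rows : nat;
  vb_cols : nat;
  vb_trans : vb_index -> vb_index -> M ->
    'M[C]_(vb_rows, vb_cols) -> 'M[C]_(vb_rows, vb_cols)
}.

Definition is_vbundle (E : vbundle) :=
  [/\ forall k, open (@vb_dom E k),
      forall p, exists k, @vb_dom E k p,
      forall k l p, @vb_dom E k p -> @vb_dom E l p -> linear (@vb_trans E k l p),
      forall k p v, @vb_dom E k p -> @vb_trans E k k p v = v &
      (forall k l m p v, @vb_dom E k p -> @vb_dom E l p -> @vb_dom E m p ->
        @vb_trans E k l p (@vb_trans E l m p v) = @vb_trans E k m p v) /\
      (forall k l v,
        smooth_cmx (vb_dom k `&` vb_dom l) (fun p => @vb_trans E k l p v))].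

(* phi k l is the expression of the map in the trivialisations k of E and    *)
(* l of F.                                                                   *)
Definition is_vbundle_iso (E F : vbundle)
    (phi : vb_index E -> vb_index F -> M ->
      'M[C]_(vb_rows E, vb_cols E) -> 'M[C]_(vb_rows F, vb_cols F)) :=
  [/\ forall k l p, vb_dom k p -> vb_dom l p -> linear (phi k l p),
      forall k l p, vb_dom k p -> vb_dom l p -> bijective (phi k l p),
      forall k l v, smooth_cmx (vb_dom k `&` vb_dom l) (fun p => phi k l p v) &
      forall k k' l l' p v,
        vb_dom k p -> vb_dom k' p -> vb_dom l p -> vb_dom l' p ->
        phi k' l' p (vb_trans k' k p v) = vb_trans l' l p (phi k l p v)].

Definition is_section (E : vbundle)
    (s : vb_index E -> M -> 'M[C]_(vb_rows E, vb_cols E)) :=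
  (forall k, smooth_cmx (vb_dom k) (s k)) /\
  forall k l p, vb_dom k p -> vb_dom l p -> s k p = vb_trans k l p (s l p).

Definition spinor_bundle (n N : nat) (P : frame_bundle n)
    (Q : spin_structure P) (Delta : clifford R n -> 'M[C]_N) : vbundle :=
  {| vb_index := ss_index Q;
     vb_dom := @ss_dom _ _ Q;
     vb_rows := N; vb_cols := 1;
     vb_trans := fun k l p v => Delta (ss_trans k l p) *m v |}.

End Bundles.

Definition TM_plus_selfdual (R : realType) (M : oriented_riemannian4 R) :
    frame_bundle M 7 :=
  FrameBundle (@sf_dom R M) (@sf_trans R M).

Section Associated.
Variables (R : realType) (M : oriented_riemannian4 R).
Local Notation C := R[i].

(* Representations of Spin(4), resp. SO(4), by linear maps of 'M[C]_(r, c).  *)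
Definition spin4_rep (r c : nat) := clifford R 4 -> 'M[C]_(r, c) -> 'M[C]_(r, c).
Definition so4_rep (r c : nat) := 'M[R]_4 -> 'M[C]_(r, c) -> 'M[C]_(r, c).

Definition mx_rep (N : nat) (D : clifford R 4 -> 'M[C]_N) : spin4_rep N 1 :=
  fun a v => D a *m v.

Definition tens_rep (N N' : nat) (D : clifford R 4 -> 'M[C]_N)
    (D' : clifford R 4 -> 'M[C]_N') : spin4_rep (N * N') 1 :=
  mx_rep (fun a => D a *t D' a).

Definition end_rep (N : nat) (D : clifford R 4 -> 'M[C]_N) : spin4_rep N N :=
  fun a T => D a *m T *m invmx (D a).

(* A |-> rho a, for some lift a of A to Spin(4). This is independent of the  *)
(* lift, hence the descended representation of SO(4), when descends rho.     *)
Definition descended (r c : nat) (rho : spin4_rep r c) : so4_rep r c :=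
  fun A => rho (xget 0 [set a | spin a /\ spin_cover a = A]).

Definition descends (r c : nat) (rho : spin4_rep r c) :=
  forall a, spin a -> descended rho (spin_cover a) = rho a.

Definition Ass (r c : nat) (rho : so4_rep r c) : vbundle M :=
  {| vb_index := frame M;
     vb_dom := @fr_dom R M;
     vb_rows := r; vb_cols := c;
     vb_trans := fun e e' p => rho (fr_trans e e' p) |}.

Definition rep_iso (r c r' c' : nat) (rho : so4_rep r c) (rho' : so4_rep r' c')
    (f : 'M[C]_(r, c) -> 'M[C]_(r', c')) :=
  [/\ linear f, bijective f &
      forall A v, SO A -> f (rho A v) = rho' A (f v)].

(* The bundle map [e, v] |-> [e, f v]. *)
Definition induced_map (r c r' c' : nat) (rho' : so4_rep r' c')
    (f : 'M[C]_(r, c) -> 'M[C]_(r', c')) (e e' : frame M) (p : M)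
    (v : 'M[C]_(r, c)) : 'M[C]_(r', c') :=
  rho' (fr_trans e' e p) (f v).

Definition Ass_iso (r c r' c' : nat) (rho : so4_rep r c)
    (rho' : so4_rep r' c') :=
  exists2 f : 'M[C]_(r, c) -> 'M[C]_(r', c'), rep_iso rho rho' f &
    @is_vbundle_iso R M (Ass rho) (Ass rho') (induced_map rho' f).

(* w = d rho (X) v, where d rho : so(4) -> gl(V) is the differential at 1. *)
Definition rep_differential (r c : nat) (rho : so4_rep r c) (X : 'M[R]_4)
    (v w : 'M[C]_(r, c)) :=
  forall A : R -> 'M[R]_4, (forall t, SO (A t)) -> A 0 = 1%:M ->
    (forall k l, is_derive (0 : R) (1 : R) (fun t => A t k l : R) (X k l)) ->
    forall k l,
      is_derive (0 : R) (1 : R) (fun t => Re (rho (A t) v k l) : R) (Re (w k l)) /\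
      is_derive (0 : R) (1 : R) (fun t => Im (rho (A t) v k l) : R) (Im (w k l)).

(* The connection of Ass rho induced by the Levi-Civita connection: in the   *)
(* frame e, nabla_m s = d_m s + d rho (levi_civita e m) s.                   *)
Definition covariant_derivative (r c : nat) (rho : so4_rep r c)
    (s : frame M -> M -> 'M[C]_(r, c)) (e : frame M) (m : 'I_4) (p : M)
    (d : 'M[C]_(r, c)) :=
  exists2 w, rep_differential rho (levi_civita e m p) (s e p) w &
    d = pd_cmx (fr_chart e) m (s e) p + w.

Definition parallel (r c : nat) (rho : so4_rep r c)
    (s : frame M -> M -> 'M[C]_(r, c)) :=
  forall e m p, fr_dom e p -> covariant_derivative rho s e m p 0.

Definition SigmaM_SigmaLambda : spin4_rep ((2 + 2) * 2) 1 :=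
  tens_rep (@Delta4 R) (@Delta3 R \o @pr_plus R).
Definition SigmaPlus_SigmaLambda : spin4_rep (2 * 2) 1 :=
  tens_rep (@Delta4_plus R) (@Delta3 R \o @pr_plus R).
Definition SigmaPlus_SigmaPlus : spin4_rep (2 * 2) 1 :=
  tens_rep (@Delta4_plus R) (@Delta4_plus R).
Definition End_SigmaPlus : spin4_rep 2 2 := end_rep (@Delta4_plus R).

Definition Id_SigmaPlus (e : frame M) (p : M) : 'M[C]_2 := 1%:M.

End Associated.

Arguments SigmaM_SigmaLambda R : clear implicits.
Arguments SigmaPlus_SigmaLambda R : clear implicits.
Arguments SigmaPlus_SigmaPlus R : clear implicits.
Arguments End_SigmaPlus R : clear implicits.

(* Main.v *)
Require Import Defs.
From HB Require Import structures.
From mathcomp Require Import all_boot all_order all_algebra zify ring lra.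
From mathcomp Require Import all_classical all_reals all_analysis.

Set Implicit Arguments.
Unset Strict Implicit.
Unset Printing Implicit Defensive.

Import Order.TTheory GRing.Theory Num.Theory.
Import numFieldNormedType.Exports.
From mathcomp.real_closed Require Import complex mxtens.
Import Defs.

Local Open Scope ring_scope.

(** The group Spin(4) is a product of two groups of unit quaternions because
    the volume element of Cl_4 commutes with even elements and has square 1.
    Concretely, even elements of Cl_4 are y + z e4 with y, z in Cl_3, and
    [pr_plus] sends e4 to - omega, where omega = e1 e2 e3 is central in Cl_3
    with square 1; it sends the product of two unit vectors to a product of
    two unit quaternions, so that it maps Spin(4) to Spin(3) ([pr_plusM],
    [spin_pr_plus]).

    The representation Delta_4^+ is the composition of Delta_3 with this
    projection ([Delta4_plusE]), so Sigma^+ (x) Sigma Lambda^+ and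
    Sigma^+ (x) Sigma^+ are given by equal representations. As Spin(4) acts on Delta_4^+ = C^2 with
    determinant 1 ([det_Delta4_plus]), the area form is invariant and
    identifies C^2 with its dual, hence the tensor square with the
    endomorphisms ([tens_end_conj]).

    The element (a, pr_plus a) of Spin(4) x Spin(3) has an image in Spin(7)
    that does not change when a is replaced by - a. This defines a
    homomorphism from SO(4) to Spin(7). It lifts the action of SO(4) on the
    sum of R^4 and the self-dual forms, because the rotation defined by
    pr_plus a is that of the self-dual forms ([sdform_rotation]). Applied to
    the SO(4)-valued cocycle of all local orthonormal frames, it gives a
    spin structure on TM + Lambda^+ ([sum_spin_structure]). Under Delta_7 the
    element (a, pr_plus a) acts as the tensor product of Delta_4 a and
    Delta_3 (pr_plus a) ([Delta7_tens]), which identifies the spinor bundle.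

    Whatever has to descend from Spin(4) to SO(4) is quadratic in the
    coordinates of a. The products of two coordinates of a are polynomials in
    the entries of the rotation that a defines ([cover_quadE]): averaging
    x |-> x - (A e_i) x e_i over the basis vectors e_i recovers a from a y and
    the rotation A, up to a scalar. Hence quadratic expressions in an
    arbitrary, pointwise chosen lift are well defined and smooth
    ([quadratic_lift], [smooth_quadratic_lift]).

    That the associated bundles are vector bundles also requires orthonormal
    frames near every point, provided by the Cholesky factorisation of the
    metric ([smooth_cholesky]), and the cocycle identity for them, which is
    the chain rule ([jac_comp]). The orientation and the transition functions
    of the frames of TM + Lambda^+ are computed in an orthonormal frame, where
    the Hodge star becomes the standard one ([hodge_conj]).

    Finally the identity of Sigma^+ is fixed by the conjugation action, so it
    is constant in every frame and both terms of its covariant derivative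
    vanish ([Id_SigmaPlus_parallel]). *)

(** * The Clifford algebra *)

Section CliffordAlgebra.
Variables (R : comNzRingType) (n : nat).
Local Notation Cl := (clifford R n).
Implicit Types (a b : Cl) (A B S T : {set 'I_n}) (v w : 'rV[R]_n).

Definition clscale (r : R) a : Cl := [ffun S => r * a S].

Let clscaleA r s a : clscale r (clscale s a) = clscale (r * s) a.
Proof. by apply/ffunP => S; rewrite !ffunE mulrA. Qed.

Let clscale1 : left_id 1 clscale.
Proof. by move=> a; apply/ffunP => S; rewrite !ffunE mul1r. Qed.

Let clscaleDr : right_distributive clscale +%R.
Proof. by move=> r a b; apply/ffunP => S; rewrite !ffunE mulrDr. Qed.

Let clscaleDl a : {morph clscale^~ a : r s / r + s}.
Proof. by move=> r s; apply/ffunP => S; rewrite !ffunE mulrDl. Qed.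

HB.instance Definition _ := GRing.Zmodule_isLmodule.Build R (clifford R n)
  clscaleA clscale1 clscaleDr clscaleDl.

Lemma clscaleE r a S : (r *: a) S = r * a S.
Proof. by rewrite ffunE. Qed.

Lemma claddE a b S : (a + b) S = a S + b S.
Proof. by rewrite ffunE. Qed.

Lemma clsubE a b S : (a - b) S = a S - b S.
Proof. by rewrite !ffunE. Qed.

Lemma clmulE a b S :
  (a * b) S = \sum_A csign R A (symdiff A S) * (a A * b (symdiff A S)).
Proof. by rewrite ffunE. Qed.

Lemma cl1E S : (1 : Cl) S = (S == finset.set0)%:R.
Proof. by rewrite ffunE. Qed.

Let clscaleAl (r : R) a b : r *: (a * b) = (r *: a) * b.
Proof.
apply/ffunP => S; rewrite clscaleE !clmulE mulr_sumr; apply: eq_bigr => A _.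
by rewrite clscaleE; ring.
Qed.

HB.instance Definition _ :=
  GRing.Lmodule_isLalgebra.Build R (clifford R n) clscaleAl.

Let clscaleAr (r : R) a b : r *: (a * b) = a * (r *: b).
Proof.
apply/ffunP => S; rewrite clscaleE !clmulE mulr_sumr; apply: eq_bigr => A _.
by rewrite clscaleE; ring.
Qed.

HB.instance Definition _ :=
  GRing.Lalgebra_isAlgebra.Build R (clifford R n) clscaleAr.

Definition cle S : Cl := [ffun T => (T == S)%:R].

Lemma cl_sum_coef (I : Type) (r : seq I) (P : pred I) (F : I -> Cl) S :
  (\sum_(i <- r | P i) F i) S = \sum_(i <- r | P i) F i S.
Proof.
by elim/big_rec2: _ => [|i x y _ <-]; rewrite ffunE.
Qed.

Lemma cleE a : a = \sum_S a S *: cle S.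
Proof.
apply/ffunP => T; rewrite cl_sum_coef (bigD1 T) //= clscaleE ffunE eqxx mulr1.
rewrite big1 ?addr0 // => S /negPf ST; rewrite clscaleE ffunE eq_sym ST.
by rewrite mulr0.
Qed.

Lemma cle_mul A B : cle A * cle B = csign R A B *: cle (symdiff A B).
Proof.
apply/ffunP => S; rewrite clmulE (bigD1 A) //= !ffunE eqxx mul1r big1 ?addr0.
  rewrite -(inj_eq (inv_inj (symdiffK A))) symdiffK.
  by case: eqP => [->|]; rewrite ?mulr0 // symdiffK.
by move=> T /negPf TA; rewrite !ffunE TA mul0r mulr0.
Qed.

Lemma cle0 : cle finset.set0 = 1.
Proof. by apply/ffunP => S; rewrite !ffunE. Qed.

Lemma clvecE v : clvec v = \sum_i v 0 i *: cle [set i]%SET.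
Proof.
apply/ffunP => S; rewrite cl_sum_coef ffunE big_mkcond; apply: eq_bigr => i _.
by rewrite clscaleE ffunE; case: eqP; rewrite ?mulr1 ?mulr0.
Qed.

Lemma clvec_coef v i : clvec v [set i]%SET = v 0 i.
Proof.
rewrite ffunE (big_pred1 i) // => j.
by rewrite (inj_eq finset.set1_inj) eq_sym.
Qed.

Fact clvec_is_linear : linear (@clvec R n).
Proof.
move=> r v w; rewrite !clvecE scaler_sumr -big_split; apply: eq_bigr => i _.
by rewrite !mxE scalerDl scalerA.
Qed.

HB.instance Definition _ := GRing.isLinear.Build R _ _ _ (@clvec R n)
  clvec_is_linear.

Lemma clvec_delta i : clvec (delta_mx 0 i) = cle [set i]%SET.
Proof.
rewrite clvecE (bigD1 i) //= mxE !eqxx scale1r big1 ?addr0 // => j /negPf ji.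
by rewrite mxE ji andbF scale0r.
Qed.

Definition dotr v w := \sum_i v 0 i * w 0 i.

Lemma clvec_sq v : clvec v * clvec v = - dotr v v *: 1.
Proof.
rewrite clvec_sqr; apply/ffunP => S; rewrite clscaleE !ffunE /dotr.
by under eq_bigr do rewrite expr2.
Qed.

Lemma dotr_delta i : dotr (delta_mx 0 i) (delta_mx 0 i) = 1.
Proof.
rewrite /dotr (bigD1 i) //= !mxE !eqxx mulr1 big1 ?addr0 // => l /negPf li.
by rewrite !mxE li andbF mulr0.
Qed.

Lemma dotrC v w : dotr v w = dotr w v.
Proof. by apply: eq_bigr => i _; rewrite mulrC. Qed.

Lemma dotrDl u v w : dotr (u + v) w = dotr u w + dotr v w.
Proof. by rewrite -big_split; apply: eq_bigr => i _; rewrite mxE mulrDl. Qed.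

Lemma dotrZl r v w : dotr (r *: v) w = r * dotr v w.
Proof. by rewrite mulr_sumr; apply: eq_bigr => i _; rewrite mxE mulrA. Qed.

Lemma dotrDr u v w : dotr u (v + w) = dotr u v + dotr u w.
Proof. by rewrite !(dotrC u) dotrDl. Qed.

Lemma dotrZr r v w : dotr v (r *: w) = r * dotr v w.
Proof. by rewrite !(dotrC v) dotrZl. Qed.

Lemma dotrE v w : v *m w^T = (dotr v w)%:M.
Proof.
apply/matrixP => i j; rewrite !mxE !ord1 eqxx mulr1n.
by apply: eq_bigr => k _; rewrite !mxE.
Qed.

(** Polarisation of the relation v * v = - <v, v>. *)
Lemma clvec_anticomm v w :
  clvec v * clvec w + clvec w * clvec v = (- (2 * dotr v w)) *: 1.
Proof.
have solve (V : zmodType) (p q r s e : V) :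
    p + q + (r + s) = e -> q + r = e - p - s.
  by move<-; rewrite -(addrA p) (addrC p) (addrA q) !addrK.
have := clvec_sq (v + w).
rewrite raddfD /= mulrDl !mulrDr => /solve ->.
rewrite !clvec_sq dotrDl !dotrDr (dotrC w v) -!scalerBl; congr (_ *: _); ring.
Qed.

End CliffordAlgebra.

(** * Reversal and grading *)

Section Parity.
Variables (R : comNzRingType) (n : nat).
Local Notation Cl := (clifford R n).
Implicit Types (a b : Cl) (A B S T : {set 'I_n}) (v w : 'rV[R]_n).

Lemma sign_card A : \prod_(i in A) (-1) = (-1) ^+ #|A| :> R.
Proof. by rewrite prodr_const. Qed.

Lemma sign_card_symdiff A B :
  (-1) ^+ #|symdiff A B| = (-1) ^+ #|A| * (-1) ^+ #|B| :> R.
Proof. by rewrite -!sign_card prod_symdiff // => i; rewrite mulrNN mulr1. Qed.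

Lemma csign_sqr A B : csign R A B * csign R A B = 1.
Proof.
rewrite /csign -big_split big1 // => i _ /=; rewrite -big_split big1 // => j _ /=.
by case: ifP; rewrite ?mulrNN mulr1.
Qed.

(** The pairs (i, j) of A x A with j < i contribute C(|A|, 2) signs and the
    diagonal |A| more. Any element i may be removed in the induction,
    because the signs of (i, j) and (j, i) multiply to -1 when j differs
    from i. *)
Lemma csign_diag A : csign R A A = (-1) ^+ 'C(#|A|, 2) * (-1) ^+ #|A|.
Proof.
have [k] := ubnP #|A|; elim: k A => // k IH A Ak.
have [->|[i iA]] := finset.set_0Vmem A.
  by rewrite finset.cards0 csign0l mulr1.
have AE : A = symdiff [set i]%SET (A :\ i).
  by apply/setP => j; rewrite !finset.inE; case: eqP => // ->; rewrite iA.
have cA : #|A| = #|(A :\ i)%SET|.+1 by rewrite (finset.cardsD1 i) iA.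
rewrite {1 2}AE csignDl !csignDr csign1 leqnn IH; last by rewrite -ltnS -cA.
rewrite cA binS bin1 exprD.
suff -> : csign R (A :\ i)%SET [set i]%SET = csign R [set i]%SET (A :\ i)%SET *
    (-1) ^+ #|(A :\ i)%SET|.
  rewrite [(-1) ^+ _.+1]exprS; move: (csign_sqr [set i]%SET (A :\ i)%SET).
  by move=> c2; ring: c2.
rewrite -sign_card /csign finset.big_set1 -big_split; apply: eq_bigr => j /=.
rewrite !finset.inE finset.big_set1 -(inj_eq val_inj) /= => /andP[ji _].
by case: ltngtP ji; rewrite ?mulrNN ?mulr1 ?mul1r.
Qed.

Fact clrev_is_linear : linear (@clrev R n).
Proof. by move=> r a b; apply/ffunP => S; rewrite !ffunE; ring. Qed.

HB.instance Definition _ := GRing.isLinear.Build R _ _ _ (@clrev R n)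
  clrev_is_linear.

Lemma clrev_cle S : clrev (cle R S) = (-1) ^+ 'C(#|S|, 2) *: cle R S.
Proof.
by apply/ffunP => T; rewrite !ffunE; case: eqP => [->//|]; rewrite !mulr0.
Qed.

(** The sign of the reversal is thus a value of the bicharacter csign, up to
    the parity character; this is what makes reversal an anti-automorphism. *)
Lemma rsgnE A : (-1) ^+ 'C(#|A|, 2) = csign R A A * (-1) ^+ #|A| :> R.
Proof. by rewrite csign_diag -mulrA -exprMn mulrNN mulr1 expr1n mulr1. Qed.

(** On basis elements the identity compares the signs of A, B and of their
    symmetric difference; by bimultiplicativity of csign the last is the
    product of the former two and of csign A B and csign B A, which are the
    signs of the two products. *)
Lemma clrevM a b : clrev (a * b) = clrev b * clrev a.
Proof.
rewrite {1}(cleE a) {1}(cleE b) [in RHS](cleE a) [in RHS](cleE b).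
rewrite mulr_suml !linear_sum mulr_sumr /=; apply: eq_bigr => A _.
rewrite mulr_sumr linear_sum mulr_suml /=; apply: eq_bigr => B _.
rewrite -scalerAl -scalerAr !linearZ /= -scalerAl -scalerAr scalerA.
rewrite [in RHS]scalerA [b B * _]mulrC; congr (_ *: _).
rewrite cle_mul linearZ /= !clrev_cle -scalerAl -scalerAr cle_mul.
rewrite symdiffC !scalerA; congr (_ *: _).
rewrite !rsgnE sign_card_symdiff csignDl !csignDr.
by move: (csign_sqr A B) => c2; ring: c2.
Qed.

Lemma clrevK : involutive (@clrev R n).
Proof.
move=> a; apply/ffunP => S; rewrite !ffunE mulrA -exprD addnn -mul2n exprM.
by rewrite sqrrN expr1n expr1n mul1r.
Qed.

Lemma clrev1 : clrev (1 : Cl) = 1.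
Proof. by rewrite -cle0 clrev_cle finset.cards0 scale1r. Qed.

Lemma clrev_vec v : clrev (clvec v) = clvec v.
Proof.
rewrite !clvecE linear_sum; apply: eq_bigr => i _ /=.
by rewrite linearZ /= clrev_cle finset.cards1 scale1r.
Qed.

(** The components of the Z/2-grading, [true] being the odd one. *)
Definition clparity (p : bool) a := forall S, odd #|S| != p -> a S = 0.

Lemma odd_symdiff A B : odd #|symdiff A B| = odd #|A| (+) odd #|B|.
Proof.
have e : (#|symdiff A B| + 2 * #|(A :&: B)%SET| = #|A| + #|B|)%N.
  have -> : symdiff A B = ((A :\: B) :|: (B :\: A))%SET.
    by apply/setP => i; rewrite !finset.inE; case: (i \in A); case: (i \in B).
  have D0 : ((A :\: B) :&: (B :\: A) = finset.set0)%SET.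
    by apply/setP => i; rewrite !finset.inE; case: (i \in A); case: (i \in B).
  rewrite finset.cardsU D0 finset.cards0 subn0.
  have := finset.cardsID B A; have := finset.cardsID A B.
  by rewrite (finset.setIC B A); lia.
by rewrite -oddD -e oddD oddM andFb addbF.
Qed.

Lemma clparityM p q a b :
  clparity p a -> clparity q b -> clparity (p (+) q) (a * b).
Proof.
move=> pa qb S oS; rewrite clmulE big1 // => A _.
have [oA|/pa ->] := eqVneq (odd #|A|) p; last by rewrite mul0r mulr0.
have [oB|/qb ->] := eqVneq (odd #|symdiff A S|) q; last by rewrite !mulr0.
by move: oS; rewrite -oA -oB odd_symdiff addKb eqxx.
Qed.

Lemma clparityD p a b : clparity p a -> clparity p b -> clparity p (a + b).
Proof. by move=> pa pb S oS; rewrite ffunE pa // pb // addr0. Qed.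

Lemma clparityZ p r a : clparity p a -> clparity p (r *: a).
Proof. by move=> pa S oS; rewrite clscaleE pa // mulr0. Qed.

Lemma clparity_cle S : clparity (odd #|S|) (cle R S).
Proof.
by move=> T oT; rewrite ffunE; have [TS|//] := eqVneq T S; rewrite TS eqxx in oT.
Qed.

Lemma clparity1 : clparity false (1 : Cl).
Proof. by rewrite -cle0; have := @clparity_cle finset.set0; rewrite finset.cards0. Qed.

Lemma clparity_vec v : clparity true (clvec v).
Proof.
move=> S oS; rewrite ffunE big1 // => i /eqP SE.
by move: oS; rewrite SE finset.cards1.
Qed.

Lemma clparity_rev p a : clparity p a -> clparity p (clrev a).
Proof. by move=> pa S oS; rewrite ffunE pa // mulr0. Qed.

End Parity.

Section MonotoneInclusion.
Variables (R : comNzRingType) (m n : nat) (f : 'I_m -> 'I_n).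
Hypothesis f_mono : forall i j, (f i <= f j)%N = (i <= j)%N.
Implicit Types (a b : clifford R m) (A B S : {set 'I_m}).

Lemma mono_inj : injective f.
Proof.
move=> i j fij; apply/val_inj/eqP.
by rewrite eqn_leq -!f_mono fij leqnn.
Qed.

Definition clmap a : clifford R n := \sum_S a S *: cle R (f @: S)%SET.

Fact clmap_is_linear : linear clmap.
Proof.
move=> r a b; rewrite /clmap scaler_sumr -big_split; apply: eq_bigr => S _ /=.
by rewrite !ffunE scalerDl scalerA.
Qed.

HB.instance Definition _ := GRing.isLinear.Build R _ _ _ clmap clmap_is_linear.

Lemma clmap_cle A : clmap (cle R A) = cle R (f @: A)%SET.
Proof.
rewrite /clmap (bigD1 A) //= ffunE eqxx scale1r big1 ?addr0 // => S /negPf SA.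
by rewrite ffunE SA scale0r.
Qed.

Lemma csign_imset A B : csign R (f @: A)%SET (f @: B)%SET = csign R A B.
Proof.
rewrite /csign big_imset /=; last by move=> ? ? _ _ /mono_inj.
apply: eq_bigr => i _; rewrite big_imset /=; last by move=> ? ? _ _ /mono_inj.
by apply: eq_bigr => j _; rewrite f_mono.
Qed.

Lemma symdiff_imset A B :
  symdiff (f @: A)%SET (f @: B)%SET = (f @: symdiff A B)%SET.
Proof.
apply/setP => k; rewrite finset.inE; apply/idP/imsetP => [|[j]].
  have [/imsetP[i iA ->]|kA] := boolP (k \in (f @: A)%SET).
    rewrite (mem_imset _ _ mono_inj) => /= iB; exists i => //.
    by rewrite finset.inE iA.
  move=> /= /imsetP[i iB kE]; exists i => //; rewrite finset.inE iB addbT.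
  by apply: contra kA => iA; rewrite kE (mem_imset _ _ mono_inj).
by rewrite finset.inE => jAB ->; rewrite !(mem_imset _ _ mono_inj).
Qed.

Lemma clmapM a b : clmap (a * b) = clmap a * clmap b.
Proof.
rewrite {1}(cleE a) {1}(cleE b) [in RHS](cleE a) [in RHS](cleE b).
rewrite mulr_suml !linear_sum mulr_suml /=; apply: eq_bigr => A _.
rewrite mulr_sumr linear_sum mulr_sumr /=; apply: eq_bigr => B _.
rewrite -scalerAl -scalerAr !linearZ /= -scalerAl -scalerAr.
rewrite cle_mul !linearZ /= !clmap_cle cle_mul csign_imset symdiff_imset.
by rewrite !scalerA; congr (_ *: _); ring.
Qed.

Lemma clmap1 : clmap 1 = 1.
Proof. by rewrite -cle0 clmap_cle imset0 cle0. Qed.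

Lemma clmap_vec (v : 'rV[R]_m) : clmap (clvec v) = \sum_i v 0 i *: cle R [set f i]%SET.
Proof.
rewrite clvecE linear_sum; apply: eq_bigr => i _ /=.
by rewrite linearZ /= clmap_cle imset_set1.
Qed.

Lemma clrev_map a : clrev (clmap a) = clmap (clrev a).
Proof.
rewrite [in RHS](cleE a) !linear_sum; apply: eq_bigr => S _ /=.
rewrite !linearZ /= !clrev_cle [in RHS]linearZ /= clmap_cle.
by rewrite (card_imset _ mono_inj).
Qed.

Lemma clmap_coef a S : clmap a (f @: S)%SET = a S.
Proof.
rewrite /clmap cl_sum_coef (bigD1 S) //= clscaleE ffunE eqxx mulr1.
rewrite big1 ?addr0 // => T /negPf TS; rewrite clscaleE ffunE.
by rewrite (inj_eq (imset_inj mono_inj)) eq_sym TS mulr0.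
Qed.

End MonotoneInclusion.

(** * Orthogonal sums and reflections *)

Section GradedProduct.
Variables (R : comNzRingType) (m n : nat).
Implicit Types (a : clifford R m) (b : clifford R n).

Lemma lshift_mono (i j : 'I_m) : (lshift n i <= lshift n j)%N = (i <= j)%N.
Proof. by []. Qed.

Lemma rshift_mono (i j : 'I_n) : (rshift m i <= rshift m j)%N = (i <= j)%N.
Proof. by rewrite leq_add2l. Qed.

Definition cl_inl : clifford R m -> clifford R (m + n) := clmap (lshift n).
Definition cl_inr : clifford R n -> clifford R (m + n) := clmap (@rshift m n).

HB.instance Definition _ := GRing.Linear.on cl_inl.
HB.instance Definition _ := GRing.Linear.on cl_inr.
HB.instance Definition _ := GRing.isMonoidMorphism.Build _ _ cl_inl
  (conj (clmap1 R (lshift n)) (clmapM lshift_mono)).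
HB.instance Definition _ := GRing.isMonoidMorphism.Build _ _ cl_inr
  (conj (clmap1 R (@rshift m n)) (clmapM rshift_mono)).

(** Every index of the left summand precedes every index of the right one,
    so there is nothing to exchange. *)
Lemma csign_lr (A : {set 'I_m}) (B : {set 'I_n}) :
  csign R (lshift n @: A)%SET (@rshift m n @: B)%SET = 1.
Proof.
rewrite /csign big1 // => _ /imsetP[i _ ->]; rewrite big1 // => _ /imsetP[j _ ->].
by rewrite /= leqNgt (leq_trans (ltn_ord i)) ?leq_addr.
Qed.

Lemma csign_rl (A : {set 'I_m}) (B : {set 'I_n}) :
  csign R (@rshift m n @: B)%SET (lshift n @: A)%SET = (-1) ^+ (#|B| * #|A|).
Proof.
rewrite /csign; transitivity
    (\prod_(i in (@rshift m n @: B)%SET) \prod_(j in (lshift n @: A)%SET) (-1) : R).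
  apply: eq_bigr => _ /imsetP[i _ ->]; apply: eq_bigr => _ /imsetP[j _ ->].
  by rewrite /= (leq_trans (ltnW (ltn_ord j))) ?leq_addr.
under eq_bigr do rewrite sign_card (card_imset _ (@lshift_inj _ _)).
by rewrite prodr_const (card_imset _ (@rshift_inj _ _)) -exprM mulnC.
Qed.

(** Generators of two orthogonal subspaces anticommute, so that each of the
    |A| |B| exchanges costs a sign. *)
Lemma cl_inr_inl p q a b : clparity p a -> clparity q b ->
  cl_inr b * cl_inl a = (-1) ^+ (p && q) *: (cl_inl a * cl_inr b).
Proof.
move=> pa qb; rewrite (cleE a) (cleE b) [cl_inl _ in RHS]linear_sum.
rewrite [in RHS]mulr_suml scaler_sumr.
rewrite [cl_inl _ in LHS]linear_sum mulr_sumr /=; apply: eq_bigr => A _.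
rewrite [cl_inr _ in RHS]linear_sum [cl_inr _]linear_sum mulr_suml mulr_sumr.
rewrite scaler_sumr /=; apply: eq_bigr => B _.
have [oA|/pa ->] := eqVneq (odd #|A|) p; last first.
  by rewrite !scale0r raddf0 mulr0 mul0r scaler0.
have [oB|/qb ->] := eqVneq (odd #|B|) q; last first.
  by rewrite !scale0r raddf0 mulr0 mul0r scaler0.
rewrite !linearZ /= -!scalerAl -!scalerAr !scalerA.
rewrite /cl_inl /cl_inr !clmap_cle !cle_mul csign_lr csign_rl symdiffC !scalerA.
congr (_ *: _); rewrite -signr_odd oddM oA oB andbC; ring.
Qed.

Lemma clvec_row (u : 'rV[R]_m) (v : 'rV[R]_n) :
  clvec (row_mx u v) = cl_inl (clvec u) + cl_inr (clvec v).
Proof.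
rewrite clvecE big_split_ord /cl_inl /cl_inr !clmap_vec /=.
by congr (_ + _); apply: eq_bigr => i _; rewrite (row_mxEl, row_mxEr).
Qed.

Lemma clrev_inl a : clrev (cl_inl a) = cl_inl (clrev a).
Proof. exact: (clrev_map lshift_mono). Qed.

Lemma clrev_inr b : clrev (cl_inr b) = cl_inr (clrev b).
Proof. exact: (clrev_map rshift_mono). Qed.

End GradedProduct.

Section CliffordProducts.
Variables (R : comNzRingType) (n : nat).
Local Notation Cl := (clifford R n).
Implicit Types (a b : Cl) (v w : 'rV[R]_n) (vs : seq 'rV[R]_n).

Definition unit_vectors vs := forall v, v \in vs -> \sum_i v 0 i ^+ 2 = 1.

Definition clprod vs : Cl := \prod_(v <- vs) clvec v.

(** The transpose turns the action on row vectors into that of A on column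
    vectors, so that [acts] is multiplicative without reversing the order.
    The elements a range over products of unit vectors, for which [clrev a]
    is the inverse of a up to sign; the sign is the one for which a single
    unit vector acts by a reflection. *)
Definition acts a (A : 'M[R]_n) :=
  forall w, a * clvec w * clrev a = clvec (w *m A^T).

Definition reflection v : 'M[R]_n := 1%:M - 2 *: (v^T *m v).

Lemma dotr_sqr v : dotr v v = \sum_i v 0 i ^+ 2.
Proof. by apply: eq_bigr => i _; rewrite expr2. Qed.

Lemma unit_consP v vs :
  unit_vectors (v :: vs) <-> dotr v v = 1 /\ unit_vectors vs.
Proof.
rewrite dotr_sqr; split=> [u|[u1 u] w].
  by split=> [|w wvs]; apply: u; rewrite inE ?eqxx ?wvs ?orbT.
by rewrite inE => /predU1P[->//|]; exact: u.
Qed.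

Lemma refl_tr v : (reflection v)^T = reflection v.
Proof. by rewrite /reflection linearB linearZ /= trmx_mul trmxK tr_scalar_mx. Qed.

Lemma mul_refl w v : w *m reflection v = w - (2 * dotr w v) *: v.
Proof.
rewrite mulmxBr mulmx1 -scalemxAr mulmxA dotrE.
by rewrite mul_scalar_mx scalerA.
Qed.

(** Moving v past w in v w v by the anticommutation relation gives -2 <w, v>
    v + w, because v * v = -1. *)
Lemma acts_reflection v : dotr v v = 1 -> acts (clvec v) (reflection v).
Proof.
move=> v1 w; rewrite clrev_vec refl_tr mul_refl.
have -> : clvec v * clvec w = (- (2 * dotr w v)) *: 1 - clvec w * clvec v.
  by rewrite -(clvec_anticomm w v) [X in X - _]addrC addrK.
rewrite mulrBl -scalerAl mul1r -mulrA clvec_sq v1 -scalerAr mulr1.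
by rewrite linearB [in RHS]linearZ /= scaleN1r opprK scaleNr addrC.
Qed.

Lemma acts1 : acts 1 1%:M.
Proof. by move=> w; rewrite clrev1 mul1r mulr1 trmx1 mulmx1. Qed.

Lemma actsM a b A B : acts a A -> acts b B -> acts (a * b) (A *m B).
Proof.
move=> aA bB w; rewrite clrevM trmx_mul mulmxA -aA -bB; rewrite !mulrA.
by [].
Qed.

Lemma acts_cover (a : Cl) A i j :
  acts a A -> (a * clvec (delta_mx 0 j) * clrev a) [set i]%SET = A i j.
Proof. by move=> ->; rewrite clvec_coef -rowE !mxE. Qed.

Lemma clprod_cons v vs : clprod (v :: vs) = clvec v * clprod vs.
Proof. by rewrite /clprod big_cons. Qed.

Lemma clprod_cat vs ws : clprod (vs ++ ws) = clprod vs * clprod ws.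
Proof. by rewrite /clprod big_cat. Qed.

Lemma clprod_parity vs : clparity (odd (size vs)) (clprod vs).
Proof.
elim: vs => [|v vs IH]; first by rewrite /clprod big_nil; exact: clparity1.
by rewrite clprod_cons /= -addTb; apply: clparityM => //; exact: clparity_vec.
Qed.

Lemma clrev_prod vs : clrev (clprod vs) = clprod (rev vs).
Proof.
elim: vs => [|v vs IH]; first by rewrite /clprod !big_nil clrev1.
rewrite clprod_cons clrevM clrev_vec IH rev_cons -cats1 clprod_cat.
by rewrite /clprod big_seq1.
Qed.

Lemma clprod_revr vs : unit_vectors vs ->
  clprod vs * clrev (clprod vs) = (-1) ^+ size vs.
Proof.
elim: vs => [_|v vs IH /unit_consP[v1 /IH vs1]].
  by rewrite /clprod !big_nil clrev1 mulr1.
rewrite clprod_cons clrevM clrev_vec mulrA -(mulrA (clvec v)) vs1.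
by rewrite commr_sign -mulrA clvec_sq v1 scaleN1r mulrN1 exprS mulN1r.
Qed.

End CliffordProducts.

(** * The spin group and the rotation group *)

Section SpinGroup.
Variables (R : realType) (n : nat).
Local Notation Cl := (clifford R n).
Implicit Types (a b : Cl) (v w : 'rV[R]_n) (vs : seq 'rV[R]_n) (A B : 'M[R]_n).

Lemma acts_spin_cover a A : acts a A -> spin_cover a = A.
Proof. by move=> aA; apply/matrixP => i j; rewrite mxE (acts_cover _ _ aA). Qed.

(** The two block triangular factorisations of the same matrix give det (1 -
    u v) = 1 - v u for a column u and a row v; here v u = 2. *)
Lemma det_refl v : dotr v v = 1 -> \det (reflection v) = -1.
Proof.
move=> v1; rewrite /reflection; set u := (2 *: v^T).
have -> : 2 *: (v^T *m v) = u *m v by rewrite -scalemxAl.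
pose L := block_mx 1%:M 0 u 1%:M : 'M[R]_(1 + n).
have e1 : block_mx 1%:M v u 1%:M = L *m block_mx 1%:M v 0 (1%:M - u *m v).
  by rewrite mulmx_block !mul0mx !mulmx0 !mul1mx !mulmx1 !addr0 addrC subrK.
have e2 : block_mx 1%:M v u 1%:M = block_mx (1%:M - v *m u) v 0 1%:M *m L.
  by rewrite mulmx_block !mul0mx !mulmx0 !mul1mx !mulmx1 !add0r subrK.
have := congr1 determinant e1; rewrite e2 !det_mulmx det_lblock !det_ublock.
rewrite !det1 !mul1r !mulr1 => <-.
rewrite det_mx11 !mxE eqxx.
have -> : \sum_j v 0 j * u j 0 = 2 * dotr v v.
  by rewrite mulr_sumr; apply: eq_bigr => j _; rewrite !mxE; ring.
by rewrite v1 /=; ring.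
Qed.

Lemma refl_orth v : dotr v v = 1 -> (reflection v)^T *m reflection v = 1%:M.
Proof.
move=> v1; rewrite refl_tr; apply/row_matrixP => i; rewrite !rowE mulmxA.
rewrite !mul_refl mulmx1; set w := delta_mx _ _.
have -> : dotr (w - (2 * dotr w v) *: v) v = - dotr w v.
  by rewrite -scaleNr dotrDl dotrZl v1; ring.
by rewrite mulrN scaleNr opprK subrK.
Qed.

Lemma clprod_acts vs : unit_vectors vs ->
  exists A, [/\ acts (clprod vs) A, A^T *m A = 1%:M & \det A = (-1) ^+ size vs].
Proof.
elim: vs => [_|v vs IH /unit_consP[v1 /IH[A [aA AA dA]]]].
  exists 1%:M; rewrite /clprod big_nil; split; first exact: acts1.
    by rewrite trmx1 mulmx1.
  by rewrite det1 expr0.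
exists (reflection v *m A); rewrite clprod_cons; split.
- by apply: actsM => //; exact: acts_reflection.
- by rewrite trmx_mul mulmxA -(mulmxA A^T) refl_orth // mulmx1.
- by rewrite det_mulmx det_refl // dA exprS.
Qed.

Lemma dotr_orth A v w : A^T *m A = 1%:M -> dotr (v *m A^T) (w *m A^T) = dotr v w.
Proof.
move=> AA; have := dotrE (v *m A^T) (w *m A^T).
rewrite trmx_mul trmxK mulmxA -(mulmxA v) AA mulmx1 dotrE.
by move=> /matrixP/(_ 0 0); rewrite !mxE eqxx !mulr1n.
Qed.

Lemma dotr_gt0 v : v != 0 -> 0 < dotr v v.
Proof.
move=> v0; rewrite dotr_sqr lt_def sumr_ge0 ?andbT; last by move=> i _; exact: sqr_ge0.
apply: contra v0; rewrite psumr_eq0 => [/allP v0|i _]; last exact: sqr_ge0.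
apply/eqP/rowP => i; apply/eqP; rewrite mxE -sqrf_eq0.
by apply: v0; rewrite mem_index_enum.
Qed.

(** The reflection in the hyperplane orthogonal to v - w exchanges the unit
    vectors v and w and fixes what pairs equally with both; u is v - w,
    normalised. *)
Lemma refl_swap v w : dotr v v = 1 -> dotr w w = 1 -> v != w ->
  exists2 u, dotr u u = 1 & v *m reflection u = w /\
    forall x, dotr x v = dotr x w -> x *m reflection u = x.
Proof.
move=> v1 w1 vw; pose d := v - w; pose s := Num.sqrt (dotr d d).
have d0 : 0 < dotr d d by rewrite dotr_gt0 // subr_eq0.
have s0 : s != 0 by rewrite gt_eqF // sqrtr_gt0.
have ss : s ^+ 2 = dotr d d by rewrite sqr_sqrtr // ltW.
have dvd : dotr v d * 2 = dotr d d.
  by rewrite /d -(scaleN1r w) !dotrDl !dotrDr !dotrZl !dotrZr v1 w1 (dotrC w v); ring.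
exists (s^-1 *: d).
  by rewrite dotrZl dotrZr -ss; field.
have reflE x : x *m reflection (s^-1 *: d) = x - (2 * dotr x d / s ^+ 2) *: d.
  by rewrite mul_refl dotrZr scalerA; congr (_ - _ *: _); field.
split=> [|x xvw]; rewrite reflE.
  by rewrite mulrC [2 * _]mulrC dvd -ss mulVf ?expf_neq0 // scale1r subKr.
suff -> : dotr x d = 0 by rewrite mulr0 mul0r scale0r subr0.
by rewrite /d -(scaleN1r w) dotrDr dotrZr xvw; ring.
Qed.

(** Every orthogonal matrix is a product of reflections. One reflection
    carries the image of a basis vector e_j back to e_j; it fixes the e_i
    already fixed by the matrix, since these pair equally with e_j and with
    its image. Hence after at most n reflections the identity is reached. *)
Lemma cartan_dieudonne A : A^T *m A = 1%:M ->
  exists2 vs, unit_vectors vs & acts (clprod vs) A.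
Proof.
(* Induction on the number k of basis vectors still to be fixed. *)
suff H : forall k, (k <= n)%N -> forall B, B^T *m B = 1%:M ->
    (forall i : 'I_n, (i < n - k)%N -> delta_mx 0 i *m B^T = (delta_mx 0 i : 'rV_n)) ->
    exists2 vs, unit_vectors vs & acts (clprod vs) B.
  by move=> AA; apply: (H n) => // i; rewrite subnn.
elim=> [_ B BB Bfix|k IH kn B BB Bfix].
  exists [::] => //; rewrite /clprod big_nil.
  suff -> : B = 1%:M by exact: acts1.
  apply: trmx_inj; rewrite trmx1; apply/row_matrixP => i.
  by rewrite !rowE mulmx1 Bfix // subn0.
have jn : (n - k.+1 < n)%N by rewrite ltn_subrL (leq_trans _ kn).
pose j := Ordinal jn.
have jE (i : 'I_n) : (i < n - k)%N -> (i < n - k.+1)%N \/ i = j.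
  rewrite -subSS subSn // ltnS leq_eqVlt => /orP[/eqP ij|]; last by left.
  by right; exact: val_inj.
have [Bj|Bj] := eqVneq (delta_mx 0 j *m B^T) (delta_mx 0 j : 'rV_n).
  by apply: IH => // [|i /jE[/Bfix//|->//]]; exact: ltnW.
have Bj1 : dotr (delta_mx 0 j *m B^T) (delta_mx 0 j *m B^T) = 1.
  by rewrite dotr_orth // dotr_delta.
have [u u1 [uj ufix]] := refl_swap Bj1 (dotr_delta R j) Bj.
have [|||vs uvs avs] := IH _ (reflection u *m B).
- exact: ltnW.
- by rewrite trmx_mul mulmxA -(mulmxA B^T) refl_orth // mulmx1.
- move=> i; rewrite trmx_mul refl_tr mulmxA => /jE[ij|->]; last by rewrite uj.
  by rewrite Bfix // ufix //; rewrite -{1}(Bfix i ij) dotr_orth.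
exists (u :: vs); first exact/unit_consP.
rewrite clprod_cons -[B]mul1mx -(refl_orth u1) refl_tr -mulmxA.
by apply: actsM => //; exact: acts_reflection.
Qed.

Lemma spin1 : spin (1 : Cl).
Proof. by exists [::]; rewrite big_nil; split. Qed.

Lemma spinM a b : spin a -> spin b -> spin (a * b).
Proof.
move=> [vs [evs uvs ->]] [ws [ews uws ->]]; exists (vs ++ ws); split.
- by rewrite size_cat oddD (negPf evs).
- by move=> v; rewrite mem_cat => /orP[/uvs|/uws].
- by rewrite big_cat.
Qed.

Lemma spin_rev a : spin a -> spin (clrev a).
Proof.
move=> [vs [evs uvs ->]]; exists (rev vs); split.
- by rewrite size_rev.
- by move=> v; rewrite mem_rev => /uvs.
- exact: clrev_prod.
Qed.

Lemma spin_parity a : spin a -> clparity false a.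
Proof.
by move=> [vs [/negPf evs _ ->]]; have := @clprod_parity _ _ vs; rewrite evs.
Qed.

Lemma spin_revr a : spin a -> a * clrev a = 1.
Proof.
move=> [vs [/negPf evs uvs ->]]; rewrite clprod_revr // -signr_odd evs.
by rewrite expr0.
Qed.

Lemma spin_revl a : spin a -> clrev a * a = 1.
Proof. by move=> /spin_rev/spin_revr; rewrite clrevK. Qed.

Lemma spin_acts a : spin a -> acts a (spin_cover a).
Proof.
move=> [vs [_ uvs ->]]; have [A [aA _ _]] := clprod_acts uvs.
by rewrite (acts_spin_cover aA).
Qed.

Lemma spin_coverM a b :
  spin a -> spin b -> spin_cover (a * b) = spin_cover a *m spin_cover b.
Proof. by move=> sa sb; apply/acts_spin_cover/actsM; exact: spin_acts. Qed.

Lemma spin_cover1 : spin_cover (1 : Cl) = 1%:M.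
Proof. exact/acts_spin_cover/acts1. Qed.

Lemma spin_cover_SO a : spin a -> SO (spin_cover a).
Proof.
move=> [vs [/negPf evs uvs ->]]; have [A [aA AA dA]] := clprod_acts uvs.
rewrite (acts_spin_cover aA); split=> //.
by rewrite dA -signr_odd evs expr0.
Qed.

(** Spin elements are products of an even number of unit vectors, and can be
    built two vectors at a time. *)
Lemma spin_ind (P : clifford R n -> Prop) :
  P 1 -> (forall v w a, dotr v v = 1 -> dotr w w = 1 -> spin a -> P a ->
    P (clvec v * clvec w * a)) ->
  forall a, spin a -> P a.
Proof.
move=> P1 PM a [vs [evs uvs ->]].
have [k] := ubnP (size vs); elim: k vs evs uvs => // k IH [_ _ _|v [//|w vs]] /=.
  by rewrite big_nil.
rewrite negbK !ltnS => evs /unit_consP[v1 /unit_consP[w1 uvs]] vsk.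
rewrite !big_cons mulrA; apply: PM => //; last exact: IH (ltnW vsk).
by exists vs.
Qed.

Lemma spin_vec2 (v w : 'rV[R]_n) : dotr v v = 1 -> dotr w w = 1 ->
  spin (clvec v * clvec w).
Proof.
move=> v1 w1; exists [:: v; w]; split => //; last by rewrite !big_cons big_nil mulr1.
by apply/unit_consP; split=> //; apply/unit_consP.
Qed.

(** A product of k reflections has determinant (-1)^k, so that a
    factorisation of a rotation has even length. *)
Lemma spin_cover_surj A : SO A -> exists2 a, spin a & spin_cover a = A.
Proof.
move=> [AA dA]; have [vs uvs avs] := cartan_dieudonne AA.
exists (clprod vs); last exact: acts_spin_cover.
exists vs; split => //; have [B [aB _ dB]] := clprod_acts uvs.
move: dB; rewrite -(acts_spin_cover aB) (acts_spin_cover avs) dA.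
by rewrite -signr_odd; case: odd => //= /eqP; rewrite expr1 -addr_eq0 -mulr2n pnatr_eq0.
Qed.

End SpinGroup.

(** * Quadratic expressions in a spin element *)

Section QuadraticRecovery.
Variables (R : realType) (n : nat).
Local Notation Cl := (clifford R n).
Implicit Types (a y : Cl) (S T : {set 'I_n}) (A : 'M[R]_n) (i : 'I_n).

(** Moving e_i past the even element e_S gives a sign for each element of S
    other than i. *)
Lemma conj_cle i S : ~~ odd #|S| ->
  clvec (delta_mx 0 i) * cle R S * clvec (delta_mx 0 i) =
  (if i \in S then 1 else -1) *: cle R S.
Proof.
move=> /negPf eS; rewrite clvec_delta cle_mul -scalerAl cle_mul scalerA.
have -> : symdiff (symdiff [set i]%SET S) [set i]%SET = S.
  by rewrite symdiffC symdiffK.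
congr (_ *: _); rewrite csignDl csign1 leqnn mulN1r mulrN.
suff -> : csign R [set i]%SET S * csign R S [set i]%SET =
    \prod_(j in S) -1 * \prod_(j in S) (if j == i then -1 else 1).
  rewrite sign_card -signr_odd eS mul1r -big_mkcondr /=.
  have [iS|iS] := boolP (i \in S).
    rewrite (big_pred1 i) ?opprK // => j /=.
    by rewrite andbC; case: eqP => // ->.
  by rewrite big_pred0 // => j; apply/negP => /andP[jS /eqP ji]; rewrite -ji jS in iS.
rewrite /csign finset.big_set1 -!big_split; apply: eq_bigr => j _ /=.
rewrite finset.big_set1 -(inj_eq val_inj) /=.
by case: ltngtP; rewrite ?mulrNN ?mulr1 ?mul1r.
Qed.

(** For A the rotation defined by a, this operator maps a * y to a * (y -
    e_i y e_i). On even y, conjugation by e_i is the identity on the e_S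
    with i in S and -1 on the others, so the step removes the former and
    doubles the latter. *)
Definition average_step A i (x : Cl) : Cl :=
  x - clvec (delta_mx 0 i *m A^T) * x * clvec (delta_mx 0 i).

Lemma average_step_even i y : clparity false y ->
  average_step 1%:M i y = [ffun S : {set 'I_n} => if i \in S then 0 else 2 * y S].
Proof.
move=> ey; rewrite /average_step trmx1 mulmx1.
have -> : clvec (delta_mx 0 i) * y * clvec (delta_mx 0 i) =
    \sum_S (y S * (if i \in S then 1 else -1)) *: cle R S.
  rewrite {1}(cleE y) mulr_sumr mulr_suml; apply: eq_bigr => S _.
  have [oS|eS] := boolP (odd #|S|).
    by rewrite ey ?oS // mul0r !scale0r mulr0 mul0r.
  by rewrite -scalerAr -scalerAl conj_cle // scalerA.
apply/ffunP => S; rewrite !ffunE cl_sum_coef (bigD1 S) //= big1 ?addr0; last first.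
  by move=> T /negPf TS; rewrite clscaleE ffunE eq_sym TS mulr0.
by rewrite clscaleE ffunE eqxx /=; case: ifP => _; ring.
Qed.

Lemma average_step_spin a i y :
  spin a -> average_step (spin_cover a) i (a * y) = a * average_step 1%:M i y.
Proof.
move=> sa; rewrite /average_step -(spin_acts sa) trmx1 mulmx1 mulrBr; congr (_ - _).
by rewrite !mulrA -(mulrA _ (clrev a)) spin_revl // mulr1.
Qed.

Definition average A (x : Cl) : Cl := foldr (average_step A) x (enum 'I_n).

(** After a step for every i, only the constant term of y survives: the
    element a is recovered, up to a scalar, from a * y and the rotation
    alone. *)
Lemma average_spin a y : spin a -> clparity false y ->
  average (spin_cover a) (a * y) = (2 ^+ n * y finset.set0) *: a.
Proof.
move=> sa ey; pose f r := foldr (average_step 1%:M) y r.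
(* After the steps for the indices in r, exactly the coefficients of the
   subsets that avoid r are left. *)
have fE r : f r = [ffun S : {set 'I_n} =>
    if has (mem S) r then 0 else 2 ^+ size r * y S].
  elim: r => [|i r IH] /=.
    by apply/ffunP => S; rewrite ffunE mul1r.
  rewrite [average_step _ _ _]average_step_even; last first.
    move=> S oS; rewrite -/(f r) IH ffunE ey ?mulr0 //; by case: ifP.
  apply/ffunP => S; rewrite -/(f r) IH !ffunE.
  by case: (i \in S) => //=; case: ifP => _; rewrite ?mulr0 // mulrA -exprS.
have -> : average (spin_cover a) (a * y) = a * f (enum 'I_n).
  rewrite /average /f; elim: (enum _) => //= i r ->.
  exact: average_step_spin.
have -> : f (enum 'I_n) = (2 ^+ n * y finset.set0) *: 1.
  apply/ffunP => S; rewrite fE clscaleE !ffunE size_enum_ord.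
  have [->|[i iS]] := finset.set_0Vmem S.
    rewrite eqxx mulr1; case: hasP => // -[i _].
    by rewrite /= finset.inE.
  case: hasP => [_|[]]; last by exists i; rewrite ?mem_enum.
  case: eqP => [S0|]; last by rewrite mulr0.
  by rewrite S0 finset.inE in iS.
by rewrite -scalerAr mulr1.
Qed.

(** The product of the coordinates T and S of a spin element, as a
    polynomial in the entries of the rotation A that it defines:
    [average_spin] applied to a * y = e_T. Then y = clrev a * e_T has
    constant term a T, so that the average of e_T is 2^n (a T) a. For odd T
    the coordinate a T is zero. *)
Definition cover_quad A T S : R :=
  if odd #|T| then 0 else (2 ^+ n)^-1 * average A (cle R T) S.

(** A quadratic expression in a spin element depends only on its rotation,
    and depends on it polynomially. This single fact yields both the
    independence of choices of lifts and the smoothness of what is built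
    from them. *)
Lemma cover_quadE a T S : spin a -> a T * a S = cover_quad (spin_cover a) T S.
Proof.
move=> sa; rewrite /cover_quad; have [oT|eT] := boolP (odd #|T|).
  by rewrite (spin_parity sa) ?oT // mul0r.
have -> : cle R T = a * (clrev a * cle R T) by rewrite mulrA spin_revr // mul1r.
rewrite average_spin //; last first.
  rewrite -[false]/(false (+) false); apply: clparityM.
    exact/clparity_rev/spin_parity.
  by rewrite -(negPf eT); exact: clparity_cle.
have -> : (clrev a * cle R T) finset.set0 = a T.
  rewrite clmulE (bigD1 T) //= symdiff0 big1 ?addr0 => [|S' /negPf ST].
    rewrite csign_diag !ffunE eqxx mulr1 -[(-1) ^+ #|T|]signr_odd (negPf eT).
    by rewrite mulr1 mulrA -exprMn mulrNN mulr1 expr1n mul1r.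
  by rewrite symdiff0 [cle R T _]ffunE ST mulr0 mulr0.
by rewrite clscaleE; field; rewrite expf_neq0 // pnatr_eq0.
Qed.

End QuadraticRecovery.

(** * The projection of Spin(4) to Spin(3) *)

Section SelfDualProjection.
Variable R : realType.
Local Notation L := (@cl_inl R 3 1).
Implicit Types (x : clifford R (3 + 1)) (y z : clifford R 3).

Lemma clvol_cle n : clvol R n = cle R finset.setT.
Proof. by []. Qed.

Local Notation omega := (clvol R 3).

Lemma omega_central y : omega * y = y * omega.
Proof.
rewrite clvol_cle (cleE y) mulr_sumr mulr_suml; apply: eq_bigr => S _.
rewrite -scalerAr -scalerAl; congr (_ *: _); rewrite !cle_mul symdiffC.
congr (_ *: _); rewrite /csign exchange_big; apply: eq_bigr => i _ /=.
under eq_bigl do rewrite finset.in_setT.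
under [RHS]eq_bigl do rewrite finset.in_setT.
rewrite !big_ord_recl !big_ord0 /=.
by case: i => [[|[|[|//]]] ?] /=; ring.
Qed.

Lemma omega_sqr : omega * omega = 1.
Proof.
rewrite clvol_cle cle_mul symdiffv cle0 csign_diag finset.cardsT card_ord.
by rewrite (_ : 'C(3, 2) = 3)%N // -exprD -signr_odd scale1r.
Qed.

Lemma omega_rev : clrev omega = - omega.
Proof.
rewrite clvol_cle clrev_cle finset.cardsT card_ord (_ : 'C(3, 2) = 3)%N //.
by rewrite -signr_odd scaleN1r.
Qed.

Lemma omega_parity : clparity true omega.
Proof.
rewrite clvol_cle; have := @clparity_cle R 3 finset.setT.
by rewrite finset.cardsT card_ord.
Qed.

(** The last basis vector, seen as a vector of the second summand of R^3 +
    R^1. *)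
Definition e4 : clifford R (3 + 1) := @cl_inr R 3 1 (clvec 1%:M).

Lemma e4_cle : e4 = @cl_inr R 3 1 (cle R [set 0]%SET).
Proof.
rewrite -clvec_delta; suff <- : 1%:M = delta_mx 0 0 :> 'rV[R]_1 by [].
by apply/matrixP => i j; rewrite !mxE !ord1.
Qed.

Lemma e4_comm p y : clparity p y -> e4 * L y = (-1) ^+ p *: (L y * e4).
Proof. by move=> py; rewrite (cl_inr_inl py (@clparity_vec _ _ _)) andbT. Qed.

Lemma e4_sqr : e4 * e4 = -1.
Proof.
rewrite /e4 -rmorphM /= clvec_sq /dotr big_ord1 mxE eqxx mulr1 scaleN1r.
by rewrite rmorphN1.
Qed.

Lemma clvol4E : clvol R (3 + 1) = L omega * e4.
Proof.
rewrite e4_cle !clvol_cle /cl_inl /cl_inr !clmap_cle cle_mul csign_lr scale1r.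
congr (cle _ _); apply/setP => i; rewrite !finset.inE; symmetry.
case: (split_ordP (i : 'I_(3 + 1))) => j ->.
  rewrite (mem_imset _ _ (@lshift_inj 3 1)) finset.in_setT.
  by case: imsetP => // -[k _ /eqP]; rewrite eq_lrshift.
rewrite (mem_imset _ _ (@rshift_inj 3 1)) finset.inE ord1 eqxx.
by case: imsetP => // -[k _ /eqP]; rewrite eq_rlshift.
Qed.

Lemma coef_L y (S : {set 'I_3}) : L y (lshift 1 @: S)%SET = y S.
Proof. exact: (clmap_coef (@lshift_mono 3 1)). Qed.

Lemma coef_Le4 y (S : {set 'I_3}) : (L y * e4) (lshift 1 @: S)%SET = 0.
Proof.
rewrite (cleE y) linear_sum mulr_suml cl_sum_coef big1 // => T _ /=.
rewrite linearZ /= -scalerAl clscaleE e4_cle /cl_inl /cl_inr !clmap_cle cle_mul.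
rewrite clscaleE ffunE; case: eqP => [/setP/(_ (@rshift 3 1 0))|].
  rewrite finset.inE imset_set1 finset.in_set1 eqxx.
  by case: imsetP => [[k _ /eqP]|_]; [|case: imsetP => [[k _ /eqP]|]];
    rewrite ?eq_rlshift.
by rewrite !mulr0.
Qed.

(** Even elements of Cl_4 in terms of Cl_3, which has basis 1, e4 over the
    latter: y + z e4 with y even and z odd. *)
Definition split4 x y z :=
  [/\ x = L y + L z * e4, clparity false y & clparity true z].

Lemma split4_vol x y z : split4 x y z ->
  x - x * clvol R (3 + 1) = L (y - z * omega) + L (z - y * omega) * e4.
Proof.
move=> [-> ey oz]; rewrite clvol4E mulrDl !mulrA -(rmorphM L).
rewrite -(mulrA (L z) e4) (e4_comm omega_parity) expr1 scaleN1r mulrN mulNr.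
rewrite -!mulrA e4_sqr !mulrN1 !mulrN ?opprK -(rmorphM L).
by rewrite !rmorphB /= mulrBl opprD [X in _ + X = _]addrC addrACA.
Qed.

(** The projection sends e4 to -omega. As omega is central with omega omega
    = 1, this explains why it is multiplicative: the relations e4 z = - z e4
    and e4 e4 = -1 for odd z give the same products as a central element of
    square 1 does without the signs. *)
Lemma pr_plus_split x y z : split4 x y z -> pr_plus x = y - z * omega.
Proof.
move=> xyz; apply/ffunP => S; rewrite ffunE.
have -> : [set widen_ord (leqnSn 3) i | i in S]%SET = (lshift 1 @: S)%SET.
  by apply: eq_imset => i; apply: val_inj.
transitivity ((x - x * clvol R (3 + 1)) (lshift 1 @: S)%SET); first by [].
by rewrite (split4_vol xyz) ffunE coef_L coef_Le4 addr0.
Qed.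

Lemma split4M x y z x' y' z' : split4 x y z -> split4 x' y' z' ->
  split4 (x * x') (y * y' + z * z') (y * z' + z * y').
Proof.
move=> [-> ey oz] [-> ey' oz']; split.
- rewrite !mulrDl !mulrDr !mulrA -!(rmorphM L) -!(mulrA (L z) e4).
  rewrite (e4_comm ey') (e4_comm oz') expr0 expr1 scale1r scaleN1r.
  rewrite mulrN mulNr -!mulrA e4_sqr !mulrA -!(rmorphM L) mulrN1 opprK.
  by rewrite !rmorphD /= mulrDl [X in _ + X = _]addrC addrACA.
- apply: clparityD; first exact: (@clparityM _ _ false false).
  exact: (@clparityM _ _ true true).
- apply: clparityD; first exact: (@clparityM _ _ false true).
  exact: (@clparityM _ _ true false).
Qed.

Lemma split4_rev x y z : split4 x y z -> split4 (clrev x) (clrev y) (- clrev z).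
Proof.
move=> [-> ey oz]; split.
- rewrite linearD /= clrevM !clrev_inl clrev_inr clrev_vec -/e4.
  by rewrite (e4_comm (clparity_rev oz)) expr1 scaleN1r rmorphN mulNr.
- exact: clparity_rev.
- by rewrite -scaleN1r; apply/clparityZ/clparity_rev.
Qed.

Lemma clvec4E (v : 'rV[R]_(3 + 1)) :
  clvec v = L (clvec (lsubmx v)) + rsubmx v 0 0 *: e4.
Proof.
rewrite -[in LHS](hsubmxK v) clvec_row /e4 -linearZ /= -linearZ /=.
suff <- : rsubmx v = rsubmx v 0 0 *: 1%:M by [].
by apply/matrixP => i j; rewrite !ord1 !mxE eqxx mulr1.
Qed.

(** The parts without and with e4 of the product of the vectors v = v' + s
    e4 and w = w' + t e4; [lsubmx] and [rsubmx] extract v' and s. *)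
Definition split_even (v w : 'rV[R]_(3 + 1)) :=
  clvec (lsubmx v) * clvec (lsubmx w) - (rsubmx v 0 0 * rsubmx w 0 0) *: 1.
Definition split_odd (v w : 'rV[R]_(3 + 1)) :=
  rsubmx w 0 0 *: clvec (lsubmx v) - rsubmx v 0 0 *: clvec (lsubmx w).

Lemma split4_vec2 (v w : 'rV[R]_(3 + 1)) :
  split4 (clvec v * clvec w) (split_even v w) (split_odd v w).
Proof.
rewrite /split_even /split_odd (clvec4E v) (clvec4E w).
have := @clparity_vec _ _ (lsubmx v); have := @clparity_vec _ _ (lsubmx w).
move: (clvec (lsubmx v)) (clvec (lsubmx w)) (rsubmx v 0 0) (rsubmx w 0 0).
move=> p q s t oq op; split.
- rewrite mulrDl !mulrDr -!scalerAl -!scalerAr e4_sqr (e4_comm oq).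
  rewrite expr1 scaleN1r scalerN -rmorphM scalerA scalerN.
  rewrite !raddfB /= !linearZ /= rmorph1 mulrDl -!scalerAl mulNr.
  by rewrite [X in _ + X = _]addrC addrACA.
- rewrite -scaleNr; apply: clparityD; last exact/clparityZ/clparity1.
  exact: (@clparityM _ _ true true).
- by rewrite -scaleNr; apply: clparityD; apply: clparityZ.
Qed.

(** Each vector v' + s e4 gives rise to the quaternion s + omega v'; the
    product of two vectors is sent to the product of one of these and a
    conjugate, up to sign. *)
Lemma pr_plus_vec2 (v w : 'rV[R]_(3 + 1)) :
  pr_plus (clvec v * clvec w) =
  (rsubmx v 0 0 *: 1 + omega * clvec (lsubmx v)) *
  (- rsubmx w 0 0 *: 1 + omega * clvec (lsubmx w)).
Proof.
rewrite (pr_plus_split (split4_vec2 v w)) /split_even /split_odd.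
move: (clvec (lsubmx v)) (clvec (lsubmx w)) (rsubmx v 0 0) (rsubmx w 0 0).
move=> p q s t.
have -> : omega * p = p * omega by exact: omega_central.
rewrite [in RHS]mulrDl !mulrDr -!scalerAl -!scalerAr !mul1r !mulr1.
rewrite -(mulrA p) (mulrA omega) omega_sqr mul1r (omega_central q).
rewrite mulrBl -!scalerAl scalerA mulrN !scaleNr.
rewrite opprB addrACA [RHS]addrACA [RHS]addrC; congr (_ + _); exact: addrC.
Qed.

Lemma spin4_split (a : clifford R (3 + 1)) : spin a -> exists y z, split4 a y z.
Proof.
move: a; apply: spin_ind => [|v w a _ _ _ [y [z yz]]].
  exists 1, 0; split; first by rewrite !rmorph1 rmorph0 mul0r addr0.
    exact: clparity1.
  by move=> S _; rewrite ffunE.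
by eexists; eexists; exact: split4M (split4_vec2 v w) yz.
Qed.

Lemma pr_plusM (a b : clifford R 4) :
  spin a -> spin b -> pr_plus (a * b) = pr_plus a * pr_plus b.
Proof.
move=> /spin4_split[y [z yz]] /spin4_split[y' [z' yz']].
rewrite (pr_plus_split yz) (pr_plus_split yz').
have -> : pr_plus (a * b) = y * y' + z * z' - (y * z' + z * y') * omega.
  exact: pr_plus_split (split4M yz yz').
rewrite [in RHS]mulrBl !mulrBr mulrDl !mulrA.
rewrite -!(mulrA z omega) !omega_central !mulrA -(mulrA _ omega) omega_sqr mulr1.
by rewrite opprB opprD addrACA.
Qed.

Lemma pr_plus_rev (a : clifford R 4) :
  spin a -> pr_plus (clrev a) = clrev (pr_plus a).
Proof.
move=> /spin4_split[y [z yz]].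
rewrite (pr_plus_split yz).
have -> : pr_plus (clrev a) = clrev y - (- clrev z) * omega.
  exact: pr_plus_split (split4_rev yz).
by rewrite raddfB /= clrevM omega_rev !mulNr omega_central.
Qed.

Lemma pr_plus1 : pr_plus (1 : clifford R 4) = 1.
Proof.
have -> : pr_plus (1 : clifford R 4) = 1 - 0 * omega.
  apply: pr_plus_split; split; last by move=> S _; rewrite ffunE.
    by rewrite rmorph1 raddf0 mul0r addr0.
  exact: clparity1.
by rewrite mul0r subr0.
Qed.

(** Odd elements of Cl_3 have degrees 1 and 3, and reversal is -1 in degree
    3. *)
Lemma odd_rev_vec (x : clifford R 3) :
  clparity true x -> clrev x = x -> exists s, x = clvec s.
Proof.
move=> ox rx; exists (\row_i x [set i]%SET); apply/ffunP => S.
have [oS|eS] := boolP (odd #|S|); last first.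
  by rewrite ox ?(negPf eS) // (@clparity_vec _ _ _ S) ?(negPf eS).
have cS : (#|S| <= 3)%N by have := max_card (mem S); rewrite card_ord.
have [/eqP/cards1P[i ->]|S1] := eqVneq #|S| 1%N.
  by rewrite clvec_coef mxE.
have S3 : #|S| = 3%N by case: #|S| oS S1 cS => [|[|[|[|]]]].
rewrite ffunE big1 => [|i /eqP Si]; last by rewrite Si finset.cards1 in S3.
move: rx => /(congr1 (fun f : clifford R 3 => f S)); rewrite ffunE S3.
rewrite (_ : 'C(3, 2) = 3)%N // -signr_odd expr1 mulN1r => /eqP.
by rewrite eq_sym -addr_eq0 -mulr2n mulrn_eq0 => /eqP.
Qed.

Lemma orthogonal_unit (v : 'rV[R]_3) : exists2 u, dotr u u = 1 & dotr u v = 0.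
Proof.
pose d := nz_row (kermx v^T).
have d0 : d != 0.
  rewrite nz_row_eq0 -mxrank_eq0 mxrank_ker subn_eq0 -ltnNge.
  by rewrite (leq_ltn_trans (rank_leq_col _)).
have dv : dotr d v = 0.
  have /sub_kermxP := nz_row_sub (kermx v^T).
  by rewrite -/d dotrE => /matrixP/(_ 0 0); rewrite !mxE eqxx mulr1n.
have dd := dotr_gt0 d0.
exists ((Num.sqrt (dotr d d))^-1 *: d); last by rewrite dotrZl dv mulr0.
rewrite dotrZl dotrZr mulrA -expr2 exprVn sqr_sqrtr ?ltW // mulVf //.
by rewrite gt_eqF.
Qed.

(** Unit quaternions x = t + omega q are spin elements: choose a unit vector
    u orthogonal to q. Then x u is odd and fixed by reversal, hence a vector
    s, necessarily of norm one, and x = - s u because u u = -1. *)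
Lemma spin3_quaternion (t : R) (q : 'rV[R]_3) : t ^+ 2 + dotr q q = 1 ->
  spin (t *: 1 + omega * clvec q).
Proof.
move=> tq; set x := _ + _.
have [u u1 uq] := orthogonal_unit q.
have anti : clvec u * clvec q = - (clvec q * clvec u).
  apply/eqP; rewrite -addr_eq0 clvec_anticomm uq mulr0 oppr0.
  by rewrite scale0r.
have rx : clrev x = t *: 1 - omega * clvec q.
  rewrite /x linearD linearZ /= clrev1 clrevM clrev_vec omega_rev.
  by rewrite mulrN omega_central.
have qq : (omega * clvec q) * (omega * clvec q) = - dotr q q *: 1.
  by rewrite {1}omega_central mulrA -(mulrA (clvec q)) omega_sqr mulr1 clvec_sq.
have xx : x * clrev x = 1.
  rewrite rx /x mulrBr !mulrDl qq -!scalerAr -!scalerAl !mul1r !mulr1 scalerA.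
  by rewrite opprD addrA addrK -scaleNr opprK -scalerDl -expr2 tq scale1r.
have uu : clvec u * clvec u = -1 by rewrite clvec_sq u1 scaleN1r.
have [s xuE] : exists s, x * clvec u = clvec s.
  apply: odd_rev_vec.
    apply: (@clparityM _ _ false true); last exact: clparity_vec.
    apply: clparityD; first exact/clparityZ/clparity1.
    apply: (@clparityM _ _ true true); [exact: omega_parity|exact: clparity_vec].
  rewrite clrevM clrev_vec rx /x mulrBr mulrDl -scalerAr -scalerAl mul1r mulr1.
  by rewrite mulrA -(omega_central (clvec u)) -mulrA anti mulrN opprK mulrA.
have s1 : dotr s s = 1.
  have : clvec s * clrev (clvec s) = -1.
    rewrite -xuE clrevM clrev_vec mulrA -(mulrA x) uu mulrN1 mulNr xx.
    by [].
  rewrite clrev_vec clvec_sq => /(congr1 (fun f : clifford R 3 => f finset.set0)).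
  rewrite clscaleE [in RHS]ffunE cl1E eqxx mulr1 => /oppr_inj.
  by [].
exists [:: - s; u]; split => //.
  apply/unit_consP; split; first by rewrite -scaleN1r dotrZl dotrZr s1; ring.
  by apply/unit_consP.
rewrite !big_cons big_nil mulr1 linearN /= -xuE mulNr -mulrA uu mulrN1 opprK.
by [].
Qed.

Lemma quaternion_norm (v : 'rV[R]_(3 + 1)) :
  rsubmx v 0 0 ^+ 2 + dotr (lsubmx v) (lsubmx v) = dotr v v.
Proof.
rewrite addrC [in RHS]/dotr big_split_ord big_ord1 /= expr2 !mxE.
by congr (_ + _); apply: eq_bigr => i _; rewrite !mxE.
Qed.

(** The quaternion of a vector has the same norm as the vector, so products
    of two unit vectors are sent to products of two unit quaternions. *)
Lemma spin_pr_plus (a : clifford R 4) : spin a -> spin (pr_plus a).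
Proof.
move: a; apply: spin_ind => [|v w a v1 w1 sa IH]; first by rewrite pr_plus1; exact: spin1.
rewrite (pr_plusM (spin_vec2 v1 w1) sa); apply: spinM IH; rewrite (pr_plus_vec2 v w).
apply: spinM; apply: spin3_quaternion; last rewrite sqrrN.
  by rewrite quaternion_norm.
by rewrite quaternion_norm.
Qed.

End SelfDualProjection.

(** * Modules given by Clifford matrices *)

(** The size n may be zero, so that square matrices form a ring only under
    an assumption; they are always a monoid. *)
HB.instance Definition _ (R : pzSemiRingType) (n : nat) :=
  Monoid.isLaw.Build 'M[R]_n 1%:M (@mulmx R n n n)
    (@mulmxA R n n n n) (@mul1mx R n n) (@mulmx1 R n n).

Section CliffordRepresentation.
Variables (R : realType) (n N : nat) (gamma : 'I_n.+1 -> 'M[R[i]]_N).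
Hypothesis gammaP : clifford_matrices gamma.
Local Notation C := R[i].
Implicit Types (a b : clifford R n.+1) (P : pred nat).

Fact cl_rep_is_additive : zmod_morphism (cl_rep gamma).
Proof.
move=> a b; rewrite /cl_rep -sumrB; apply: eq_bigr => S _.
by rewrite !ffunE rmorphB scalerBl.
Qed.

HB.instance Definition _ := GRing.isZmodMorphism.Build _ _ (cl_rep gamma)
  cl_rep_is_additive.

Lemma cl_repZ (r : R) a : cl_rep gamma (r *: a) = (r%:C)%C *: cl_rep gamma a.
Proof.
rewrite /cl_rep scaler_sumr; apply: eq_bigr => S _.
by rewrite clscaleE rmorphM scalerA.
Qed.

Lemma cl_rep_cle (S : {set 'I_n.+1}) :
  cl_rep gamma (cle R S) = \big[mulmx/1%:M]_(i < n.+1 | i \in S) gamma i.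
Proof.
rewrite /cl_rep (bigD1 S) //= ffunE eqxx scale1r.
rewrite [X in _ + X]big1 ?addr0 // => T /negPf TS.
by rewrite ffunE TS scale0r.
Qed.

(* Indexing the generators by natural numbers allows induction on an upper
   bound for the indices. *)
Let g k := gamma (inord k).

Let g_anti i k : (i <= n)%N -> (k <= n)%N -> i != k ->
  g i *m g k = - (g k *m g i).
Proof.
move=> i_n kn /negPf ik; apply/eqP; rewrite -addr_eq0 gammaP.
have -> : (inord i == inord k :> 'I_n.+1) = false.
  apply/negP => /eqP/(congr1 val) /=; rewrite !inordK // => /eqP.
  by rewrite ik.
by rewrite mulr0 raddf0.
Qed.

Let g_sqr i : g i *m g i = - 1%:M.
Proof.
have := gammaP (inord i) (inord i); rewrite eqxx mulr1 -/(g i) => /matrixP gg.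
apply/matrixP => r c; move: (gg r c); rewrite !mxE -mulr2n => /eqP.
have -> : (- 2 : C) *+ (r == c) = (- (r == c)%:R) *+ 2.
  by rewrite mulNrn mulNrn -!mulrnA mulnC.
by rewrite eqrMn2r // => /eqP.
Qed.

(* The product, in increasing order, of the generators of index k < m with P
   k. *)
Let W m P := \big[mulmx/1%:M]_(0 <= k < m | P k) g k.

Let WS m P : W m.+1 P = W m P *m (if P m then g m else 1%:M).
Proof.
rewrite /W [LHS]big_mkcond big_nat_recr //= -big_mkcond; congr (_ *m _).
Qed.

Let eq_W m P P' : (forall k, (k < m)%N -> P k = P' k) -> W m P = W m P'.
Proof.
move=> PP'; rewrite /W [LHS]big_nat_cond [RHS]big_nat_cond.
apply: eq_bigl => k; rewrite /=; case: ltnP => // km; exact: PP'.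
Qed.

Let W_comm m i P : (m <= i)%N -> (i <= n)%N ->
  g i *m W m P = (\prod_(0 <= k < m | P k) -1) *: (W m P *m g i).
Proof.
elim: m => [_ _|m IH mi i_n].
  by rewrite /W !big_nil mulmx1 mul1mx scale1r.
rewrite WS mulmxA IH ?(ltnW mi) // -scalemxAl -!mulmxA.
rewrite [in RHS]big_mkcond big_nat_recr //= -big_mkcond /=; case: (P m); last by rewrite mulmx1 mul1mx mulr1.
rewrite g_anti ?(gtn_eqF mi) ?(leq_trans (ltnW mi)) //.
by rewrite mulmxN scalerN mulrN1 scaleNr.
Qed.

(* Multiplication by g i toggles the membership of i. The generator passes
   those of smaller index, and is cancelled by g i * g i = -1 if it was
   present, whence a sign for each k <= i with P k. *)
Let W_mul m i P : (i < m)%N -> (m <= n.+1)%N ->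
  g i *m W m P = (\prod_(0 <= k < m | P k && (k <= i)%N) -1) *:
    W m (fun k => P k (+) (k == i)).
Proof.
elim: m => // m IH; rewrite ltnS leq_eqVlt => /orP[/eqP -> mn|im mn].
  rewrite !WS mulmxA W_comm // -scalemxAl -mulmxA eqxx.
  have -> : W m (fun k => P k (+) (k == m)) = W m P.
    by apply: eq_W => k km; rewrite (ltn_eqF km) addbF.
  have -> : \prod_(0 <= k < m.+1 | P k && (k <= m)%N) -1 =
      (\prod_(0 <= k < m | P k) -1) * (if P m then -1 else 1) :> C.
    rewrite [LHS]big_mkcond big_nat_recr //= leqnn andbT; congr (_ * _).
    rewrite -big_mkcond [LHS]big_nat_cond [RHS]big_nat_cond.
    by apply: eq_bigl => k /=; case: ltnP => // /ltnW ->; rewrite andbT.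
  case: (P m); last by rewrite mulmx1 mulr1.
  by rewrite g_sqr mulmxN !mulmx1 mulrN1 scaleNr scalerN.
rewrite !WS mulmxA IH ?(ltnW mn) // -scalemxAl (gtn_eqF im) addbF.
rewrite [in RHS]big_mkcond big_nat_recr //= -big_mkcond /=.
by rewrite (leqNgt m) im andbF mulr1.
Qed.

Let big_W (S : {set 'I_n.+1}) : \big[mulmx/1%:M]_(i < n.+1 | i \in S) gamma i =
  W n.+1 (fun k => inord k \in S).
Proof.
rewrite /W big_mkord; apply: eq_big => [i|i _]; first by rewrite inord_val.
by rewrite /g inord_val.
Qed.

(** The signs of [W_mul] are those of csign: the definition of the product
    in the Clifford algebra is made for the anticommutation relations. *)
Lemma cl_rep_gen i (S : {set 'I_n.+1}) : gamma i *m cl_rep gamma (cle R S) =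
  cl_rep gamma (cle R [set i]%SET * cle R S).
Proof.
rewrite cle_mul cl_repZ !cl_rep_cle !big_W.
have -> : gamma i = g i by rewrite /g inord_val.
rewrite W_mul //; congr (_ *: _).
  rewrite /csign finset.big_set1 rmorph_prod big_mkord /=.
  rewrite [LHS]big_mkcond [RHS]big_mkcond /=; apply: eq_bigr => j _.
  by rewrite inord_val; case: (j \in S) => //=; case: ifP; rewrite ?rmorphN1 ?rmorph1.
apply: eq_W => k kn; rewrite !finset.inE addbC; congr (_ (+) _).
by rewrite -(inj_eq val_inj) /= inordK.
Qed.

Lemma cl_rep1 : cl_rep gamma 1 = 1%:M.
Proof.
by rewrite -cle0 cl_rep_cle big_pred0 // => i; rewrite finset.inE.
Qed.

Lemma cl_rep_vec v : cl_rep gamma (clvec v) = \sum_i (v 0 i)%:C%C *: gamma i.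
Proof.
rewrite clvecE raddf_sum; apply: eq_bigr => i _ /=; rewrite cl_repZ.
rewrite -[gamma i]mulmx1 -cl_rep1 cl_rep_gen mulr1.
by [].
Qed.

Lemma cl_rep_vecM v a :
  cl_rep gamma (clvec v * a) = cl_rep gamma (clvec v) *m cl_rep gamma a.
Proof.
rewrite cl_rep_vec mulmx_suml clvecE mulr_suml raddf_sum; apply: eq_bigr => i _.
rewrite -scalerAl /= cl_repZ -scalemxAl; congr (_ *: _).
rewrite {1}(cleE a) mulr_sumr raddf_sum [in RHS](cleE a) [X in _ = _ *m X]raddf_sum.
rewrite mulmx_sumr; apply: eq_bigr => S _ /=.
by rewrite -scalerAr !cl_repZ -scalemxAr cl_rep_gen.
Qed.

(** When the left factor is a product of vectors, multiplicativity follows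
    from the case of a generator, by linearity and induction on the number
    of vectors. *)
Lemma cl_rep_prodM vs a :
  cl_rep gamma (clprod vs * a) = cl_rep gamma (clprod vs) *m cl_rep gamma a.
Proof.
elim: vs => [|v vs IH]; first by rewrite /clprod big_nil mul1r cl_rep1 mul1mx.
by rewrite clprod_cons -mulrA !cl_rep_vecM IH mulmxA.
Qed.

Lemma cl_rep_spinM a b : spin a ->
  cl_rep gamma (a * b) = cl_rep gamma a *m cl_rep gamma b.
Proof. by move=> [vs [_ _ ->]]; exact: cl_rep_prodM. Qed.

End CliffordRepresentation.

(** * Spin representations in dimensions 3, 4 and 7 *)

Section SpinRepresentations.
Variable R : realType.
Local Notation C := R[i].
Implicit Types (v w : 'rV[R]_(3 + 1)) (a b : clifford R 4).

(** The off-diagonal blocks of the Clifford action of a vector of R^4. *)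
Definition chiral_up v : 'M[C]_2 :=
  Delta3 (clvec (lsubmx v)) - ((rsubmx v 0 0)%:C%C)%:M.
Definition chiral_down v : 'M[C]_2 :=
  Delta3 (clvec (lsubmx v)) + ((rsubmx v 0 0)%:C%C)%:M.

Lemma Delta4_vec v :
  Delta4 (clvec v) = block_mx 0 (chiral_up v) (chiral_down v) 0.
Proof.
transitivity (\sum_(i < 3 + 1) (v 0 i)%:C%C *: @gamma4 R i).
  exact: (cl_rep_vec (@gamma4P R)).
rewrite big_split_ord big_ord1 /= gamma4r.
under eq_bigr do rewrite gamma4l scale_block_mx !scaler0.
have sum_block (F G : 'I_3 -> 'M[C]_2) :
    \sum_i block_mx 0 (F i) (G i) 0 = block_mx 0 (\sum_i F i) (\sum_i G i) 0.
  by rewrite !big_ord_recl !big_ord0 !addr0 !add_block_mx !addr0.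
rewrite sum_block scale_block_mx !scaler0 add_block_mx !addr0.
rewrite /chiral_up /chiral_down /Delta3 (cl_rep_vec (@gamma3P R)).
rewrite scalerN !scalemx1 !mxE.
by congr (block_mx _ (_ - _) (_ + _) _);
  apply: eq_bigr => i _; rewrite !mxE.
Qed.

Lemma Delta4_vec2 v w : Delta4 (clvec v * clvec w) =
  block_mx (chiral_up v *m chiral_down w) 0 0 (chiral_down v *m chiral_up w).
Proof.
rewrite /Delta4 (cl_rep_vecM (@gamma4P R)) -/(Delta4 _) -/(Delta4 _) !Delta4_vec.
by rewrite mulmx_block !mul0mx !mulmx0 !addr0 !add0r.
Qed.

Lemma Delta4_spinM a b : spin a -> Delta4 (a * b) = Delta4 a *m Delta4 b.
Proof. exact: (cl_rep_spinM (@gamma4P R)). Qed.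

(** Products of two vectors preserve each half-spin space, as a vector
    exchanges them. *)
Lemma Delta4_diag a : spin a -> exists P, exists Q, Delta4 a = block_mx P 0 0 Q.
Proof.
move: a; apply: spin_ind => [|v w a v1 w1 sa [P [Q aE]]].
  exists 1%:M, 1%:M; rewrite -scalar_mx_block.
  by rewrite /Delta4 cl_rep1.
rewrite Delta4_spinM; last exact: spin_vec2.
rewrite aE (Delta4_vec2 v w) mulmx_block !mul0mx !mulmx0 !addr0 !add0r.
by eexists; eexists.
Qed.

Lemma Delta4_plusM a b : spin a -> spin b ->
  Delta4_plus (a * b) = Delta4_plus a *m Delta4_plus b.
Proof.
move=> sa sb; rewrite /Delta4_plus Delta4_spinM //.
have [P [Q ->]] := Delta4_diag sa; have [P' [Q' ->]] := Delta4_diag sb.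
by rewrite mulmx_block !block_mxKul mul0mx addr0.
Qed.

Lemma Delta4_1 : Delta4 (1 : clifford R 4) = 1%:M.
Proof. by rewrite /Delta4 cl_rep1. Qed.

Lemma Delta4_plus1 : Delta4_plus (1 : clifford R 4) = 1%:M.
Proof. by rewrite /Delta4_plus Delta4_1 scalar_mx_block block_mxKul. Qed.

Lemma Delta4_plus_vec2 v w :
  Delta4_plus (clvec v * clvec w : clifford R 4) =
  chiral_up v *m chiral_down w.
Proof. by rewrite /Delta4_plus Delta4_vec2 block_mxKul. Qed.

(** The volume element of Cl_3 acts as -1; this is the choice of one of the
    two irreducible Clifford modules in dimension 3. *)
Lemma Delta3_omega : Delta3 (clvol R 3) = - 1%:M.
Proof.
rewrite /Delta3 clvol_cle (cl_rep_cle (gamma3 R)).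
rewrite (eq_bigl predT) => [|i]; last by rewrite finset.in_setT.
rewrite -gamma3_prod !big_ord_recl big_ord0 mulmx1 mulmxA.
by congr (gamma3 _ _ *m gamma3 _ _ *m gamma3 _ _); apply: val_inj.
Qed.

Lemma Delta3_quaternion (t : R) (q : 'rV[R]_3) :
  Delta3 (t *: 1 + clvol R 3 * clvec q) = (t%:C%C)%:M - Delta3 (clvec q).
Proof.
rewrite omega_central {1}/Delta3 raddfD /= (cl_repZ (gamma3 R)).
rewrite cl_rep1 scalemx1; congr (_ + _).
by rewrite (cl_rep_vecM (@gamma3P R)) -/(Delta3 _) -/(Delta3 _) Delta3_omega mulmxN mulmx1.
Qed.

(** Both sides are multiplicative. On the product of v' + s e4 and w' + t e4
    the left-hand side is (D v' - s) (D w' + t), where D = Delta3. As omega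
    acts as -1, the factors s + omega v' and - t + omega w' of the
    projection act as s - D v' and - t - D w', and the two signs cancel. *)
Lemma Delta4_plusE a : spin a -> Delta4_plus a = Delta3 (pr_plus a).
Proof.
move: a; apply: spin_ind => [|v w a v1 w1 sa IH].
  by rewrite Delta4_plus1 pr_plus1 /Delta3 cl_rep1.
have svw := spin_vec2 v1 w1.
rewrite Delta4_plusM // pr_plusM // IH.
rewrite {2}/Delta3 (cl_rep_spinM (@gamma3P R)); last exact: spin_pr_plus.
congr (_ *m _); rewrite (Delta4_plus_vec2 v w) (pr_plus_vec2 v w).
rewrite /Delta3 (cl_rep_spinM (@gamma3P R)); last first.
  by apply: spin3_quaternion; rewrite quaternion_norm.
rewrite -/(Delta3 _) -/(Delta3 _) !Delta3_quaternion /chiral_up /chiral_down.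
have neg (s : R) (D : 'M[C]_2) : (- s)%:C%C%:M - D = - (D + s%:C%C%:M).
  by rewrite opprD addrC rmorphN raddfN.
by rewrite neg mulmxN -mulNmx opprB.
Qed.

Lemma det_mx2 (K : comNzRingType) (A : 'M[K]_2) :
  \det A = A 0 0 * A 1 1 - A 0 1 * A 1 0.
Proof.
rewrite (expand_det_row _ 0) !big_ord_recl big_ord0 /cofactor !det_mx11 !mxE.
rewrite /= addn0 expr0 expr1 mul1r mulN1r addr0 mulrN.
by congr (A _ _ * A _ _ - A _ _ * A _ _); apply: val_inj.
Qed.

Lemma Delta3_vecE (q : 'rV[R]_3) (r c : 'I_2) : Delta3 (clvec q) r c =
  nth 0 (nth [::] [:: [:: 0 +i* q 0 0; q 0 1 +i* q 0 (lift 0 (lift 0 0))];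
   [:: - q 0 1 +i* q 0 (lift 0 (lift 0 0)); 0 +i* - q 0 0]]%C r) c.
Proof.
have -> : (1 : 'I_3) = lift 0 0 by exact: val_inj.
rewrite /Delta3 (cl_rep_vec (@gamma3P R)) !big_ord_recl big_ord0 !mxE /=.
by case: r => [[|[|//]] ?]; case: c => [[|[|//]] ?] /=;
  apply/eqP; rewrite eq_complex /=; apply/andP; split; apply/eqP => /=; ring.
Qed.

Lemma det_quaternion (q : 'rV[R]_3) (t : R) :
  \det (Delta3 (clvec q) + (t%:C%C)%:M) = ((t ^+ 2 + dotr q q)%:C)%C.
Proof.
rewrite det_mx2 !mxE !Delta3_vecE /= /dotr !big_ord_recl big_ord0.
have -> : (1 : 'I_3) = lift 0 0 by exact: val_inj.
by apply/eqP; rewrite eq_complex /=; apply/andP; split; apply/eqP => /=; ring.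
Qed.

(** The determinant on a product of two vectors is the product of their
    squared norms. *)
Lemma det_Delta4_plus a : spin a -> \det (Delta4_plus a) = 1.
Proof.
move: a; apply: spin_ind => [|v w a v1 w1 sa IH].
  by rewrite Delta4_plus1 det1.
have svw := spin_vec2 v1 w1.
rewrite Delta4_plusM // det_mulmx IH mulr1 (Delta4_plus_vec2 v w) det_mulmx.
rewrite /chiral_up /chiral_down -raddfN -rmorphN /= !det_quaternion sqrrN.
by rewrite !quaternion_norm v1 w1 mulr1.
Qed.

Local Notation D7 := (@Delta7 R).

Lemma tensDl (m n p q : nat) (A B : 'M[C]_(m, n)) (D : 'M[C]_(p, q)) :
  (A + B) *t D = A *t D + B *t D.
Proof. by apply/matrixP => r c; rewrite !mxE mulrDl. Qed.

Lemma tens1mx (m n : nat) : (1%:M : 'M[C]_m) *t (1%:M : 'M[C]_n) = 1%:M.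
Proof.
apply/matrixP => r c; case: (mxtens_indexP r) => r1 r2.
case: (mxtens_indexP c) => c1 c2; rewrite tensmxE !mxE.
rewrite (inj_eq (can_inj (@mxtens_indexK _ _))) xpair_eqE.
by case: eqP; case: eqP; rewrite ?mulr1 ?mulr0 ?mul0r.
Qed.

Lemma tens_suml (m n p q : nat) (I : Type) (r : seq I) (F : I -> 'M[C]_(m, n))
  (D : 'M[C]_(p, q)) : (\sum_(i <- r) F i) *t D = \sum_(i <- r) F i *t D.
Proof.
elim: r => [|i r IH]; first by rewrite !big_nil tens0mx.
by rewrite !big_cons tensDl IH.
Qed.

Lemma tensDr (m n p q : nat) (A B : 'M[C]_(m, n)) (D : 'M[C]_(p, q)) :
  D *t (A + B) = D *t A + D *t B.
Proof. by apply/matrixP => r c; rewrite !mxE mulrDr. Qed.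

Lemma tens_sumr (m n p q : nat) (I : Type) (r : seq I) (F : I -> 'M[C]_(m, n))
  (D : 'M[C]_(p, q)) : D *t (\sum_(i <- r) F i) = \sum_(i <- r) D *t F i.
Proof.
elim: r => [|i r IH]; first by rewrite !big_nil tensmx0.
by rewrite !big_cons tensDr IH.
Qed.

Lemma tensZl (m n p q : nat) k (A : 'M[C]_(m, n)) (D : 'M[C]_(p, q)) :
  (k *: A) *t D = k *: (A *t D).
Proof. by apply/matrixP => r c; rewrite !mxE mulrA. Qed.

Lemma tensZr (m n p q : nat) k (A : 'M[C]_(m, n)) (D : 'M[C]_(p, q)) :
  D *t (k *: A) = k *: (D *t A).
Proof. by apply/matrixP => r c; rewrite !mxE; ring. Qed.

Lemma Delta7_vec (u : 'rV[R]_(4 + 3)) : D7 (clvec u) =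
  Delta4 (clvec (lsubmx u)) *t 1%:M + vol4 R *t Delta3 (clvec (rsubmx u)).
Proof.
transitivity (\sum_(i < 4 + 3) (u 0 i)%:C%C *: @gamma7 R i).
  by rewrite /Delta7 (cl_rep_vec (@gamma7P R)).
rewrite /Delta4 /Delta3 (cl_rep_vec (@gamma4P R)) (cl_rep_vec (@gamma3P R)).
rewrite tens_suml tens_sumr big_split_ord; congr (_ + _);
  apply: eq_bigr => i _; rewrite ?tensZl ?tensZr !mxE; congr (_ *: _).
  by rewrite /gamma7 (unsplitK (inl i)).
by rewrite /gamma7 (unsplitK (inr i)).
Qed.

Lemma Delta7_l a x : spin a ->
  D7 (@cl_inl R 4 3 a * x) = (Delta4 a *t 1%:M) *m D7 x.
Proof.
move=> [vs [_ _ ->]]; rewrite -/(clprod vs).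
elim: vs => [|v vs IH].
  by rewrite /clprod big_nil rmorph1 mul1r Delta4_1 tens1mx mul1mx.
rewrite clprod_cons rmorphM /= -mulrA.
have -> : @cl_inl R 4 3 (clvec v) = clvec (row_mx v 0).
  by rewrite clvec_row !raddf0 addr0.
rewrite /Delta7 (cl_rep_vecM (@gamma7P R)) -/(Delta7 _) -/(Delta7 _) IH.
rewrite Delta7_vec row_mxKl row_mxKr raddf0 /Delta3 raddf0 tensmx0 addr0 mulmxA.
by rewrite tensmx_mul mulmx1 /Delta4 (cl_rep_vecM (@gamma4P R)).
Qed.

(** On the second summand each vector acts through the grading operator
    vol4, which cancels in products of two vectors. *)
Lemma Delta7_r (b : clifford R 3) : spin b -> D7 (@cl_inr R 4 3 b) = 1%:M *t Delta3 b.
Proof.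
move: b; apply: spin_ind => [|v w b v1 w1 sb IH].
  by rewrite rmorph1 /Delta7 /Delta3 !cl_rep1 tens1mx.
have row0 (u : 'rV[R]_3) : @cl_inr R 4 3 (clvec u) = clvec (row_mx 0 u).
  by rewrite clvec_row !raddf0 add0r.
have D7r (u : 'rV[R]_3) : D7 (clvec (row_mx 0 u : 'rV_(4 + 3))) = vol4 R *t Delta3 (clvec u).
  by rewrite Delta7_vec row_mxKl row_mxKr raddf0 /Delta4 raddf0 tens0mx add0r.
rewrite !rmorphM /= -mulrA !row0.
rewrite /Delta7 !(cl_rep_vecM (@gamma7P R)) -!/(Delta7 _) IH !D7r.
rewrite !tensmx_mul mulmx1 vol4_sqr /Delta3 -mulrA.
by rewrite !(cl_rep_vecM (@gamma3P R)).
Qed.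

(** Even elements of the two Clifford algebras commute, and the graded
    tensor product of modules is an ordinary one for them. *)
Lemma Delta7_tens a (b : clifford R 3) : spin a -> spin b ->
  D7 (@cl_inl R 4 3 a * cl_inr 4 b) = Delta4 a *t Delta3 b.
Proof. by move=> sa sb; rewrite Delta7_l // Delta7_r // tensmx_mul mulmx1 mul1mx. Qed.

End SpinRepresentations.

(** * Descent from Spin(4) to SO(4) *)

Section QuadraticFunctions.
Variable R : realType.
Local Notation C := R[i].
Local Notation Cl4 := (clifford R 4).
Implicit Types (f g : Cl4 -> R) (F G : Cl4 -> C) (a b : Cl4).

Definition linear_on_spin f :=
  exists c, forall a, spin a -> f a = \sum_S c S * a S.

(** Only the values on Spin(4) matter. The explicit coefficients are what
    allows one to replace the products of coordinates by [cover_quad]. *)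
Definition quadratic_on_spin f :=
  exists c, forall a, spin a -> f a = \sum_S \sum_T c S T * (a S * a T).

Lemma linear_ext f g : (forall a, spin a -> f a = g a) ->
  linear_on_spin f -> linear_on_spin g.
Proof. by move=> fg [c cE]; exists c => a sa; rewrite -fg // cE. Qed.

Lemma quadratic_ext f g : (forall a, spin a -> f a = g a) ->
  quadratic_on_spin f -> quadratic_on_spin g.
Proof. by move=> fg [c cE]; exists c => a sa; rewrite -fg // cE. Qed.

Lemma linear_coef (S : {set 'I_4}) : linear_on_spin (fun a => a S).
Proof.
exists (fun T => (T == S)%:R) => a _; rewrite (bigD1 S) //= eqxx mul1r.
by rewrite big1 ?addr0 // => T /negPf ->; rewrite mul0r.
Qed.

Lemma linearD_on_spin f g : linear_on_spin f -> linear_on_spin g ->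
  linear_on_spin (fun a => f a + g a).
Proof.
move=> [c cE] [d dE]; exists (fun S => c S + d S) => a sa.
by rewrite cE // dE // -big_split; apply: eq_bigr => S _; rewrite mulrDl.
Qed.

Lemma linearZ_on_spin f r : linear_on_spin f -> linear_on_spin (fun a => r * f a).
Proof.
move=> [c cE]; exists (fun S => r * c S) => a sa.
by rewrite cE // mulr_sumr; apply: eq_bigr => S _; rewrite mulrA.
Qed.

Lemma linear_sum_on_spin (I : Type) (r : seq I) (P : pred I) (h : I -> Cl4 -> R) :
  (forall i, linear_on_spin (h i)) ->
  linear_on_spin (fun a => \sum_(i <- r | P i) h i a).
Proof.
move=> lh; elim: r => [|i r IH].
  exists (fun _ => 0) => a _; rewrite big_nil big1 // => S _.
  by rewrite mul0r.
apply: (@linear_ext (fun a => (if P i then 1 else 0) * h i a +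
    \sum_(j <- r | P j) h j a)) => [a _|].
  by rewrite big_cons; case: (P i); rewrite ?mul1r // mul0r add0r.
by apply: linearD_on_spin => //; exact: linearZ_on_spin.
Qed.

Lemma quadraticM f g : linear_on_spin f -> linear_on_spin g ->
  quadratic_on_spin (fun a => f a * g a).
Proof.
move=> [c cE] [d dE]; exists (fun S T => c S * d T) => a sa.
rewrite cE // dE // mulr_suml; apply: eq_bigr => S _.
by rewrite mulr_sumr; apply: eq_bigr => T _; ring.
Qed.

Lemma quadraticD f g : quadratic_on_spin f -> quadratic_on_spin g ->
  quadratic_on_spin (fun a => f a + g a).
Proof.
move=> [c cE] [d dE]; exists (fun S T => c S T + d S T) => a sa.
rewrite cE // dE // -big_split; apply: eq_bigr => S _.
by rewrite -big_split; apply: eq_bigr => T _; rewrite mulrDl.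
Qed.

Lemma quadraticZ f r : quadratic_on_spin f -> quadratic_on_spin (fun a => r * f a).
Proof.
move=> [c cE]; exists (fun S T => r * c S T) => a sa.
rewrite cE // mulr_sumr; apply: eq_bigr => S _.
by rewrite mulr_sumr; apply: eq_bigr => T _; ring.
Qed.

Lemma quadratic_sum (I : Type) (r : seq I) (P : pred I) (h : I -> Cl4 -> R) :
  (forall i, quadratic_on_spin (h i)) ->
  quadratic_on_spin (fun a => \sum_(i <- r | P i) h i a).
Proof.
move=> lh; elim: r => [|i r IH].
  exists (fun _ _ => 0) => a _; rewrite big_nil big1 // => S _.
  by rewrite big1 // => T _; rewrite mul0r.
apply: (@quadratic_ext (fun a => (if P i then 1 else 0) * h i a +
    \sum_(j <- r | P j) h j a)) => [a _|].
  by rewrite big_cons; case: (P i); rewrite ?mul1r // mul0r add0r.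
by apply: quadraticD => //; exact: quadraticZ.
Qed.

Definition clinear F :=
  linear_on_spin (fun a => Re (F a)) /\ linear_on_spin (fun a => Im (F a)).
Definition cquadratic F :=
  quadratic_on_spin (fun a => Re (F a)) /\ quadratic_on_spin (fun a => Im (F a)).

Lemma clinear_ext F G : (forall a, spin a -> F a = G a) -> clinear F -> clinear G.
Proof. by move=> FG [Fr Fi]; split; [apply: linear_ext Fr|apply: linear_ext Fi] => a /FG ->. Qed.

Lemma cquadratic_ext F G : (forall a, spin a -> F a = G a) ->
  cquadratic F -> cquadratic G.
Proof.
by move=> FG [Fr Fi]; split; [apply: quadratic_ext Fr|apply: quadratic_ext Fi] => a /FG ->.
Qed.

Lemma clinearZ (f : Cl4 -> R) (k : C) : linear_on_spin f ->
  clinear (fun a => (f a)%:C%C * k).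
Proof.
move=> lf; case: k => kr ki; split.
  apply: (linear_ext _ (linearZ_on_spin kr lf)) => a _ /=.
  by rewrite mul0r subr0 mulrC.
apply: (linear_ext _ (linearZ_on_spin ki lf)) => a _ /=.
by rewrite mul0r addr0 mulrC.
Qed.

Lemma cquadraticM F G : clinear F -> clinear G -> cquadratic (fun a => F a * G a).
Proof.
move=> [Fr Fi] [Gr Gi]; split.
  apply: (@quadratic_ext (fun a => Re (F a) * Re (G a) + (-1) * (Im (F a) * Im (G a)))).
    by move=> a _; case: (F a) (G a) => [x y] [z t] /=; rewrite mulN1r.
  by apply: quadraticD; [|apply: quadraticZ]; exact: quadraticM.
apply: (@quadratic_ext (fun a => Re (F a) * Im (G a) + Im (F a) * Re (G a))).
  by move=> a _; case: (F a) (G a) => [x y] [z t].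
by apply: quadraticD; exact: quadraticM.
Qed.

Lemma cquadraticZ F (k : C) : cquadratic F -> cquadratic (fun a => F a * k).
Proof.
move=> [Fr Fi]; case: k => x y; split.
  apply: (@quadratic_ext (fun a => x * Re (F a) + (- y) * Im (F a))).
    by move=> a _; case: (F a) => z t /=; ring.
  by apply: quadraticD; exact: quadraticZ.
apply: (@quadratic_ext (fun a => y * Re (F a) + x * Im (F a))).
  by move=> a _; case: (F a) => z t /=; ring.
by apply: quadraticD; exact: quadraticZ.
Qed.

Lemma Re_sum (I : Type) (r : seq I) (P : pred I) (h : I -> C) :
  Re (\sum_(i <- r | P i) h i) = \sum_(i <- r | P i) Re (h i).
Proof. by elim/big_rec2: _ => // i x y _ <-; case: (h i) y => ? ? [? ?]. Qed.

Lemma Im_sum (I : Type) (r : seq I) (P : pred I) (h : I -> C) :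
  Im (\sum_(i <- r | P i) h i) = \sum_(i <- r | P i) Im (h i).
Proof. by elim/big_rec2: _ => // i x y _ <-; case: (h i) y => ? ? [? ?]. Qed.

Lemma clinear_sum (I : Type) (r : seq I) (P : pred I) (h : I -> Cl4 -> C) :
  (forall i, clinear (h i)) -> clinear (fun a => \sum_(i <- r | P i) h i a).
Proof.
move=> lh; split.
  apply: (@linear_ext (fun a => \sum_(i <- r | P i) Re (h i a))) => [a _|].
    by rewrite Re_sum.
  by apply: linear_sum_on_spin => i; case: (lh i).
apply: (@linear_ext (fun a => \sum_(i <- r | P i) Im (h i a))) => [a _|].
  by rewrite Im_sum.
by apply: linear_sum_on_spin => i; case: (lh i).
Qed.

Lemma cquadratic_sum (I : Type) (r : seq I) (P : pred I) (h : I -> Cl4 -> C) :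
  (forall i, cquadratic (h i)) -> cquadratic (fun a => \sum_(i <- r | P i) h i a).
Proof.
move=> lh; split.
  apply: (@quadratic_ext (fun a => \sum_(i <- r | P i) Re (h i a))) => [a _|].
    by rewrite Re_sum.
  by apply: quadratic_sum => i; case: (lh i).
apply: (@quadratic_ext (fun a => \sum_(i <- r | P i) Im (h i a))) => [a _|].
  by rewrite Im_sum.
by apply: quadratic_sum => i; case: (lh i).
Qed.

Lemma quadratic_cover f : quadratic_on_spin f -> exists c,
  forall a, spin a -> f a = \sum_S \sum_T c S T * cover_quad (spin_cover a) S T.
Proof.
move=> [c cE]; exists c => a sa; rewrite cE //; apply: eq_bigr => S _.
by apply: eq_bigr => T _; rewrite cover_quadE.
Qed.

(** In particular an even function of this kind does not distinguish the two
    lifts of a rotation. *)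
Lemma quadratic_lift f a b : quadratic_on_spin f -> spin a -> spin b ->
  spin_cover a = spin_cover b -> f a = f b.
Proof. by move=> /quadratic_cover[c cE] sa sb ab; rewrite (cE a sa) (cE b sb) ab. Qed.

End QuadraticFunctions.

Section Descent.
Variable R : realType.
Local Notation C := R[i].
Local Notation Cl4 := (clifford R 4).
Implicit Types (a b : Cl4) (A B : 'M[R]_4).

(** The choice of lift made in [descended]. It is arbitrary at each rotation
    and may jump between the two sheets of the cover; it is only ever used
    through quadratic expressions. *)
Definition spin_lift A : Cl4 := xget 0 [set a : Cl4 | spin a /\ spin_cover a = A]%classic.

Lemma spin_liftP A : SO A -> spin (spin_lift A) /\ spin_cover (spin_lift A) = A.
Proof.
move=> /spin_cover_surj[a sa aA]; rewrite /spin_lift.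
by case: xgetP => [x _ []//|/(_ a)[]].
Qed.

(** Representations with matrix entries quadratic in the coordinates of the
    spin element. They take the same value at a and - a, hence descend to
    SO(4), and the descended representation is polynomial in the entries of
    the rotation. *)
Record even_rep (r c : nat) (rho : spin4_rep R r c) : Prop := EvenRep {
  even_rep_linear : forall a, linear (rho a);
  even_rep1 : forall v, rho 1 v = v;
  even_repM : forall a b v, spin a -> spin b -> rho (a * b) v = rho a (rho b v);
  even_rep_quadratic : forall v i j, cquadratic (fun a => rho a v i j)
}.

Section EvenRep.
Variables (r c : nat) (rho : spin4_rep R r c).
Hypothesis rhoP : even_rep rho.
Local Notation rho' := (descended rho).

Lemma even_rep_lift a b v : spin a -> spin b ->
  spin_cover a = spin_cover b -> rho a v = rho b v.
Proof.
move=> sa sb ab; apply/matrixP => i j.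
have [qr qi] := even_rep_quadratic rhoP v i j.
apply/eqP; rewrite eq_complex; apply/andP; split; apply/eqP.
  exact: quadratic_lift qr sa sb ab.
exact: quadratic_lift qi sa sb ab.
Qed.

Lemma even_rep_descends : descends rho.
Proof.
move=> a sa; apply/funext => v.
have [sl la] := spin_liftP (spin_cover_SO sa).
exact: (even_rep_lift v sl sa la).
Qed.

Lemma descended1 v : rho' 1%:M v = v.
Proof. by rewrite -spin_cover1 even_rep_descends ?even_rep1 //; exact: spin1. Qed.

Lemma descendedM A B v : SO A -> SO B -> rho' (A *m B) v = rho' A (rho' B v).
Proof.
move=> /spin_cover_surj[a sa <-] /spin_cover_surj[b sb <-].
rewrite -spin_coverM // !even_rep_descends ?even_repM //.
exact: spinM.
Qed.

Lemma descended_linear A : linear (rho' A).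
Proof. exact: even_rep_linear. Qed.

End EvenRep.

(** Matrix representations of Spin(4) with entries linear in the
    coordinates, such as those induced from modules over the Clifford
    algebra. They change sign with a, and the tensor product of two of them
    descends to SO(4). *)
Record spin_mx_rep (N : nat) (D : Cl4 -> 'M[C]_N) : Prop := SpinMxRep {
  spin_mx_rep1 : D 1 = 1%:M;
  spin_mx_repM : forall a b, spin a -> spin b -> D (a * b) = D a *m D b;
  spin_mx_rep_linear : forall i j, clinear (fun a => D a i j)
}.

Lemma tens_rep_even (N N' : nat) (D : Cl4 -> 'M[C]_N) (D' : Cl4 -> 'M[C]_N') :
  spin_mx_rep D -> spin_mx_rep D' -> even_rep (tens_rep D D').
Proof.
move=> [D1 DM Dl] [D1' DM' Dl']; split.
- by move=> a k u v; rewrite /tens_rep /mx_rep mulmxDr scalemxAr.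
- by move=> v; rewrite /tens_rep /mx_rep D1 D1' tens1mx mul1mx.
- move=> a b v sa sb; rewrite /tens_rep /mx_rep DM // DM' //.
  by rewrite -tensmx_mul mulmxA.
- move=> v i j; pose h a k := (D a *t D' a) i k * v k j.
  apply: (@cquadratic_ext _ (fun a => \sum_k h a k)).
    by move=> a _; rewrite /tens_rep /mx_rep mxE.
  apply: cquadratic_sum => k; apply: cquadraticZ.
  case: (mxtens_indexP i) => i1 i2; case: (mxtens_indexP k) => k1 k2.
  apply: (@cquadratic_ext _ (fun a => D a i1 k1 * D' a i2 k2)).
    by move=> a _; rewrite tensmxE.
  exact: cquadraticM.
Qed.

Lemma linear_rev (f : Cl4 -> R) : linear_on_spin f -> linear_on_spin (fun a => f (clrev a)).
Proof.
move=> [c cE]; exists (fun S => c S * (-1) ^+ 'C(#|S|, 2)) => a sa.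
rewrite cE; last exact: spin_rev.
by apply: eq_bigr => S _; rewrite ffunE mulrA.
Qed.

Lemma spin_mx_inv (N : nat) (D : Cl4 -> 'M[C]_N) a :
  spin_mx_rep D -> spin a -> D a \in unitmx /\ invmx (D a) = D (clrev a).
Proof.
move=> [D1 DM Dl] sa.
have e : D a *m D (clrev a) = 1%:M by rewrite -DM ?spin_revr //; exact: spin_rev.
have [ua _] := mulmx1_unit e; split=> //.
by rewrite -[RHS](mulKmx ua) e mulmx1.
Qed.

(** The inverse of D a is D (clrev a), again linear in a, so that
    conjugation is quadratic. *)
Lemma end_rep_even (N : nat) (D : Cl4 -> 'M[C]_N) :
  spin_mx_rep D -> even_rep (end_rep D).
Proof.
move=> DP; have [D1 DM Dl] := DP; split.
- by move=> a k u v; rewrite /end_rep mulmxDr mulmxDl -scalemxAr -scalemxAl.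
- by move=> v; rewrite /end_rep D1 invmx1 mulmx1 mul1mx.
- move=> a b v sa sb; have [ua ia] := spin_mx_inv DP sa; have [ub ib] := spin_mx_inv DP sb.
  have [_ iab] := spin_mx_inv DP (spinM sa sb).
  have sa' := spin_rev sa; have sb' := spin_rev sb.
  by rewrite /end_rep iab ia ib clrevM !DM // !mulmxA.
- move=> v i j; pose h a k l := D a i l * D (clrev a) k j * v l k.
  apply: (@cquadratic_ext _ (fun a => \sum_k \sum_l h a k l)) => [a sa|].
    have [_ ia] := spin_mx_inv DP sa; rewrite /end_rep ia mxE.
    apply: eq_bigr => k _; rewrite mxE mulr_suml; apply: eq_bigr => l _.
    by rewrite /h; ring.
  apply: cquadratic_sum => k; apply: cquadratic_sum => l; apply: cquadraticZ.
  apply: cquadraticM => //; have [lr li] := Dl k j.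
  by split; [exact: (linear_rev lr)|exact: (linear_rev li)].
Qed.

Lemma cl_rep_linear (n N : nat) (gamma : 'I_n -> 'M[C]_N) (F : Cl4 -> clifford R n) i j :
  (forall S, linear_on_spin (fun a => F a S)) ->
  clinear (fun a => cl_rep gamma (F a) i j).
Proof.
move=> lF; pose h a S := (F a S)%:C%C *
  (\big[mulmx/1%:M]_(k < n | k \in S) gamma k) i j.
apply: (@clinear_ext _ (fun a => \sum_S h a S)) => [a _|].
  by rewrite /cl_rep summxE; apply: eq_bigr => S _; rewrite mxE.
by apply: clinear_sum => S; exact: clinearZ.
Qed.

Lemma Delta4_spin_mx : spin_mx_rep (@Delta4 R).
Proof.
split; first exact: Delta4_1.
  by move=> a b sa _; exact: Delta4_spinM.
by move=> i j; apply: cl_rep_linear => S; exact: linear_coef.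
Qed.

Lemma Delta4_plus_spin_mx : spin_mx_rep (@Delta4_plus R).
Proof.
split; [exact: Delta4_plus1|exact: Delta4_plusM|move=> i j].
have [_ _ /(_ (lshift 2 i) (lshift 2 j))] := Delta4_spin_mx.
by apply: clinear_ext => a _; rewrite !mxE.
Qed.

Lemma Delta3_pr_spin_mx : spin_mx_rep (@Delta3 R \o @pr_plus R).
Proof.
have [D1 DM Dl] := Delta4_plus_spin_mx; split.
- by rewrite /= -Delta4_plusE ?D1 //; exact: spin1.
- by move=> a b sa sb; rewrite /= -!Delta4_plusE ?DM //; exact: spinM.
- by move=> i j; apply: clinear_ext (Dl i j) => a sa; rewrite /= -Delta4_plusE.
Qed.

End Descent.

(** * Spin(4) inside Spin(7) and self-dual forms *)

Section Spin7Lift.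
Variable R : realType.
Local Notation Cl4 := (clifford R 4).
Implicit Types (a b : Cl4).

Lemma spin_inl (m n : nat) (a : clifford R m) : spin a -> spin (cl_inl n a).
Proof.
move: a; apply: spin_ind => [|v w a v1 w1 sa IH]; first by rewrite rmorph1; exact: spin1.
have row0 (u : 'rV[R]_m) : cl_inl n (clvec u) = clvec (row_mx u 0).
  by rewrite clvec_row !raddf0 addr0.
have dot0 (u : 'rV[R]_m) : dotr (row_mx u 0 : 'rV_(m + n)) (row_mx u 0) = dotr u u.
  rewrite /dotr big_split_ord /= [X in _ + X]big1 ?addr0 => [|i _].
    by apply: eq_bigr => i _; rewrite !row_mxEl.
  by rewrite !row_mxEr mxE mul0r.
by rewrite !rmorphM /= !row0; apply: spinM => //; apply: spin_vec2; rewrite dot0.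
Qed.

Lemma spin_inr (m n : nat) (b : clifford R n) : spin b -> spin (cl_inr m b).
Proof.
move: b; apply: spin_ind => [|v w a v1 w1 sa IH]; first by rewrite rmorph1; exact: spin1.
have row0 (u : 'rV[R]_n) : cl_inr m (clvec u) = clvec (row_mx 0 u).
  by rewrite clvec_row !raddf0 add0r.
have dot0 (u : 'rV[R]_n) : dotr (row_mx 0 u : 'rV_(m + n)) (row_mx 0 u) = dotr u u.
  rewrite /dotr big_split_ord /= [X in X + _]big1 ?add0r => [|i _].
    by apply: eq_bigr => i _; rewrite !row_mxEr.
  by rewrite !row_mxEl mxE mul0r.
by rewrite !rmorphM /= !row0; apply: spinM => //; apply: spin_vec2; rewrite dot0.
Qed.

(** An even element built from one summand commutes with the vectors of the
    other, hence acts trivially on them. *)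
Lemma acts_inl (m n : nat) (a : clifford R m) : spin a ->
  acts (cl_inl n a) (block_mx (spin_cover a) 0 0 1%:M).
Proof.
move=> sa w; rewrite -[w]hsubmxK clvec_row clrev_inl tr_block_mx mul_row_block.
rewrite !trmx0 !mulmx0 addr0 add0r trmx1 mulmx1 clvec_row -(spin_acts sa).
rewrite mulrDr mulrDl !rmorphM /=; congr (_ + _).
rewrite -mulrA (cl_inr_inl (clparity_rev (spin_parity sa)) (@clparity_vec _ _ _)).
by rewrite scale1r mulrA -rmorphM /= spin_revr // rmorph1 mul1r.
Qed.

Lemma acts_inr (m n : nat) (b : clifford R n) : spin b ->
  acts (cl_inr m b) (block_mx 1%:M 0 0 (spin_cover b)).
Proof.
move=> sb w; rewrite -[w]hsubmxK clvec_row clrev_inr tr_block_mx mul_row_block.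
rewrite !trmx0 !mulmx0 addr0 add0r trmx1 mulmx1 clvec_row -(spin_acts sb).
rewrite mulrDr mulrDl !rmorphM /=; congr (_ + _).
rewrite (cl_inr_inl (@clparity_vec _ _ _) (spin_parity sb)) andbF scale1r.
by rewrite -mulrA -rmorphM /= spin_revr // rmorph1 mulr1.
Qed.

(** The image of (a, pr_plus a) under Spin(4) x Spin(3) -> Spin(7). Both
    factors change sign with a, so their product depends only on the
    rotation defined by a: this is why TM + Lambda^+ is spin although
    neither summand need be. *)
Definition spin7_lift a : clifford R (4 + 3) := cl_inl 3 a * cl_inr 4 (pr_plus a).

Lemma spin_spin7_lift a : spin a -> spin (spin7_lift a).
Proof. by move=> sa; apply: spinM; [apply: spin_inl|apply/spin_inr/spin_pr_plus]. Qed.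

Lemma spin7_liftM a b : spin a -> spin b ->
  spin7_lift (a * b) = spin7_lift a * spin7_lift b.
Proof.
move=> sa sb; rewrite /spin7_lift pr_plusM // !rmorphM /= -!mulrA; congr (_ * _).
rewrite !mulrA; congr (_ * _).
by rewrite (cl_inr_inl (spin_parity sb) (spin_parity (spin_pr_plus sa))) scale1r.
Qed.

Lemma spin7_lift_cover a : spin a -> spin_cover (spin7_lift a) =
  block_mx (spin_cover a) 0 0 (spin_cover (pr_plus a)).
Proof.
move=> sa; have sp := spin_pr_plus sa.
rewrite (acts_spin_cover (actsM (@acts_inl 4 3 _ sa) (@acts_inr 4 3 _ sp))) mulmx_block.
by rewrite !mul0mx !mulmx0 !mulmx1 !mul1mx !addr0 !add0r.
Qed.

Lemma pr_plus_linear (S : {set 'I_3}) : linear_on_spin (fun a => pr_plus a S).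
Proof.
pose S' := [set widen_ord (leqnSn 3) i | i in S]%SET.
have l1 := linear_coef R S'.
pose h A a := (csign R A (symdiff A S') * clvol R 4 (symdiff A S')) * a A.
apply: (@linear_ext _ (fun a => a S' + (-1) * \sum_A h A a)) => [a _|].
  rewrite [in RHS]ffunE clsubE clmulE mulN1r.
  by congr (_ - _); apply: eq_bigr => A _; rewrite /h; ring.
apply: linearD_on_spin => //; apply: linearZ_on_spin.
apply: linear_sum_on_spin => A; apply: linearZ_on_spin; exact: linear_coef.
Qed.

Lemma linear_clmap (m n : nat) (f : 'I_m -> 'I_n) (F : Cl4 -> clifford R m) T :
  (forall S, linear_on_spin (fun a => F a S)) ->
  linear_on_spin (fun a => clmap f (F a) T).
Proof.
move=> lF; apply: (@linear_ext _ (fun a =>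
    \sum_(S : {set 'I_m}) cle R (f @: S)%SET T * F a S)) => [a _|].
  by rewrite /clmap cl_sum_coef; apply: eq_bigr => S _; rewrite clscaleE mulrC.
by apply: linear_sum_on_spin => S; exact: linearZ_on_spin.
Qed.

Lemma spin7_lift_quadratic S : quadratic_on_spin (fun a => spin7_lift a S).
Proof.
apply: (@quadratic_ext _ (fun a => \sum_A csign R A (symdiff A S) *
    (cl_inl 3 a A * cl_inr 4 (pr_plus a) (symdiff A S)))) => [a _|].
  by rewrite clmulE.
apply: quadratic_sum => A; apply: quadraticZ; apply: quadraticM.
  by apply: linear_clmap => T; exact: linear_coef.
apply: linear_clmap => T; exact: pr_plus_linear.
Qed.

End Spin7Lift.

Section SelfDualRotation.
Variable R : realType.
Local Notation omega := (clvol R 3).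
Implicit Types (k l : 'I_4) (c d : 'I_3).

(** The self-dual forms e^14 + e^23, e^24 - e^13 and e^12 + e^34, as
    skew-symmetric matrices. The order and the signs are those for which the
    induced action on self-dual forms is the rotation of the vectors e_1,
    e_2, e_3 of R^3. *)
Definition sdform c : 'M[R]_4 := \matrix_(k, l)
  nth 0 (nth [::] (nth [::]
   [:: [:: [:: 0; 0; 0; 1]; [:: 0; 0; 1; 0]; [:: 0; -1; 0; 0]; [:: -1; 0; 0; 0]];
       [:: [:: 0; 0; -1; 0]; [:: 0; 0; 0; 1]; [:: 1; 0; 0; 0]; [:: 0; -1; 0; 0]];
       [:: [:: 0; 1; 0; 0]; [:: -1; 0; 0; 0]; [:: 0; 0; 0; 1]; [:: 0; 0; -1; 0]]]
   c) k) l.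

Lemma sdform_skew c : (sdform c)^T = - sdform c.
Proof.
apply/matrixP => k l; rewrite !mxE.
by case: c => [[|[|[|//]]] ?]; case: k => [[|[|[|[|//]]]] ?];
  case: l => [[|[|[|[|//]]]] ?]; rewrite /= ?oppr0 ?opprK.
Qed.

Lemma sdform_dot c d : \sum_k \sum_l sdform c k l * sdform d k l = 4 * (c == d)%:R.
Proof.
rewrite !big_ord_recl !big_ord0 !mxE /=.
by case: c => [[|[|[|//]]] ?]; case: d => [[|[|[|//]]] ?] /=; ring.
Qed.

(** The coefficients of e2 e3, e3 e1 and e1 e2: in Cl_3, these bivectors are
    - omega e_c, and omega omega = 1. *)
Definition dual_coef c (y : clifford R 3) : R := - (omega * y) [set c]%SET.

Fact dual_coef_is_linear c : linear (dual_coef c : _ -> R^o).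
Proof.
move=> r x y; rewrite /dual_coef mulrDr -scalerAr !ffunE.
by rewrite /GRing.scale /=; ring.
Qed.

HB.instance Definition _ c := GRing.isLinear.Build R _ R^o _ (dual_coef c)
  (dual_coef_is_linear c).

(** Membership of the three indices decides equality of subsets, which lets
    the sums over subsets be evaluated case by case. *)
Lemma set3_eq (S T : {set 'I_3}) : (S == T) =
  [&& (0 \in S) == (0 \in T), (1 \in S) == (1 \in T) &
      (lift 0 (lift 0 0) \in S) == (lift 0 (lift 0 0) \in T)].
Proof.
apply/eqP/and3P => [->//|[/eqP e0 /eqP e1 /eqP e2]].
apply/setP => -[[|[|[|//]]] ?].
- by move: e0; congr ((_ \in S) = (_ \in T)); apply: val_inj.
- by move: e1; congr ((_ \in S) = (_ \in T)); apply: val_inj.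
- by move: e2; congr ((_ \in S) = (_ \in T)); apply: val_inj.
Qed.

Lemma csign_omega d : csign R finset.setT [set d]%SET = (-1) ^+ d.+1.
Proof.
rewrite /csign; under eq_bigr do rewrite finset.big_set1.
under eq_bigl do rewrite finset.in_setT.
rewrite !big_ord_recl big_ord0 /=.
by case: d => [[|[|[|//]]] ?] /=; ring.
Qed.

Lemma dual_coef_ee c d e : dual_coef c (cle R [set d]%SET * cle R [set e]%SET) =
  sdform c (widen_ord (leqnSn 3) d) (widen_ord (leqnSn 3) e).
Proof.
rewrite /dual_coef clvol_cle mulrA cle_mul -scalerAl cle_mul scalerA clscaleE.
rewrite ffunE set3_eq !finset.inE csignDl csign1 !csign_omega mxE.
by case: c => [[|[|[|//]]] ?]; case: d => [[|[|[|//]]] ?];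
  case: e => [[|[|[|//]]] ?] /=; ring.
Qed.

Lemma dual_coef1 c : dual_coef c 1 = 0.
Proof.
rewrite /dual_coef mulr1 clvol_cle ffunE set3_eq !finset.inE.
by case: c => [[|[|[|//]]] ?] /=; rewrite oppr0.
Qed.

Lemma dual_coef_omega c (q : 'rV[R]_3) : dual_coef c (omega * clvec q) = - q 0 c.
Proof. by rewrite /dual_coef mulrA omega_sqr mul1r clvec_coef. Qed.

(** The projection sends e_i e4 to e_i (- omega), so that the bivectors of
    R^4 are projected to those of R^3 exactly by pairing with the three
    self-dual forms. *)
Lemma dual_coef_pr c (k l : 'I_(3 + 1)) :
  dual_coef c (pr_plus (clvec (delta_mx 0 k) * clvec (delta_mx 0 l))) = sdform c k l.
Proof.
have -> := pr_plus_split (split4_vec2 (delta_mx 0 k) (delta_mx 0 l)).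
rewrite /split_even /split_odd mulrBl -!scalerAl -!omega_central.
rewrite !linearB !linearZ /= dual_coef1 !dual_coef_omega.
have lsubl (i : 'I_3) : lsubmx (delta_mx 0 (lshift 1 i) : 'rV[R]_(3 + 1)) = delta_mx 0 i.
  by apply/rowP => j; rewrite !mxE eq_lshift.
have lsubr (i : 'I_1) : lsubmx (delta_mx 0 (rshift 3 i) : 'rV[R]_(3 + 1)) = 0.
  by apply/rowP => j; rewrite !mxE eq_lrshift andbF.
have rsubl (i : 'I_3) : rsubmx (delta_mx 0 (lshift 1 i) : 'rV[R]_(3 + 1)) 0 0 = 0.
  by rewrite !mxE eq_rlshift andbF.
have rsubr (i : 'I_1) : rsubmx (delta_mx 0 (rshift 3 i) : 'rV[R]_(3 + 1)) 0 0 = 1.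
  by rewrite !mxE eq_rshift !ord1 !eqxx.
case: (split_ordP k) => i ->; case: (split_ordP l) => j ->;
  rewrite ?lsubl ?lsubr ?rsubl ?rsubr ?raddf0 ?(mulr0, mul0r).
- rewrite !clvec_delta dual_coef_ee /GRing.scale /= !mul0r !addr0.
  by congr (sdform c _ _); apply: val_inj.
- rewrite raddf0 /GRing.scale /= !mxE /= ord1.
  by case: c => [[|[|[|//]]] ?]; case: i => [[|[|[|//]]] ?] /=; ring.
- rewrite raddf0 /GRing.scale /= !mxE /= ord1.
  by case: c => [[|[|[|//]]] ?]; case: j => [[|[|[|//]]] ?] /=; ring.
- rewrite raddf0 /GRing.scale /= !mxE /= !ord1.
  by case: c => [[|[|[|//]]] ?] /=; ring.
Qed.

Lemma odd_clifford3 (x : clifford R 3) : clparity true x ->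
  x = clvec (\row_c x [set c]%SET) + x finset.setT *: omega.
Proof.
move=> ox; apply/ffunP => S; rewrite claddE clscaleE.
have [oS|eS] := boolP (odd #|S|); last first.
  have nS : odd #|S| != true by rewrite (negPf eS).
  by rewrite (ox S nS) (clparity_vec _ nS) (omega_parity _ nS) mulr0 addr0.
have cS : (#|S| <= 3)%N by have := max_card (mem S); rewrite card_ord.
have [/eqP/cards1P[i ->]|S1] := eqVneq #|S| 1%N.
  rewrite clvec_coef mxE clvol_cle ffunE; case: eqP => [/setP iT|].
    by move: (iT (lift i 0)); rewrite !finset.inE eq_sym (negPf (neq_lift _ _)).
  by rewrite mulr0 addr0.
have S3 : #|S| = 3%N by case: #|S| oS S1 cS => [|[|[|[|]]]].
have -> : S = finset.setT by apply/eqP; rewrite eqEcard finset.subsetT finset.cardsT card_ord S3.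
rewrite [clvec _ _]ffunE big1 => [|i /eqP Ti].
  by rewrite ffunE eqxx mulr1 add0r.
by have := congr1 (fun S : {set 'I_3} => #|S|) Ti; rewrite finset.cardsT card_ord finset.cards1.
Qed.

(** Multiplication by omega exchanges even and odd elements; apply
    [odd_clifford3] to omega y. *)
Lemma even_clifford3 (y : clifford R 3) : clparity false y ->
  exists s, y = s *: 1 - \sum_c dual_coef c y *: (omega * clvec (delta_mx 0 c)).
Proof.
move=> ey; exists ((omega * y) finset.setT).
have oy : clparity true (omega * y).
  exact: (@clparityM _ _ true false) (@omega_parity R) ey.
rewrite -[LHS]mul1r -omega_sqr -mulrA {1}(odd_clifford3 oy) mulrDr -scalerAr.
rewrite omega_sqr addrC; congr (_ + _); rewrite clvecE mulr_sumr -sumrN.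
apply: eq_bigr => c _; rewrite mxE -scalerAr clvec_delta /dual_coef.
by rewrite scaleNr opprK.
Qed.

Fact pr_plus_is_linear : linear (@pr_plus R).
Proof.
move=> r a b; apply/ffunP => S; rewrite [LHS]ffunE [RHS]ffunE clscaleE.
by rewrite mulrDl -scalerAl !ffunE; ring.
Qed.

HB.instance Definition _ := GRing.isLinear.Build R _ _ _ (@pr_plus R)
  pr_plus_is_linear.

(** The quantisation of a bilinear form; conjugation by a spin element
    corresponds to the rotation of the form. *)
Definition bivector (N : 'M[R]_4) : clifford R 4 :=
  \sum_k \sum_l N k l *: (clvec (delta_mx 0 k) * clvec (delta_mx 0 l)).

Lemma dual_coef_bivector c N :
  dual_coef c (pr_plus (bivector N)) = \sum_k \sum_l N k l * sdform c k l.
Proof.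
rewrite /bivector !raddf_sum; apply: eq_bigr => k _.
rewrite !raddf_sum; apply: eq_bigr => l _ /=.
by rewrite !linearZ /= -dual_coef_pr.
Qed.

Lemma bivector_conj (a : clifford R 4) N : spin a ->
  a * bivector N * clrev a = bivector (spin_cover a *m N *m (spin_cover a)^T).
Proof.
move=> sa; set T := spin_cover a.
have conjE p : a * clvec (delta_mx 0 p) * clrev a = \sum_k T k p *: clvec (delta_mx 0 k).
  rewrite (spin_acts sa) clvecE; apply: eq_bigr => k _.
  by rewrite clvec_delta -rowE !mxE.
transitivity (\sum_p \sum_q \sum_k \sum_l (T k p * N p q * T l q) *:
    (clvec (delta_mx 0 k) * clvec (delta_mx 0 l)) : clifford R 4).
  rewrite mulr_sumr mulr_suml; apply: eq_bigr => p _.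
  rewrite mulr_sumr mulr_suml; apply: eq_bigr => q _.
  rewrite -scalerAr -scalerAl.
  have -> : a * (clvec (delta_mx 0 p) * clvec (delta_mx 0 q)) * clrev a =
      (a * clvec (delta_mx 0 p) * clrev a) * (a * clvec (delta_mx 0 q) * clrev a).
    by rewrite !mulrA -(mulrA _ (clrev a) a) spin_revl // mulr1.
  rewrite !conjE mulr_suml scaler_sumr; apply: eq_bigr => k _.
  rewrite mulr_sumr scaler_sumr; apply: eq_bigr => l _.
  by rewrite -scalerAl -scalerAr !scalerA; congr (_ *: _); ring.
under eq_bigr do rewrite exchange_big.
rewrite exchange_big; apply: eq_bigr => k _.
under eq_bigr do rewrite exchange_big.
rewrite exchange_big; apply: eq_bigr => l _ /=.
rewrite mxE exchange_big scaler_suml; apply: eq_bigr => q _.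
rewrite !mxE mulr_suml scaler_suml; apply: eq_bigr => p _.
by rewrite mxE.
Qed.

(** The rotation defined by pr_plus a is the action of a on self-dual forms,
    in the basis [sdform], whose elements have squared length 4 as matrices.
    The bivector of the d-th form projects to a scalar plus 4 (- omega e_d).
    Its conjugate by a projects to the conjugate of this by pr_plus a, which
    rotates e_d by the cover of pr_plus a, since omega is central. *)
Lemma sdform_rotation (a : clifford R 4) c d : spin a ->
  \sum_k \sum_l (spin_cover a *m sdform d *m (spin_cover a)^T) k l * sdform c k l =
  4 * spin_cover (pr_plus a) c d.
Proof.
move=> sa; set p := pr_plus a; have sp : spin p := spin_pr_plus sa.
rewrite -dual_coef_bivector -bivector_conj //.
have conj_pr N : pr_plus (a * bivector N * clrev a) =
    p * pr_plus (bivector N) * clrev p.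
  rewrite mulr_sumr mulr_suml !raddf_sum mulr_sumr mulr_suml /=.
  apply: eq_bigr => k _; rewrite mulr_sumr mulr_suml !raddf_sum mulr_sumr mulr_suml /=.
  apply: eq_bigr => l _; rewrite -scalerAr -scalerAl !linearZ /= -scalerAr -scalerAl.
  have skl := spin_vec2 (dotr_delta R k) (dotr_delta R l); have sra := spin_rev sa.
  by rewrite (pr_plusM (spinM sa skl) sra) (pr_plusM sa skl) pr_plus_rev.
have pr_even : clparity false (pr_plus (bivector (sdform d))).
  rewrite !raddf_sum; elim/big_ind: _ => [|x y|k _].
  - by move=> S _; rewrite ffunE.
  - exact: clparityD.
  rewrite !raddf_sum; elim/big_ind: _ => [|x y|l _].
  - by move=> S _; rewrite ffunE.
  - exact: clparityD.
  rewrite /= linearZ /=; apply/clparityZ/spin_parity/spin_pr_plus.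
  by apply: spin_vec2; exact: dotr_delta.
rewrite conj_pr; have [s ->] := even_clifford3 pr_even.
have -> : \sum_e dual_coef e (pr_plus (bivector (sdform d))) *:
    (omega * clvec (delta_mx 0 e)) = 4 *: (omega * clvec (delta_mx 0 d)).
  rewrite (bigD1 d) //= dual_coef_bivector sdform_dot eqxx mulr1 big1 ?addr0 //.
  move=> e /negPf ed; rewrite dual_coef_bivector sdform_dot eq_sym ed mulr0.
  by rewrite scale0r.
rewrite mulrBr mulrBl -!scalerAr -!scalerAl mulr1 spin_revr //.
rewrite linearB !linearZ /= dual_coef1 /GRing.scale /= mulr0 add0r.
rewrite /dual_coef opprK !mulrA (omega_central p) -(mulrA p) omega_sqr mulr1.
by rewrite (acts_cover _ _ (spin_acts sp)).
Qed.

End SelfDualRotation.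

(** * Smooth functions on open sets *)

Section NearDifferentiable.
Variables (R : realType) (V W : normedModType R).
Local Open Scope classical_set_scope.

(** A function vanishing near x has differential zero there. With
    [near_eq_differentiable], differentiability is a local property. *)
Lemma near0_differentiable (f : V -> W) x :
  (\near x, f x = 0) -> differentiable f x.
Proof.
move=> f0; have fx0 : f x = 0 := nbhs_singleton f0.
have nf : \forall h \near (0 : V), f (h + x) = 0.
  by have := f0; rewrite (near_shift 0 x) /= subr0.
have cont0 : continuous (\0 : {linear V -> W}) by exact: cst_continuous.
have df : f \o shift x = cst (f x) + (\0 : {linear V -> W}) +o_ 0 id.
  apply/eqaddoP => e e0; near=> h.
  rewrite /= !fctE /= fx0 addr0 subr0.
  have -> : f (h + x) = 0 by near: h.
  by rewrite normr0 mulr_ge0 // ltW.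
apply/diff_locallyP; rewrite (diff_unique cont0 df); split=> //.
Unshelve. all: by end_near. Qed.

Lemma near_eq_differentiable (f g : V -> W) x :
  (\near x, f x = g x) -> differentiable f x -> differentiable g x.
Proof.
move=> fg df; have -> : g = f + (g - f) by rewrite addrC subrK.
apply: differentiableD => //; apply: near0_differentiable.
by near=> y; rewrite !fctE (near fg y) // subrr.
Unshelve. all: by end_near. Qed.

End NearDifferentiable.

Section SmoothFunctions.
Variables (R : realType) (n : nat).
Local Notation V := 'rV[R]_n.+1.
Implicit Types (U W : set V) (f g : V -> R) (k : nat) (x : V).
Local Open Scope classical_set_scope.

Lemma near_open U x (P : V -> Prop) :
  open U -> U x -> (forall y, U y -> P y) -> \forall y \near x, P y.
Proof. by move=> oU Ux UP; apply: filterS UP _; exact: open_nbhs_nbhs. Qed.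

(** Continuity and derivatives at the points of an open set depend only on
    the values there. *)
Lemma eq_Cdiff k U f g : open U -> (forall x, U x -> f x = g x) ->
  Cdiff k U f -> Cdiff k U g.
Proof.
move=> oU; elim: k f g => [|k IH] f g fg /= fk.
  move=> x Ux; have nfg := near_open oU Ux fg.
  move=> P; rewrite -(fg x Ux) => /(fk x Ux) fP; apply: filterS2 nfg fP.
  by move=> y /= ->.
have [df Dfk] := fk; split=> [x Ux|i].
  by apply: near_eq_differentiable (df x Ux); exact: near_open fg.
apply: IH (Dfk i) => x Ux; apply: near_eq_derive; exact: near_open fg.
Qed.

Lemma sub_Cdiff k U W f : W `<=` U -> Cdiff k U f -> Cdiff k W f.
Proof.
move=> WU; elim: k f => [|k IH] f /=; first by move=> fc x /WU/fc.
by move=> [df Df]; split=> [x /WU/df|i] //; exact: IH.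
Qed.

Lemma CdiffW k U f : Cdiff k.+1 U f -> Cdiff k U f.
Proof.
elim: k f => [|k IH] f [df Df] /=.
  by move=> x /df; exact: differentiable_continuous.
by split=> // i; exact: IH.
Qed.

Lemma Cdiff_cst k U (r : R) : Cdiff k U (cst r).
Proof.
elim: k r => [|k IH] r /=; first by move=> x _; exact: cst_continuous.
split=> [x _|i]; first exact: differentiable_cst.
have -> : (fun x : V => 'D_(delta_mx 0 i) (cst r : V -> R) x) = cst 0.
  by apply/funext => x; rewrite derive_cst.
exact: IH.
Qed.

Lemma CdiffD k U f g : open U -> Cdiff k U f -> Cdiff k U g -> Cdiff k U (f \+ g).
Proof.
move=> oU; elim: k f g => [|k IH] f g /=.
  by move=> fc gc x Ux; apply: continuousD; [exact: fc|exact: gc].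
move=> [df Df] [dg Dg]; split=> [x Ux|i].
  by apply: differentiableD; [exact: df|exact: dg].
apply: eq_Cdiff (IH _ _ (Df i) (Dg i)) => // x Ux.
by rewrite /= deriveD //; apply: diff_derivable; [exact: df|exact: dg].
Qed.

Lemma CdiffM k U f g : open U -> Cdiff k U f -> Cdiff k U g -> Cdiff k U (f \* g).
Proof.
move=> oU; elim: k f g => [|k IH] f g.
  by move=> fc gc x Ux; apply: continuousM; [exact: fc|exact: gc].
move=> fk gk; have [df Df] := fk; have [dg Dg] := gk; split=> [x Ux|i].
  by apply: differentiableM; [exact: df|exact: dg].
apply: eq_Cdiff (CdiffD oU (IH _ _ (CdiffW fk) (Dg i)) (IH _ _ (CdiffW gk) (Df i))).
  exact: oU.
move=> x Ux; rewrite /= deriveM //; apply: diff_derivable; [exact: df|exact: dg].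
Qed.

Lemma CinftyP U f : Cinfty U f <->
  (forall x, U x -> differentiable f x) /\
  forall i, Cinfty U (fun x => 'D_(delta_mx 0 i) f x).
Proof.
split=> [fk|[df Df] [|k]].
- by split=> [x Ux|i k]; [exact: (fk 1%N).1|exact: (fk k.+1).2].
- by move=> x /df; exact: differentiable_continuous.
- by split=> // i; exact: Df.
Qed.

(** The derivative - f' / f^2 involves 1/f with one order of
    differentiability less, which makes the induction on k work; the same
    device serves for the square root. *)
Lemma Cdiff_inv k U f : open U -> (forall x, U x -> f x != 0) ->
  Cdiff k U f -> Cdiff k U (fun x => (f x)^-1).
Proof.
move=> oU f0; elim: k => [|k IH] fk.
  by move=> x Ux; apply: continuousV; [exact: f0|exact: fk].
have [df Df] := fk; have IHk := IH (CdiffW fk).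
have dfV x : U x -> differentiable (fun x => (f x)^-1) x.
  by move=> Ux; apply: differentiableV; [exact: df|exact: f0].
split=> // i.
apply: eq_Cdiff (CdiffM oU (Cdiff_cst k U (-1))
  (CdiffM oU (Df i) (CdiffM oU IHk IHk))); first exact: oU.
move=> x Ux; rewrite [RHS]deriveE; last exact: dfV.
rewrite diffV; [|exact: df|exact: f0].
rewrite /= deriveE; last exact: df.
by rewrite /GRing.scale /= -expr2 exprVn; ring.
Qed.

Lemma differentiable_sqrt (y : R) : 0 < y -> differentiable (@Num.sqrt R) y.
Proof. by move=> y0; apply/derivable1_diffP; case: (is_derive1_sqrt y0). Qed.

Lemma diff_sqrt (y h : R) : 0 < y ->
  'd (@Num.sqrt R) y h = h * (2 * Num.sqrt y)^-1.
Proof.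
move=> y0; have [dy dE] := is_derive1_sqrt y0.
by rewrite (deriv1E dy) derive1E dE.
Qed.

Lemma Cdiff_sqrt k U f : open U -> (forall x, U x -> 0 < f x) ->
  Cdiff k U f -> Cdiff k U (fun x => Num.sqrt (f x)).
Proof.
move=> oU f0; elim: k => [|k IH] fk.
  move=> x Ux; apply: (@continuous_comp _ _ _ f (@Num.sqrt R)); first exact: fk.
  exact: sqrt_continuous.
have [df Df] := fk; have IHk := IH (CdiffW fk).
have dfV x : U x -> differentiable (fun x => Num.sqrt (f x)) x.
  move=> Ux; apply: (differentiable_comp (df x Ux)).
  by apply: differentiable_sqrt; exact: f0.
split=> // i.
have nz x : U x -> 2 * Num.sqrt (f x) != 0.
  by move=> Ux; rewrite mulf_neq0 ?pnatr_eq0 // gt_eqF // sqrtr_gt0 f0.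
have V := Cdiff_inv oU nz (CdiffM oU (Cdiff_cst k U 2) IHk).
apply: eq_Cdiff (CdiffM oU (Df i) V) => // x Ux.
rewrite [RHS]deriveE; last exact: dfV.
have -> := diff_comp (df x Ux) (differentiable_sqrt (f0 x Ux)).
rewrite /= diff_sqrt; last exact: f0.
by rewrite deriveE //; exact: df.
Qed.

End SmoothFunctions.

Section Composition.
Variables (R : realType) (m n : nat).
Local Notation V := 'rV[R]_m.+1.
Local Notation W := 'rV[R]_n.+1.
Variables (U : set V) (g : V -> W).
Local Open Scope classical_set_scope.

Lemma differentiable_row x : (forall a, differentiable (fun x => g x 0 a) x) ->
  differentiable g x.
Proof.
move=> dg.
have -> : g = \sum_(a < n.+1) (fun x => g x 0 a *: (delta_mx 0 a : W)).
  apply/funext => y; rewrite {1}(row_sum_delta (g y)).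
  by elim/big_rec2: _ => // a u v _ ->.
by apply: differentiable_sum => a; exact: differentiableZl.
Qed.

Lemma derive_comp_row (f : W -> R) x (v : V) :
  (forall a, differentiable (fun x => g x 0 a) x) -> differentiable f (g x) ->
  'D_v (f \o g) x =
  \sum_a 'D_v (fun x => g x 0 a) x * 'D_(delta_mx 0 a) f (g x).
Proof.
move=> dga df; have dg := differentiable_row dga.
rewrite deriveE; last exact: differentiable_comp.
rewrite diff_comp //= -(deriveE _ dg) derive_mx; last exact: diff_derivable.
rewrite [X in 'd _ _ X]row_sum_delta linear_sum; apply: eq_bigr => a _ /=.
by rewrite linearZ /= mxE -deriveE.
Qed.

(** By induction on the order, for all f at once: by the chain rule the
    derivatives of f o g are sums of products of derivatives of g and of f'
    o g. *)
Lemma Cinfty_comp (U' : set W) (f : W -> R) :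
  open U -> (forall x, U x -> U' (g x)) ->
  (forall a, Cinfty U (fun x => g x 0 a)) -> Cinfty U' f -> Cinfty U (f \o g).
Proof.
move=> oU gU gk fk k; elim: k f fk => [|k IH] f /CinftyP[df Df].
  move=> x Ux; apply: differentiable_continuous; apply: differentiable_comp.
    by apply: differentiable_row => a; apply: (gk a 1%N).1.
  exact/df/gU.
have dg x : U x -> forall a, differentiable (fun x => g x 0 a) x.
  by move=> Ux a; apply: (gk a 1%N).1.
split=> [x Ux|i].
  by apply: differentiable_comp; [exact/differentiable_row/dg|exact/df/gU].
have sumC (s : seq 'I_n.+1) : Cdiff k U (fun x =>
    \sum_(a <- s) 'D_(delta_mx 0 i) (fun x => g x 0 a) x * 'D_(delta_mx 0 a) f (g x)).
  elim: s => [|a s IHs].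
    apply: eq_Cdiff (Cdiff_cst k U 0) => // x _; by rewrite big_nil.
  apply: eq_Cdiff (CdiffD oU (CdiffM oU ((gk a k.+1).2 i) (IH _ (Df a))) IHs).
    exact: oU.
  by move=> x _; rewrite big_cons.
apply: eq_Cdiff (sumC _) => // x Ux.
by rewrite derive_comp_row //; [exact: dg|exact/df/gU].
Qed.

End Composition.

(** * Smooth functions and Jacobians on manifolds *)

Section SmoothOnManifold.
Variables (R : realType) (M : oriented_manifold4 R).
Implicit Types (A B : set M) (f g : M -> R) (i j k : chart M) (p : M).
Local Open Scope classical_set_scope.

Lemma chart_open A i : open A -> open (coord i @` (A `&` cdom i)).
Proof.
move=> oA; have oO := @image_open _ M i.
have pc : {in coord i @` cdom i, continuous (param i)}.
  by rewrite -continuous_open_subspace //; exact: param_continuous.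
rewrite openE => _ [p [Ap ip] <-]; rewrite /interior.
have Oy : (coord i @` cdom i) (coord i p) by exists p.
have nA : nbhs (coord i p) (param i @^-1` A).
  apply: (pc (coord i p)); first exact: mem_set.
  by rewrite coordK //; exact: open_nbhs_nbhs.
have nO : nbhs (coord i p) (coord i @` cdom i) by exact: open_nbhs_nbhs.
apply: filterS2 nA nO => y /= Ay [q iq qy]; exists q => //; split=> //.
by rewrite -(coordK iq) qy.
Qed.

Lemma smooth_sub A B f : B `<=` A -> smooth A f -> smooth B f.
Proof.
move=> BA sf i k; apply: sub_Cdiff (sf i k).
by move=> _ [p [Bp ip] <-]; exists p => //; split=> //; exact: BA.
Qed.

Lemma eq_smooth A f g : open A -> (forall p, A p -> f p = g p) ->
  smooth A f -> smooth A g.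
Proof.
move=> oA fg sf i k; apply: eq_Cdiff (sf i k); first exact: chart_open.
by move=> _ [p [Ap ip] <-]; rewrite /= coordK // fg.
Qed.

Lemma smooth_cst A (r : R) : smooth A (fun=> r).
Proof. by move=> i k; exact: Cdiff_cst. Qed.

Lemma smoothD A f g : open A -> smooth A f -> smooth A g ->
  smooth A (fun p => f p + g p).
Proof.
move=> oA sf sg i k.
exact: (CdiffD (@chart_open A i oA) (sf i k) (sg i k)).
Qed.

Lemma smoothM A f g : open A -> smooth A f -> smooth A g ->
  smooth A (fun p => f p * g p).
Proof.
move=> oA sf sg i k.
exact: (CdiffM (@chart_open A i oA) (sf i k) (sg i k)).
Qed.

Lemma smoothN A f : open A -> smooth A f -> smooth A (fun p => - f p).
Proof.
move=> oA sf; apply: (@eq_smooth _ (fun p => -1 * f p)) => //.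
  by move=> p _; rewrite mulN1r.
by apply: smoothM => //; exact: smooth_cst.
Qed.

Lemma smoothV A f : open A -> (forall p, A p -> f p != 0) ->
  smooth A f -> smooth A (fun p => (f p)^-1).
Proof.
move=> oA f0 sf i k; apply: (Cdiff_inv (@chart_open A i oA) _ (sf i k)).
by move=> _ [p [Ap ip] <-]; rewrite /= coordK // f0.
Qed.

Lemma smooth_sqrt A f : open A -> (forall p, A p -> 0 < f p) ->
  smooth A f -> smooth A (fun p => Num.sqrt (f p)).
Proof.
move=> oA f0 sf i k; apply: (Cdiff_sqrt (@chart_open A i oA) _ (sf i k)).
by move=> _ [p [Ap ip] <-]; rewrite /= coordK // f0.
Qed.

Lemma smooth_sum A (I : Type) (r : seq I) (h : I -> M -> R) : open A ->
  (forall a, smooth A (h a)) -> smooth A (fun p => \sum_(a <- r) h a p).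
Proof.
move=> oA sh; elim: r => [|a r IH].
  apply: (eq_smooth oA _ (@smooth_cst A 0)) => p _; by rewrite big_nil.
apply: (eq_smooth oA _ (smoothD oA (sh a) IH)) => p _; by rewrite big_cons.
Qed.

Lemma smooth_mul_mx A (m n q : nat) (F : M -> 'M[R]_(m, n)) (G : M -> 'M[R]_(n, q)) :
  open A -> smooth_mx A F -> smooth_mx A G -> smooth_mx A (fun p => F p *m G p).
Proof.
move=> oA sF sG r c.
apply: (@eq_smooth _ (fun p => \sum_s F p r s * G p s c)) => //.
  by move=> p _; rewrite mxE.
by apply: smooth_sum => // s; apply: smoothM.
Qed.

Lemma smooth_tr_mx A (m n : nat) (F : M -> 'M[R]_(m, n)) :
  open A -> smooth_mx A F -> smooth_mx A (fun p => (F p)^T).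
Proof.
by move=> oA sF r c; apply: (eq_smooth oA _ (sF c r)) => p _; rewrite mxE.
Qed.

Lemma smooth_cst_mx A (m n : nat) (F : 'M[R]_(m, n)) : smooth_mx A (fun=> F).
Proof. by move=> r c; exact: smooth_cst. Qed.

Lemma smooth_sub_mx A B (m n : nat) (F : M -> 'M[R]_(m, n)) :
  B `<=` A -> smooth_mx A F -> smooth_mx B F.
Proof. by move=> BA sF r c; exact: smooth_sub (sF r c). Qed.

Lemma transition_sub k i j : coord k @` ((cdom i `&` cdom j) `&` cdom k) `<=`
  coord k @` (cdom j `&` cdom k).
Proof. by move=> _ [p [[ip jp] kp] <-]; exists p. Qed.

(** Seen in a third chart k, the Jacobian is a derivative of a transition
    function composed with the transition function from k to j. *)
Lemma smooth_jac i j : smooth_mx (cdom i `&` cdom j) (jac i j).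
Proof.
move=> a b k; rewrite /comp /jac.
pose h y := coord i (param j y) 0 a.
pose g y := coord j (param k y).
have oIJ : open (cdom i `&` cdom j) by apply: openI; exact: cdom_open.
have -> : (fun y => jac i j (param k y) a b) =
    (fun z => 'D_(delta_mx 0 b) h z) \o g.
  by apply/funext => y; rewrite /jac mxE.
apply: (@Cinfty_comp _ _ _ _ g (coord j @` (cdom i `&` cdom j))).
- exact: chart_open.
- move=> _ [p [[ip jp] kp] <-]; exists p => //.
  by rewrite /g coordK.
- move=> c l; apply: sub_Cdiff (@transition_smooth _ M j k c l).
  exact: transition_sub.
- by have /CinftyP[_] := @transition_smooth _ M i j a; exact.
Qed.

Lemma jac_comp i j k p : cdom i p -> cdom j p -> cdom k p ->
  jac i k p = jac i j p *m jac j k p.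
Proof.
move=> ip jp kp; apply/matrixP => a b; rewrite !mxE.
pose h y := coord i (param j y) 0 a.
pose g y := coord j (param k y).
pose U := coord k @` ((cdom j `&` cdom k)).
have oU : open U by apply: chart_open; exact: cdom_open.
have Up : U (coord k p) by exists p.
have -> : 'D_(delta_mx 0 b) (fun y => coord i (param k y) 0 a) (coord k p) =
    'D_(delta_mx 0 b) (h \o g) (coord k p).
  apply: near_eq_derive; apply: (near_open oU Up) => _ [q [jq kq] <-].
  by rewrite /= /h /g !coordK.
rewrite derive_comp_row.
- by apply: eq_bigr => c _; rewrite !mxE /g coordK // mulrC.
- move=> c; have /CinftyP[d _] := @transition_smooth _ M j k c.
  exact: d.
- have /CinftyP[d _] := @transition_smooth _ M i j a.
  by apply: d; exists p => //; rewrite /g coordK.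
Qed.

Lemma jac_unit i j p : cdom i p -> cdom j p -> jac i j p \in unitmx.
Proof.
by move=> ip jp; rewrite unitmxE unitfE gt_eqF // transition_oriented.
Qed.

(** The chain rule gives J = J * J for J the Jacobian of the chart i with
    respect to itself, and J is invertible. *)
Lemma jac_id i p : cdom i p -> jac i i p = 1%:M.
Proof.
move=> ip; have u := jac_unit ip ip.
by rewrite -[LHS](mulKmx u) -jac_comp // mulVmx.
Qed.

End SmoothOnManifold.

(** * Smooth orthonormalisation *)

Section Cholesky.
Variable R : realType.

Definition positive_definite (n : nat) (G : 'M[R]_n) :=
  G^T = G /\ forall v : 'cV[R]_n, v != 0 -> 0 < (v^T *m G *m v) 0 0.

(** The form induced by G on the orthogonal complement of the first basis
    vector. *)
Definition schur (n : nat) (G : 'M[R]_(1 + n)) : 'M[R]_n :=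
  drsubmx G - (G 0 0)^-1 *: ((ursubmx G)^T *m ursubmx G).

(** The triangular matrix whose columns are obtained from the standard basis
    by orthonormalisation for G. The recursion orthonormalises the
    complement of the first vector; its formulas use only the field
    operations and square roots of positive numbers, and are therefore
    smooth in G. *)
Fixpoint cholesky (n : nat) : 'M[R]_n -> 'M[R]_n :=
  match n with
  | 0 => fun=> 0
  | n'.+1 => fun G : 'M[R]_(1 + n') =>
      block_mx (Num.sqrt (G 0 0))^-1%:M
        (- (G 0 0)^-1 *: (ursubmx G *m cholesky (schur G)))
        0 (cholesky (schur G))
  end.

Section Step.
Variables (n : nat) (G : 'M[R]_(1 + n)).
Hypothesis Gpos : positive_definite G.
Let a := G 0 0.
Let b : 'rV[R]_n := ursubmx G.

Lemma positive_definite_diag : 0 < G 0 0.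
Proof.
have := Gpos.2 (delta_mx 0 0); rewrite trmx_delta -mulmxA -colE -rowE !mxE.
apply; apply/eqP => /matrixP/(_ 0 0)/eqP; rewrite !mxE !eqxx.
by rewrite oner_eq0.
Qed.

Lemma symmetric_blocks : G = block_mx a%:M b b^T (drsubmx G).
Proof.
rewrite -[LHS]submxK /b trmx_ursub Gpos.1; congr block_mx.
by rewrite [LHS]mx11_scalar !mxE; congr (G _ _)%:M; apply: val_inj.
Qed.

(** The Schur complement is P^T G P, where the columns of P are the
    orthogonal projections of the remaining basis vectors. *)
Lemma schur_positive : positive_definite (schur G).
Proof.
have a0 : a != 0 by rewrite gt_eqF // positive_definite_diag.
pose P : 'M[R]_(1 + n, n) := col_mx (- a^-1 *: b) 1%:M.
have GP : G *m P = col_mx 0 (schur G).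
  rewrite {1}symmetric_blocks mul_block_col mul_scalar_mx scalerA mulmx1.
  rewrite mulrN mulfV // scaleN1r addNr mulmx1 -scalemxAr scaleNr addrC.
  by [].
have PGP : P^T *m G *m P = schur G.
  rewrite -mulmxA GP tr_col_mx mul_row_col mulmx0 add0r trmx1 mul1mx.
  by [].
split=> [|w w0].
  by rewrite -PGP trmx_mul trmx_mul trmxK Gpos.1 mulmxA.
have := Gpos.2 (P *m w).
have -> : (P *m w)^T *m G *m (P *m w) = w^T *m schur G *m w.
  by rewrite trmx_mul -PGP !mulmxA.
apply; apply: contra w0 => /eqP.
rewrite mul_col_mx mul1mx => /(congr1 dsubmx); rewrite col_mxKd => ->.
by rewrite raddf0.
Qed.

End Step.

Lemma cholesky_block (n : nat) (a : R) (b : 'rV[R]_n) (D E : 'M[R]_n) : 0 < a ->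
  E^T *m (D - a^-1 *: (b^T *m b)) *m E = 1%:M ->
  forall F : 'M[R]_(1 + n),
  F = block_mx (Num.sqrt a)^-1%:M (- a^-1 *: (b *m E)) 0 E ->
  F^T *m block_mx a%:M b b^T D *m F = 1%:M.
Proof.
move=> a0 EE F ->; have an0 : a != 0 by rewrite gt_eqF.
have sn0 : Num.sqrt a != 0 by rewrite gt_eqF // sqrtr_gt0.
have saE : a = Num.sqrt a ^+ 2 by rewrite sqr_sqrtr // ltW.
rewrite -mulmxA mulmx_block tr_block_mx mulmx_block.
rewrite !mulmx0 !addr0 !trmx0 !mul0mx !addr0 tr_scalar_mx.
have -> : a%:M *m (- a^-1 *: (b *m E)) + b *m E = 0.
  by rewrite mul_scalar_mx scalerA mulrN mulfV // scaleN1r addNr.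
have DE : b^T *m (- a^-1 *: (b *m E)) + D *m E = (D - a^-1 *: (b^T *m b)) *m E.
  by rewrite mulmxBl -scalemxAr -scalemxAl mulmxA scaleNr addrC.
rewrite DE !mulmx0 add0r (mulmxA E^T _ E) EE.
have -> : (Num.sqrt a)^-1%:M *m (a%:M *m (Num.sqrt a)^-1%:M) = 1%:M :> 'M[R]_1.
  by rewrite -!scalar_mxM {2}saE; congr (_%:M); field.
suff -> : (- a^-1 *: (b *m E))^T *m (a%:M *m (Num.sqrt a)^-1%:M) +
    E^T *m (b^T *m (Num.sqrt a)^-1%:M) = 0 by rewrite -scalar_mx_block.
rewrite linearZ /= trmx_mul -scalar_mxM !mul_mx_scalar -scalemxAr scalerA.
by rewrite -scalerDl [X in X *: _](_ : _ = 0) ?scale0r //; field; rewrite an0 sn0.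
Qed.

Lemma cholesky_orthonormal (n : nat) (G : 'M[R]_n) : positive_definite G ->
  (cholesky G)^T *m G *m cholesky G = 1%:M /\ 0 < \det (cholesky G).
Proof.
elim: n G => [|n IH] G Gpos.
  by rewrite det_mx00; split=> //; apply/matrixP => -[].
have a0 := positive_definite_diag Gpos; have [EE dE] := IH _ (schur_positive Gpos).
split; last first.
  have -> : \det (cholesky G) = \det ((Num.sqrt (G 0 0))^-1%:M : 'M[R]_1) *
      \det (cholesky (schur (G : 'M[R]_(1 + n)))) by exact: (@det_ublock R 1 n).
  by rewrite det_scalar1 mulr_gt0 // invr_gt0 sqrtr_gt0.
have := cholesky_block a0 EE (erefl _).
by rewrite -(symmetric_blocks Gpos).
Qed.

End Cholesky.

Section SmoothCholesky.
Variables (R : realType) (M : oriented_manifold4 R) (A : set M).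
Hypothesis oA : open A.
Local Open Scope classical_set_scope.

Lemma smooth_cholesky (n : nat) (G : M -> 'M[R]_n) :
  (forall p, A p -> positive_definite (G p)) ->
  smooth_mx A G -> smooth_mx A (fun p => cholesky (G p)).
Proof.
elim: n G => [|n IH] G Gpos sG; first by move=> [].
pose H p : 'M[R]_(1 + n) := G p.
have sb : smooth_mx A (fun p => ursubmx (H p)).
  by move=> r c; apply: (eq_smooth oA _ (sG _ _)) => p _; rewrite !mxE.
have sD : smooth_mx A (fun p => drsubmx (H p)).
  by move=> r c; apply: (eq_smooth oA _ (sG _ _)) => p _; rewrite !mxE.
have pos p : A p -> 0 < G p 0 0 by move=> /Gpos; exact: positive_definite_diag.
have sV : smooth A (fun p => (G p 0 0)^-1).
  by apply: smoothV => // p /pos; rewrite lt_def => /andP[].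
have sE : smooth_mx A (fun p => cholesky (schur (H p))).
  apply: IH => [p Ap|]; first exact/schur_positive/Gpos.
  move=> r c; apply: (@eq_smooth _ _ _ (fun p => drsubmx (H p) r c +
    - ((G p 0 0)^-1 * ((ursubmx (H p))^T *m ursubmx (H p)) r c))) => //.
    by move=> p _; rewrite /schur !mxE.
  apply: smoothD => //; apply: smoothN => //; apply: smoothM => //.
  by apply: smooth_mul_mx => //; exact: smooth_tr_mx.
have sS : smooth A (fun p => (Num.sqrt (G p 0 0))^-1).
  apply: smoothV => //; last exact: smooth_sqrt.
  by move=> p Ap; rewrite gt_eqF // sqrtr_gt0 pos.
have blk p (r c : 'I_(1 + n)) : cholesky (G p) r c = (block_mx (Num.sqrt (G p 0 0))^-1%:M
    (- (G p 0 0)^-1 *: (ursubmx (H p) *m cholesky (schur (H p))))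
    0 (cholesky (schur (H p))) : 'M[R]_(1 + n)) r c by [].
move=> r c; case: (split_ordP (r : 'I_(1 + n))) => r' ->;
  case: (split_ordP (c : 'I_(1 + n))) => c' ->.
- apply: (eq_smooth oA _ sS) => p _.
  by rewrite blk block_mxEul !ord1 mxE mulr1n.
- apply: (@eq_smooth _ _ _ (fun p => - (G p 0 0)^-1 *
    (ursubmx (H p) *m cholesky (schur (H p))) r' c')) => //.
    by move=> p _; rewrite blk block_mxEur [RHS]mxE.
  apply: smoothM => //; first exact: smoothN.
  exact: smooth_mul_mx.
- apply: (eq_smooth oA _ (@smooth_cst _ _ A 0)) => p _.
  by rewrite blk block_mxEdl mxE.
- apply: (eq_smooth oA _ (sE r' c')) => p _.
  by rewrite blk block_mxEdr.
Qed.

End SmoothCholesky.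

(** * Orthonormal frames and associated bundles *)

Section FrameBundle.
Variables (R : realType) (M : oriented_riemannian4 R).
Implicit Types (e : frame M) (p : M) (i : chart M).
Local Open Scope classical_set_scope.

Lemma orthonormal_unit i p (E : 'M[R]_4) :
  oriented_orthonormal i p E -> E \in unitmx.
Proof. by move=> [_ d]; rewrite unitmxE unitfE gt_eqF. Qed.

(** The inverse of an orthonormal frame is a polynomial in the frame and the
    metric. *)
Lemma orthonormal_inv i p (E : 'M[R]_4) :
  oriented_orthonormal i p E -> E^T *m metric i p = invmx E.
Proof.
move=> oE; have u := orthonormal_unit oE.
by rewrite -[LHS](mulmxK u) oE.1 mul1mx.
Qed.

Lemma fr_unit e p : fr_dom e p -> fr_mx e p \in unitmx.
Proof. by move=> /fr_on/orthonormal_unit. Qed.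

Lemma fr_transE e e' p : fr_dom e p ->
  fr_trans e e' p =
  invmx (fr_mx e p) *m (jac (fr_chart e) (fr_chart e') p *m fr_mx e' p).
Proof. by move=> /fr_on/orthonormal_inv <-. Qed.

Lemma fr_trans_id e p : fr_dom e p -> fr_trans e e p = 1%:M.
Proof.
move=> ep; rewrite fr_transE // jac_id ?mul1mx ?mulVmx ?fr_unit //.
exact: fr_sub.
Qed.

Lemma fr_trans_comp e e' e'' p : fr_dom e p -> fr_dom e' p -> fr_dom e'' p ->
  fr_trans e e' p *m fr_trans e' e'' p = fr_trans e e'' p.
Proof.
move=> ep ep' ep''; rewrite !fr_transE // -!mulmxA mulKVmx ?fr_unit //.
by rewrite (jac_comp (fr_sub ep) (fr_sub ep') (fr_sub ep'')) !mulmxA.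
Qed.

Lemma orthogonal_SO (T : 'M[R]_4) : T^T *m T = 1%:M -> 0 < \det T -> SO T.
Proof.
move=> TT dT; split=> //.
have dT2 : \det T ^+ 2 = 1 by rewrite expr2 -{1}det_tr -det_mulmx TT det1.
by apply/eqP; rewrite -(@pexpr_eq1 _ _ 2) ?dT2 // ltW.
Qed.

Lemma fr_trans_SO e e' p : fr_dom e p -> fr_dom e' p -> SO (fr_trans e e' p).
Proof.
move=> ep ep'; have [d d'] := (fr_sub ep, fr_sub ep').
have [_ dE] := fr_on ep; have [on2 dE'] := fr_on ep'.
have orth : (fr_trans e e' p)^T *m fr_trans e e' p = 1%:M.
  rewrite [X in _ *m X](fr_transE e' ep) /fr_trans !trmx_mul trmxK.
  rewrite metric_sym // -!mulmxA mulKVmx ?fr_unit // -on2 (metric_change d d').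
  by rewrite !mulmxA.
apply: orthogonal_SO => //.
rewrite fr_transE // !det_mulmx det_inv !mulr_gt0 ?invr_gt0 //.
exact: transition_oriented.
Qed.

Lemma open_fr_domI e e' : open (fr_dom e `&` fr_dom e').
Proof. by apply: openI; exact: fr_open. Qed.

Lemma smooth_fr_trans e e' :
  smooth_mx (fr_dom e `&` fr_dom e') (fr_trans e e').
Proof.
have oD := open_fr_domI e e'.
have s1 : smooth_mx (fr_dom e `&` fr_dom e') (fr_mx e).
  by apply: smooth_sub_mx (@fr_smooth _ _ e) => p [].
have s2 : smooth_mx (fr_dom e `&` fr_dom e') (fr_mx e').
  by apply: smooth_sub_mx (@fr_smooth _ _ e') => p [].
have sg : smooth_mx (fr_dom e `&` fr_dom e') (metric (fr_chart e)).
  by apply: smooth_sub_mx (@metric_smooth _ M (fr_chart e)) => p [/fr_sub].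
have sj : smooth_mx (fr_dom e `&` fr_dom e') (jac (fr_chart e) (fr_chart e')).
  by apply: smooth_sub_mx (@smooth_jac _ M _ _) => p [/fr_sub d /fr_sub d'].
apply: smooth_mul_mx => //; last exact: smooth_mul_mx.
by apply: smooth_mul_mx => //; exact: smooth_tr_mx.
Qed.

Lemma metric_positive i p : cdom i p -> positive_definite (metric i p).
Proof. by move=> ip; split; [exact: metric_sym|exact: metric_pos]. Qed.

(** Every chart domain carries an oriented orthonormal frame: the one that
    orthonormalises the coordinate fields. Triangularity with positive
    diagonal makes it oriented. *)
Definition cholesky_frame i : frame M.
Proof.
refine (@Frame R M i (cdom i) (fun p => cholesky (metric i p)) _ _ _ _).
- exact: cdom_open.
- by [].
- apply: smooth_cholesky; first exact: cdom_open.
    by move=> p; exact: metric_positive.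
  exact: metric_smooth.
- by move=> p ip; apply: cholesky_orthonormal; exact: metric_positive.
Defined.

Lemma fr_cover p : exists e : frame M, fr_dom e p.
Proof. by have [i ip] := @cdom_cover _ M p; exists (cholesky_frame i). Qed.

End FrameBundle.

Section SmoothLift.
Variables (R : realType) (M : oriented_manifold4 R) (A : set M).
Hypothesis oA : open A.
Local Open Scope classical_set_scope.

Definition smooth_clifford (n : nat) (x : M -> clifford R n) :=
  forall S, smooth A (fun p => x p S).

Lemma smooth_clmul (n : nat) (x y : M -> clifford R n) :
  smooth_clifford x -> smooth_clifford y -> smooth_clifford (fun p => x p * y p).
Proof.
move=> sx sy S; pose h T p := csign R T (symdiff T S) * (x p T * y p (symdiff T S)).
apply: (@eq_smooth _ _ _ (fun p => \sum_T h T p)) => //.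
  by move=> p _; rewrite clmulE.
apply: smooth_sum => // T; apply: smoothM => //; first exact: smooth_cst.
exact: smoothM.
Qed.

Lemma smooth_clvec (n : nat) (v : M -> 'rV[R]_n) :
  smooth_mx A v -> smooth_clifford (fun p => clvec (v p)).
Proof.
move=> sv S; apply: (@eq_smooth _ _ _ (fun p =>
    \sum_i v p 0 i * cle R [set i]%SET S)) => //.
  move=> p _; rewrite clvecE cl_sum_coef; apply: eq_bigr => i _.
  by rewrite clscaleE.
by apply: smooth_sum => // i; apply: smoothM => //; exact: smooth_cst.
Qed.

(** The construction of [cover_quad] from the rotation consists of products
    and sums in the Clifford algebra. *)
Lemma smooth_cover_quad (n : nat) (F : M -> 'M[R]_n) S T :
  smooth_mx A F -> smooth A (fun p => cover_quad (F p) S T).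
Proof.
move=> sF; rewrite /cover_quad; case: odd; first exact: smooth_cst.
apply: smoothM => //; first exact: smooth_cst.
suff : smooth_clifford (fun p => average (F p) (cle R S)) by [].
rewrite /average; elim: (enum _) => [|i r IH] /=.
  by move=> U; exact: smooth_cst.
move=> U; apply: (@eq_smooth _ _ _ (fun p =>
  foldr (average_step (F p)) (cle R S) r U + - (clvec (delta_mx 0 i *m (F p)^T) *
    foldr (average_step (F p)) (cle R S) r * clvec (delta_mx 0 i)) U)) => //.
  by move=> p _; rewrite /average_step clsubE.
apply: smoothD => //; apply: smoothN => //.
have sc (v : 'rV[R]_n) : smooth_clifford (fun=> clvec v).
  by move=> V; exact: smooth_cst.
apply: (smooth_clmul (smooth_clmul _ IH) (sc _)).
apply: smooth_clvec; apply: smooth_mul_mx => //; first exact: smooth_cst_mx.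
exact: smooth_tr_mx.
Qed.

(** The lifts are chosen pointwise and need not even be continuous in p; a
    quadratic function of them is a polynomial in F p. *)
Lemma smooth_quadratic_lift (f : clifford R 4 -> R) (F : M -> 'M[R]_4) :
  quadratic_on_spin f -> smooth_mx A F -> (forall p, A p -> SO (F p)) ->
  smooth A (fun p => f (spin_lift (F p))).
Proof.
move=> /quadratic_cover[c cE] sF soF.
apply: (@eq_smooth _ _ _ (fun p => \sum_S \sum_T c S T * cover_quad (F p) S T)) => //.
  by move=> p /soF/spin_liftP[sl lF]; rewrite (cE _ sl) lF.
apply: smooth_sum => // S; apply: smooth_sum => // T; apply: smoothM => //.
  exact: smooth_cst.
exact: smooth_cover_quad.
Qed.

End SmoothLift.

Section AssociatedBundles.
Variables (R : realType) (M : oriented_riemannian4 R).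
Local Notation C := R[i].
Implicit Types (e : frame M) (p : M).
Local Open Scope classical_set_scope.

Section OneRepresentation.
Variables (r c : nat) (rho : spin4_rep R r c).
Hypothesis rhoP : even_rep rho.

Lemma smooth_descended e e' (v : 'M[C]_(r, c)) :
  smooth_cmx (fr_dom e `&` fr_dom e')
    (fun p => descended rho (fr_trans e e' p) v).
Proof.
have oD := open_fr_domI e e'; have sT := @smooth_fr_trans _ M e e'.
have soT p : (fr_dom e `&` fr_dom e') p -> SO (fr_trans e e' p).
  by move=> [ep ep']; exact: fr_trans_SO.
split=> i j; have [qr qi] := even_rep_quadratic rhoP v i j.
  apply: (eq_smooth oD _ (smooth_quadratic_lift oD qr sT soT)) => p _.
  by rewrite mxE.
apply: (eq_smooth oD _ (smooth_quadratic_lift oD qi sT soT)) => p _.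
by rewrite mxE.
Qed.

(** The cocycle of orthonormal frames takes values in SO(4), where the
    descended representation is multiplicative and smooth. *)
Lemma Ass_vbundle : is_vbundle (Ass M (descended rho)).
Proof.
split=> /=.
- by move=> e; exact: fr_open.
- exact: fr_cover.
- by move=> e e' p _ _; exact: descended_linear.
- by move=> e p v ep; rewrite fr_trans_id // descended1.
split=> [e e' e'' p v ep ep' ep''|e e' v]; last exact: smooth_descended.
by rewrite -descendedM ?fr_trans_comp //; exact: fr_trans_SO.
Qed.

End OneRepresentation.

Lemma rep_iso_spin (r c r' c' : nat) (rho : spin4_rep R r c) (rho' : spin4_rep R r' c')
    (f : 'M[C]_(r, c) -> 'M[C]_(r', c')) :
  even_rep rho -> even_rep rho' -> linear f -> bijective f ->
  (forall a v, spin a -> f (rho a v) = rho' a (f v)) ->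
  rep_iso (descended rho) (descended rho') f.
Proof.
move=> rP rP' lf bf fE; split=> // A v /spin_cover_surj[a sa <-].
by rewrite !even_rep_descends // fE.
Qed.

(** The inverse in the frames e, e' is g applied after the descended
    representation of the inverse transition, g being the inverse of f. *)
Lemma induced_iso (r c r' c' : nat) (rho : spin4_rep R r c) (rho' : spin4_rep R r' c')
    (f : 'M[C]_(r, c) -> 'M[C]_(r', c')) :
  even_rep rho' -> rep_iso (descended rho) (descended rho') f ->
  @is_vbundle_iso R M (Ass M (descended rho)) (Ass M (descended rho'))
    (induced_map (descended rho') f).
Proof.
move=> rP' [lf [g fK gK] fE]; split=> /=.
- move=> e e' p _ _ k u v; rewrite /induced_map lf.
  exact: (descended_linear rP').
- move=> e e' p ep ep'; rewrite /induced_map.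
  exists (fun w => g (descended rho' (fr_trans e e' p) w)) => [v|w].
    rewrite -(descendedM rP') ?fr_trans_comp ?fr_trans_id ?(descended1 rP') //;
    exact: fr_trans_SO.
  rewrite gK -(descendedM rP') ?fr_trans_comp ?fr_trans_id ?(descended1 rP') //;
  exact: fr_trans_SO.
- move=> e e' v; rewrite setIC.
  exact: smooth_descended.
- move=> e e1 e' e1' p v ep ep1 ep' ep1'; rewrite /induced_map fE; last exact: fr_trans_SO.
  by rewrite -!(descendedM rP') ?fr_trans_comp //; exact: fr_trans_SO.
Qed.

Lemma Ass_isoI (r c r' c' : nat) (rho : spin4_rep R r c) (rho' : spin4_rep R r' c')
    (f : 'M[C]_(r, c) -> 'M[C]_(r', c')) :
  even_rep rho -> even_rep rho' -> linear f -> bijective f ->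
  (forall a v, spin a -> f (rho a v) = rho' a (f v)) ->
  Ass_iso M (descended rho) (descended rho').
Proof.
move=> rP rP' lf bf fE; have fi := rep_iso_spin rP rP' lf bf fE.
by exists f => //; exact: induced_iso.
Qed.

End AssociatedBundles.

(** * The tensor square and the identity section *)

Section TensorSquare.
Variable R : realType.
Local Notation C := R[i].

(** The identification of v (x) w with the matrix v w^T. *)
Definition tens_matrix (v : 'cV[C]_(2 * 2)) : 'M[C]_2 :=
  \matrix_(i, j) v (mxtens_index (i, j)) 0.

Lemma tens_matrixE (A B : 'M[C]_2) v :
  tens_matrix ((A *t B) *m v) = A *m tens_matrix v *m B^T.
Proof.
apply/matrixP => i j; rewrite !mxE.
rewrite (reindex (@mxtens_index 2 2)) /=; last first.
  by apply: onW_bij; exists (@mxtens_unindex 2 2);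
    [exact: mxtens_indexK|exact: mxtens_unindexK].
under [RHS]eq_bigr do rewrite mxE mulr_suml.
rewrite [RHS]exchange_big pair_big /=; apply: eq_bigr => -[k l] _.
by rewrite tensmxE !mxE /=; ring.
Qed.

(** The matrix J of the area form of C^2. *)
Definition symplectic : 'M[C]_2 :=
  \matrix_(i, j) (if (i < j)%N then 1 else if (j < i)%N then -1 else 0).

Lemma symplectic_sqr : symplectic *m symplectic = - 1%:M.
Proof.
apply/matrixP => i j; rewrite !mxE !big_ord_recl big_ord0 !mxE.
by case: i => [[|[|//]] ?]; case: j => [[|[|//]] ?] /=; ring.
Qed.

Lemma symplectic_det (A : 'M[C]_2) : A^T *m symplectic *m A = \det A *: symplectic.
Proof.
rewrite det_mx2; apply/matrixP => i j; rewrite !mxE !big_ord_recl !big_ord0 !mxE.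
rewrite !big_ord_recl !big_ord0 !mxE.
have -> : lift ord0 0 = 1 :> 'I_2 by exact: val_inj.
have I2 (k : 'I_2) : k = 0 \/ k = 1.
  by case: k => [[|[|//]] ?]; [left|right]; exact: val_inj.
by case: (I2 i) => ->; case: (I2 j) => -> /=; ring.
Qed.

(** The isomorphism of V (x) V with V (x) V^* = End V given by the area form
    on V = C^2. *)
Definition tens_end (v : 'cV[C]_(2 * 2)) : 'M[C]_2 := tens_matrix v *m symplectic.

Fact tens_end_linear : linear tens_end.
Proof.
move=> k u v; rewrite /tens_end scalemxAl -mulmxDl; congr (_ *m _).
by apply/matrixP => i j; rewrite !mxE.
Qed.

Lemma tens_end_bij : bijective tens_end.
Proof.
exists (fun T => \col_k (T *m - symplectic)
    (mxtens_unindex k).1 (mxtens_unindex k).2) => [v|T].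
  apply/colP => k; rewrite mxE /tens_end mulmxN -mulmxA symplectic_sqr.
  by rewrite mulmxN opprK mulmx1 mxE -surjective_pairing mxtens_unindexK.
rewrite /tens_end (_ : tens_matrix _ = T *m - symplectic); last first.
  by apply/matrixP => i j; rewrite [LHS]mxE mxE mxtens_indexK.
by rewrite mulmxN mulNmx -mulmxA symplectic_sqr mulmxN opprK mulmx1.
Qed.

(** If det A = 1 then A preserves the area form, that is A^T J = J A^-1, and
    A (v w^T) A^T J = A (v w^T J) A^-1. *)
Lemma tens_end_conj (A : 'M[C]_2) v : \det A = 1 ->
  tens_end ((A *t A) *m v) = A *m tens_end v *m invmx A.
Proof.
move=> dA; have uA : A \in unitmx by rewrite unitmxE dA unitr1.
rewrite /tens_end tens_matrixE -!mulmxA; congr (_ *m (_ *m _)).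
by rewrite -[LHS](mulmxK uA) symplectic_det dA scale1r.
Qed.

End TensorSquare.

Section Parallel.
Variables (R : realType) (M : oriented_riemannian4 R).
Local Notation C := R[i].
Local Open Scope classical_set_scope.
Local Notation D := (@Delta4_plus R).

Lemma end_rep_id (a : clifford R 4) : spin a -> End_SigmaPlus R a 1%:M = 1%:M.
Proof.
move=> sa; rewrite /End_SigmaPlus /end_rep mulmx1.
by have [u _] := spin_mx_inv (@Delta4_plus_spin_mx R) sa; rewrite mulmxV.
Qed.

Lemma descended_End_id (A : 'M[R]_4) : SO A ->
  descended (End_SigmaPlus R) A 1%:M = 1%:M.
Proof. by move=> /spin_liftP[sl _]; exact: end_rep_id. Qed.

Lemma Id_SigmaPlus_section :
  is_section (E := Ass M (descended (End_SigmaPlus R))) (Id_SigmaPlus (M := M)).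
Proof.
split=> [e|e e' p ep ep'] /=.
  split=> i j.
    exact: (@smooth_cst _ M (fr_dom e) (map_mx (@Re R) (1%:M : 'M[C]_2) i j)).
  exact: (@smooth_cst _ M (fr_dom e) (map_mx (@Im R) (1%:M : 'M[C]_2) i j)).
by rewrite /Id_SigmaPlus descended_End_id //; exact: fr_trans_SO.
Qed.

(** The identity is fixed by conjugation, so it is the constant matrix 1 in
    every frame and its partial derivatives vanish. For the same reason t
    |-> rho (A t) 1 is constant along any path A of rotations, so that d rho
    (X) 1 = 0 for X the connection form. *)
Lemma Id_SigmaPlus_parallel :
  parallel (descended (End_SigmaPlus R)) (Id_SigmaPlus (M := M)).
Proof.
move=> e m p ep; exists 0.
  move=> A soA _ _ k l; split.
    have -> : (fun t => Re (descended (End_SigmaPlus R) (A t) (Id_SigmaPlus e p) k l)) =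
        cst (Re ((1%:M : 'M[C]_2) k l)).
      by apply/funext => t; rewrite descended_End_id.
    by rewrite [X in is_derive _ _ _ (Re X)]mxE; exact: is_derive_cst.
  have -> : (fun t => Im (descended (End_SigmaPlus R) (A t) (Id_SigmaPlus e p) k l)) =
      cst (Im ((1%:M : 'M[C]_2) k l)).
    by apply/funext => t; rewrite descended_End_id.
  by rewrite [X in is_derive _ _ _ (Im X)]mxE; exact: is_derive_cst.
rewrite addr0; apply/matrixP => k l; rewrite [LHS]mxE [RHS]mxE /pd.
rewrite -[X in ('D_ _ X _ +i* _)%C]/(cst (Re ((1%:M : 'M[C]_2) k l))).
rewrite -[X in (_ +i* 'D_ _ X _)%C]/(cst (Im ((1%:M : 'M[C]_2) k l))).
by rewrite !derive_cst.
Qed.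

End Parallel.

(** * The Hodge star *)

Section Hodge.
Variable R : realType.
Local Notation eps := (@levi_civita_symbol R).

Definition set_row (n : nat) (A : 'M[R]_n) (r : 'I_n) (v : 'rV[R]_n) : 'M[R]_n :=
  \matrix_(a, b) if a == r then v 0 b else A a b.

(** Linearity of the determinant in one row. *)
Lemma det_set_row (n : nat) (A : 'M[R]_n) r :
  \det A = \sum_i A r i * \det (set_row A r (delta_mx 0 i)).
Proof.
rewrite (expand_det_row A r); apply: eq_bigr => i _; congr (_ * _).
rewrite (expand_det_row _ r) (bigD1 i) //= !mxE !eqxx mul1r big1 ?addr0 => [|j /negPf ji].
  rewrite /cofactor; congr (_ * \det _); apply/matrixP => a b.
  by rewrite !mxE eq_sym (negPf (neq_lift _ _)).
by rewrite !mxE !eqxx ji mul0r.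
Qed.

(** Expand the four rows one after the other; what remains is the
    determinant of a matrix whose rows are basis vectors. *)
Lemma det_levi_civita (A : 'M[R]_4) :
  \det A = \sum_i \sum_j \sum_k \sum_l
    A 0 i * A 1 j * A (lift 0 (lift 0 0)) k * A ord_max l * eps i j k l.
Proof.
rewrite (det_set_row A 0); apply: eq_bigr => i _.
rewrite (det_set_row _ 1) mulr_sumr; apply: eq_bigr => j _.
rewrite (det_set_row _ (lift 0 (lift 0 0))) !mulr_sumr; apply: eq_bigr => k _.
rewrite (det_set_row _ ord_max) !mulr_sumr; apply: eq_bigr => l _.
rewrite !mulrA; congr (_ * _); first by rewrite !mxE.
rewrite /levi_civita_symbol; congr (determinant _).
by apply/matrixP => -[[|[|[|[|//]]]] lt] c; rewrite !mxE (tnth_nth 0) /= eq_sym.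
Qed.

(** The contraction of the volume form of R^4 with e_i and e_j. *)
Definition omega2 (i j : 'I_4) : 'M[R]_4 := \matrix_(k, l) eps i j k l.

(** The Hodge star of the standard metric. *)
Definition star (N : 'M[R]_4) : 'M[R]_4 := 2^-1 *: \sum_i \sum_j N i j *: omega2 i j.

Lemma hodgeE (G W : 'M[R]_4) : hodge G W =
  (2^-1 * Num.sqrt (\det G)) *: \sum_i \sum_j raise G W i j *: omega2 i j.
Proof.
apply/matrixP => k l; rewrite !mxE; congr (_ * _); rewrite summxE.
apply: eq_bigr => i _; rewrite summxE; apply: eq_bigr => j _.
by rewrite !mxE.
Qed.

Lemma sum_outer (E N : 'M[R]_4) (F : 'I_4 -> 'I_4 -> 'M[R]_4) :
  \sum_i \sum_j (E *m N *m E^T) i j *: F i j =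
  \sum_c \sum_d N c d *: \sum_i \sum_j (E i c * E j d) *: F i j.
Proof.
transitivity (\sum_i \sum_j \sum_d \sum_c (N c d * (E i c * E j d)) *: F i j).
  apply: eq_bigr => i _; apply: eq_bigr => j _.
  rewrite mxE scaler_suml; apply: eq_bigr => d _.
  rewrite !mxE mulr_suml scaler_suml; apply: eq_bigr => c _.
  by congr (_ *: _); ring.
transitivity (\sum_c \sum_d \sum_i \sum_j (N c d * (E i c * E j d)) *: F i j);
  last first.
  apply: eq_bigr => c _; apply: eq_bigr => d _; rewrite scaler_sumr.
  apply: eq_bigr => i _; rewrite scaler_sumr; apply: eq_bigr => j _.
  by rewrite scalerA.
under eq_bigr do rewrite exchange_big.
rewrite exchange_big [RHS]exchange_big; apply: eq_bigr => d _ /=.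
under eq_bigr do rewrite exchange_big.
by rewrite exchange_big.
Qed.

(** Invariance of the volume form up to the determinant: both sides are the
    determinant of the matrix with rows e_c, e_d, e_m, e_q, times that of E. *)
Lemma omega2_det (E : 'M[R]_4) c d :
  \sum_i \sum_j (E i c * E j d) *: (E^T *m omega2 i j *m E) = \det E *: omega2 c d.
Proof.
apply/matrixP => m q; rewrite summxE !mxE mulrC /levi_civita_symbol.
have rowE r x : ((\matrix_(a, b) (tnth [tuple c; d; m; q] a == b)%:R) *m E^T) r x =
    E x (tnth [tuple c; d; m; q] r).
  rewrite mxE (bigD1 (tnth [tuple c; d; m; q] r)) //= big1 ?addr0.
    by rewrite !mxE eqxx mul1r.
  by move=> y /negPf yt; rewrite !mxE eq_sym yt mul0r.
rewrite -(det_tr E) -det_mulmx det_levi_civita; apply: eq_bigr => i _.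
rewrite summxE; apply: eq_bigr => j _; rewrite mxE [X in _ * X]mxE mulr_sumr.
rewrite [RHS]exchange_big /=.
apply: eq_bigr => l _; rewrite mxE mulr_suml mulr_sumr; apply: eq_bigr => k _.
by rewrite !rowE !(tnth_nth 0) /= !mxE; ring.
Qed.

Lemma raise_conj (G E N : 'M[R]_4) : E^T *m G *m E = 1%:M ->
  raise G ((invmx E)^T *m N *m invmx E) = E *m N *m E^T.
Proof.
move=> EGE; have [_ uE] := mulmx1_unit EGE.
have EtG : E^T *m G = invmx E by rewrite -[LHS](mulmxK uE) EGE mul1mx.
have GE : E *m E^T *m G = 1%:M by rewrite -mulmxA EtG mulmxV.
have iG : invmx G = E *m E^T.
  have [_ uG] := mulmx1_unit GE.
  by rewrite -[RHS](mulmxK uG) GE mul1mx.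
have FE : E^T *m (invmx E)^T = 1%:M by rewrite -trmx_mul mulVmx // trmx1.
by rewrite /raise iG trmx_mul trmxK -!mulmxA (mulKmx uE) (mulmxA E^T) FE mul1mx.
Qed.

(** In an oriented orthonormal frame E the Hodge star becomes the standard
    one: a form with matrix N in the frame has components E^-T N E^-1 in the
    chart. *)
Lemma hodge_conj (G E N : 'M[R]_4) : E^T *m G *m E = 1%:M -> 0 < \det E ->
  hodge G ((invmx E)^T *m N *m invmx E) = (invmx E)^T *m star N *m invmx E.
Proof.
move=> EGE dE; have uE : E \in unitmx by rewrite unitmxE unitfE gt_eqF.
have uEt : E^T \in unitmx by rewrite unitmx_tr.
have detG : \det E ^+ 2 * \det G = 1.
  by rewrite -(@det1 R 4) -EGE !det_mulmx det_tr; ring.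
have sG : Num.sqrt (\det G) = (\det E)^-1.
  have -> : \det G = (\det E)^-1 ^+ 2.
    by rewrite exprVn -[RHS]mulr1 -detG mulKf // expf_neq0 // gt_eqF.
  by rewrite sqrtr_sqr ger0_norm // invr_ge0 ltW.
rewrite hodgeE (raise_conj _ EGE) sG sum_outer.
set f := \sum_c _.
have fE : E^T *m f *m E = \det E *: \sum_c \sum_d N c d *: omega2 c d.
  rewrite /f mulmx_sumr mulmx_suml scaler_sumr; apply: eq_bigr => c _.
  rewrite mulmx_sumr mulmx_suml scaler_sumr; apply: eq_bigr => d _.
  rewrite -scalemxAr -scalemxAl scalerA mulrC -scalerA -omega2_det; congr (_ *: _).
  rewrite mulmx_sumr mulmx_suml; apply: eq_bigr => i _.
  rewrite mulmx_sumr mulmx_suml; apply: eq_bigr => j _.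
  by rewrite -scalemxAr -scalemxAl.
have -> : f = (invmx E)^T *m (E^T *m f *m E) *m invmx E.
  by rewrite !mulmxA trmx_inv mulVmx // mul1mx mulmxK.
rewrite fE /star -!scalemxAr -!scalemxAl scalerA -mulrA mulVf ?mulr1 //.
by rewrite gt_eqF.
Qed.

Lemma det_mx3 (A : 'M[R]_3) (a : nat -> nat -> R) :
  (forall i j : 'I_3, A i j = a i j) -> \det A =
    a 0%N 0%N * (a 1%N 1%N * a 2%N 2%N - a 1%N 2%N * a 2%N 1%N)
  - a 0%N 1%N * (a 1%N 0%N * a 2%N 2%N - a 1%N 2%N * a 2%N 0%N)
  + a 0%N 2%N * (a 1%N 0%N * a 2%N 1%N - a 1%N 1%N * a 2%N 0%N).
Proof.
move=> AE; rewrite (expand_det_row _ ord0) !big_ord_recl big_ord0 /cofactor.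
by rewrite !det_mx2 !mxE !AE /= /bump /=; ring.
Qed.

(** An expansion over nat-indexed entries, which reduces for explicit
    matrices. *)
Lemma det_mx4 (A : 'M[R]_4) (a : nat -> nat -> R) :
  (forall i j : 'I_4, A i j = a i j) -> \det A =
  a 0%N 0%N * (a 1%N 1%N * (a 2%N 2%N * a 3%N 3%N - a 2%N 3%N * a 3%N 2%N)
    - a 1%N 2%N * (a 2%N 1%N * a 3%N 3%N - a 2%N 3%N * a 3%N 1%N)
    + a 1%N 3%N * (a 2%N 1%N * a 3%N 2%N - a 2%N 2%N * a 3%N 1%N))
  - a 0%N 1%N * (a 1%N 0%N * (a 2%N 2%N * a 3%N 3%N - a 2%N 3%N * a 3%N 2%N)
    - a 1%N 2%N * (a 2%N 0%N * a 3%N 3%N - a 2%N 3%N * a 3%N 0%N)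
    + a 1%N 3%N * (a 2%N 0%N * a 3%N 2%N - a 2%N 2%N * a 3%N 0%N))
  + a 0%N 2%N * (a 1%N 0%N * (a 2%N 1%N * a 3%N 3%N - a 2%N 3%N * a 3%N 1%N)
    - a 1%N 1%N * (a 2%N 0%N * a 3%N 3%N - a 2%N 3%N * a 3%N 0%N)
    + a 1%N 3%N * (a 2%N 0%N * a 3%N 1%N - a 2%N 1%N * a 3%N 0%N))
  - a 0%N 3%N * (a 1%N 0%N * (a 2%N 1%N * a 3%N 2%N - a 2%N 2%N * a 3%N 1%N)
    - a 1%N 1%N * (a 2%N 0%N * a 3%N 2%N - a 2%N 2%N * a 3%N 0%N)
    + a 1%N 2%N * (a 2%N 0%N * a 3%N 1%N - a 2%N 1%N * a 3%N 0%N)).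
Proof.
move=> AE; rewrite (expand_det_row _ ord0) !big_ord_recl big_ord0.
have AE' (i : 'I_4) (k l : 'I_3) :
    row' ord0 (col' i A) k l = a k.+1 (bump i l) by rewrite !mxE AE.
have cofE (i : 'I_4) : cofactor A ord0 i = _ :=
  congr1 (fun x => (-1) ^+ (ord0 + i) * x) 
    (@det_mx3 (row' ord0 (col' i A)) (fun m n => a m.+1 (bump i n)) (AE' i)).
rewrite !cofE.
by rewrite !AE /= /bump /=; ring.
Qed.

(** The formula of [det_mx4] for the matrix with rows e_i, e_j, e_k, e_l;
    over nat it evaluates on numerals. *)
Definition eps_nat (s : seq nat) : R :=
  let a (m n : nat) : R := (nth 0%N s m == n)%:R in
    a 0%N 0%N * (a 1%N 1%N * (a 2%N 2%N * a 3%N 3%N - a 2%N 3%N * a 3%N 2%N)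
    - a 1%N 2%N * (a 2%N 1%N * a 3%N 3%N - a 2%N 3%N * a 3%N 1%N)
    + a 1%N 3%N * (a 2%N 1%N * a 3%N 2%N - a 2%N 2%N * a 3%N 1%N))
  - a 0%N 1%N * (a 1%N 0%N * (a 2%N 2%N * a 3%N 3%N - a 2%N 3%N * a 3%N 2%N)
    - a 1%N 2%N * (a 2%N 0%N * a 3%N 3%N - a 2%N 3%N * a 3%N 0%N)
    + a 1%N 3%N * (a 2%N 0%N * a 3%N 2%N - a 2%N 2%N * a 3%N 0%N))
  + a 0%N 2%N * (a 1%N 0%N * (a 2%N 1%N * a 3%N 3%N - a 2%N 3%N * a 3%N 1%N)
    - a 1%N 1%N * (a 2%N 0%N * a 3%N 3%N - a 2%N 3%N * a 3%N 0%N)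
    + a 1%N 3%N * (a 2%N 0%N * a 3%N 1%N - a 2%N 1%N * a 3%N 0%N))
  - a 0%N 3%N * (a 1%N 0%N * (a 2%N 1%N * a 3%N 2%N - a 2%N 2%N * a 3%N 1%N)
    - a 1%N 1%N * (a 2%N 0%N * a 3%N 2%N - a 2%N 2%N * a 3%N 0%N)
    + a 1%N 2%N * (a 2%N 0%N * a 3%N 1%N - a 2%N 1%N * a 3%N 0%N)).

Lemma epsE (i j k l : 'I_4) : eps i j k l = eps_nat [:: i : nat; j : nat; k : nat; l : nat].
Proof.
rewrite /levi_civita_symbol; apply: det_mx4 => r c; rewrite mxE (tnth_nth 0).
rewrite -(inj_eq val_inj) /=; congr (_ == _)%:R.
by case: r => [[|[|[|[|//]]]] ?].
Qed.

Lemma starE (N : 'M[R]_4) k l : star N k l = 2^-1 *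
  \sum_i \sum_j N i j * eps_nat [:: i : nat; j : nat; k : nat; l : nat].
Proof.
rewrite mxE; congr (_ * _); rewrite summxE; apply: eq_bigr => i _.
by rewrite summxE; apply: eq_bigr => j _; rewrite !mxE epsE.
Qed.

Lemma star_sdform (c : 'I_3) : star (sdform R c) = sdform R c :> 'M[R]_4.
Proof.
apply/matrixP => k l; rewrite starE !big_ord_recl !big_ord0 !mxE /eps_nat /=.
by case: c => [[|[|[|//]]] ?]; case: k => [[|[|[|[|//]]]] ?];
  case: l => [[|[|[|[|//]]]] ?] /=; field.
Qed.

(** A self-dual form is determined by its first row: the components (0, l),
    (l, 0) and the two of the complementary pair of indices contribute
    equally to the pairing. *)
Lemma selfdual_entries (N : 'M[R]_4) c : N^T = - N -> star N = N ->
  \sum_k \sum_l N k l * sdform R c k l =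
  4 * \sum_l N 0 l * sdform R c 0 l.
Proof.
move=> skew starN.
have skewE k l : N k l = - N l k.
  by have /matrixP/(_ l k) := skew; rewrite !mxE.
have starNE k l : N k l = 2^-1 *
    \sum_i \sum_j N i j * eps_nat [:: i : nat; j : nat; k : nat; l : nat].
  by rewrite -{1}starN starE.
pose a (m n : nat) := N (inord m) (inord n).
have NE k l : N k l = a k l by rewrite /a !inord_val.
have sk (k l : 'I_4) : a k l = - a l k by rewrite -!NE.
have sd (k l : 'I_4) : a k l = 2^-1 *
    \sum_(i < 4) \sum_(j < 4) a i j * eps_nat [:: i : nat; j : nat; k : nat; l : nat].
  rewrite -NE starNE; congr (_ * _); apply: eq_bigr => i _.
  by apply: eq_bigr => j _; rewrite NE.
under eq_bigr do under eq_bigr do rewrite NE.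
under [X in _ = _ * X]eq_bigr do rewrite NE.
move: (sd (inord 0) (inord 1)) (sd (inord 0) (inord 2)) (sd (inord 0) (inord 3)).
move: (sk (inord 0) (inord 1)) (sk (inord 0) (inord 2)) (sk (inord 0) (inord 3)).
move: (sk (inord 1) (inord 2)) (sk (inord 1) (inord 3)) (sk (inord 2) (inord 3)).
(* The skew-symmetry and self-duality relations are now linear in the
   numbers a k l, and the claim is a linear consequence of them. *)
rewrite !big_ord_recl !big_ord0 !mxE /eps_nat !inordK //= /bump /=.
case: c => [[|[|[|//]]] ?] /=; lra.
Qed.

(** Apply [hodge_conj] to the standard metric, with a rotation as
    orthonormal frame. *)
Lemma star_rotation (T : 'M[R]_4) (c : 'I_3) : SO T ->
  star (T *m sdform R c *m T^T) = T *m sdform R c *m T^T.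
Proof.
move=> [TT dT]; have star1 N : hodge 1%:M N = star N.
  have := @hodge_conj 1%:M 1%:M N; rewrite invmx1 trmx1 !mulmx1 !mul1mx det1.
  by apply=> //; exact: ltr01.
have iT : invmx T = T^T.
  have [_ uT] := mulmx1_unit TT.
  by rewrite -[RHS](mulmxK uT) TT mul1mx.
have := @hodge_conj 1%:M T (sdform R c); rewrite mulmx1 iT trmxK star1 star_sdform.
by apply=> //; rewrite dT ltr01.
Qed.

Lemma form_inner_conj (G E N N' : 'M[R]_4) : E^T *m G *m E = 1%:M ->
  form_inner G ((invmx E)^T *m N *m invmx E) ((invmx E)^T *m N' *m invmx E) =
  2^-1 * \sum_i \sum_j N i j * N' i j.
Proof.
move=> EGE; rewrite /form_inner raise_conj //; congr (_ * _).
have trE (X Y : 'M[R]_4) : \sum_i \sum_j X i j * Y i j = \tr (X *m Y^T).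
  apply: eq_bigr => i _; rewrite mxE; apply: eq_bigr => j _; rewrite mxE.
  by [].
have [_ uE] := mulmx1_unit EGE.
rewrite !trE !trmx_mul trmxK -!mulmxA mxtrace_mulC -!mulmxA mulVmx // mulmx1.
by rewrite (mulmxA E^T) -trmx_mul mulVmx // trmx1 mul1mx.
Qed.

End Hodge.

(** * The spin structure of the sum *)

Section SumFrames.
Variables (R : realType) (M : oriented_riemannian4 R).
Implicit Types (e : frame M) (p : M).
Local Open Scope classical_set_scope.

(** The forms [sdform] have squared norm 2, half the sum of the squares of
    their entries. *)
Definition sf_scale : R := (Num.sqrt 2)^-1.

Lemma sf_scale_gt0 : 0 < sf_scale.
Proof. by rewrite invr_gt0 sqrtr_gt0 ltr0n. Qed.

Lemma sf_scale_sqr : sf_scale * sf_scale = 2^-1.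
Proof. by rewrite -expr2 exprVn sqr_sqrtr // ler0n. Qed.

(** The orthonormal frame (e_i, eta_c / sqrt 2) of TM + Lambda^+ defined by
    an orthonormal frame e of TM. The coframe, which is the inverse of e, is
    written as e^T g because this is visibly smooth. *)
Definition frame_elt e (a : 'I_7) p : 'cV[R]_4 * 'M[R]_4 :=
  match fintype.split (a : 'I_(4 + 3)) with
  | inl i => (col i (fr_mx e p), 0)
  | inr c => (0, ((fr_mx e p)^T *m metric (fr_chart e) p)^T *m
                 (sf_scale *: sdform R c) *m
                 ((fr_mx e p)^T *m metric (fr_chart e) p))
  end.

Lemma frame_eltl e (i : 'I_4) p :
  frame_elt e (lshift 3 i) p = (col i (fr_mx e p), 0).
Proof. by rewrite /frame_elt (unsplitK (inl i)). Qed.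

Lemma frame_eltr e (c : 'I_3) p : fr_dom e p ->
  frame_elt e (rshift 4 c) p = (0,
    (invmx (fr_mx e p))^T *m (sf_scale *: sdform R c) *m invmx (fr_mx e p)).
Proof.
by move=> /fr_on/orthonormal_inv <-; rewrite /frame_elt (unsplitK (inr c)).
Qed.

Lemma sum_coord_l (E : 'M[R]_4) x (i : 'I_4) :
  sum_coord E x (lshift 3 i) 0 = (invmx E *m x.1) i 0.
Proof. by rewrite mxE (unsplitK (inl i)). Qed.

Lemma sum_coord_r (E : 'M[R]_4) x (c : 'I_3) :
  sum_coord E x (rshift 4 c) 0 = (E^T *m x.2 *m E) 0 (lift 0 c).
Proof. by rewrite mxE (unsplitK (inr c)). Qed.

Lemma smooth_frame_elt1 e a : smooth_mx (fr_dom e) (fun p => (frame_elt e a p).1).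
Proof.
have oD := @fr_open _ _ e; move=> r c; rewrite /frame_elt.
case: fintype.split => i; last exact: smooth_cst_mx.
by apply: (eq_smooth oD _ (@fr_smooth _ _ e r i)) => p _; rewrite mxE.
Qed.

Lemma smooth_frame_elt2 e a : smooth_mx (fr_dom e) (fun p => (frame_elt e a p).2).
Proof.
have oD := @fr_open _ _ e; rewrite /frame_elt.
case: fintype.split => i; first exact: smooth_cst_mx.
have sF : smooth_mx (fr_dom e) (fun p => (fr_mx e p)^T *m metric (fr_chart e) p).
  apply: smooth_mul_mx => //; first by apply: smooth_tr_mx => //; exact: fr_smooth.
  by apply: smooth_sub_mx (@metric_smooth _ M (fr_chart e)) => p /fr_sub.
apply: smooth_mul_mx => //; apply: smooth_mul_mx => //; last exact: smooth_cst_mx.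
exact: smooth_tr_mx.
Qed.

Lemma starZ (s : R) N : star (s *: N) = s *: star N.
Proof.
rewrite /star scalerA mulrC -scalerA; congr (_ *: _).
rewrite scaler_sumr; apply: eq_bigr => i _; rewrite scaler_sumr.
by apply: eq_bigr => j _; rewrite mxE scalerA.
Qed.

Lemma frame_elt_selfdual e p a : fr_dom e p ->
  selfdual (metric (fr_chart e) p) (frame_elt e a p).2.
Proof.
move=> ep; have [on d] := fr_on ep.
case: (split_ordP (a : 'I_(4 + 3))) => c ->.
  rewrite frame_eltl /=; split; first by rewrite trmx0 oppr0.
  have := @hodge_conj _ _ _ 0 on d; rewrite mulmx0 mul0mx => ->.
  by rewrite -[X in star X](scale0r (0 : 'M[R]_4)) starZ scale0r mulmx0 mul0mx.
rewrite frame_eltr //=; split.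
  by rewrite !trmx_mul trmxK linearZ /= sdform_skew scalerN mulNmx mulmxN mulmxA.
by rewrite hodge_conj // starZ star_sdform.
Qed.

Lemma form_inner0l (G W : 'M[R]_4) : form_inner G 0 W = 0.
Proof.
rewrite /form_inner big1 ?mulr0 // => i _; rewrite big1 // => j _.
by rewrite /raise mulmx0 mul0mx mxE mul0r.
Qed.

Lemma form_inner0r (G W : 'M[R]_4) : form_inner G W 0 = 0.
Proof.
rewrite /form_inner big1 ?mulr0 // => i _; rewrite big1 // => j _.
by rewrite [X in _ * X]mxE mulr0.
Qed.

Lemma col_form (A X B : 'M[R]_4) i j :
  ((col i A)^T *m X *m col j B) 0 0 = (A^T *m X *m B) i j.
Proof.
rewrite !colE trmx_mul trmx_delta.
pose u : 'rV[R]_4 := delta_mx 0 i; pose w : 'cV[R]_4 := delta_mx j 0.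
have -> : u *m A^T *m X *m (B *m w) = u *m (A^T *m X *m B) *m w by rewrite !mulmxA.
by rewrite -rowE -colE mxE [LHS]mxE.
Qed.

Lemma sum_scaled_sdform (N : 'M[R]_4) c :
  \sum_i \sum_j (sf_scale *: N) i j * (sf_scale *: sdform R c) i j =
  2^-1 * \sum_i \sum_j N i j * sdform R c i j.
Proof.
rewrite -sf_scale_sqr mulr_sumr; apply: eq_bigr => i _; rewrite mulr_sumr.
by apply: eq_bigr => j _; rewrite !mxE; ring.
Qed.

Lemma frame_elt_orthonormal e p a b : fr_dom e p ->
  sum_inner (metric (fr_chart e) p) (frame_elt e a p) (frame_elt e b p) = (a == b)%:R.
Proof.
move=> ep; have [on d] := fr_on ep; rewrite /sum_inner.
have lr (k : 'I_4) (l : 'I_3) : (lshift 3 k == rshift 4 l :> 'I_7) = false.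
  exact: eq_lrshift.
have rl (k : 'I_4) (l : 'I_3) : (rshift 4 l == lshift 3 k :> 'I_7) = false.
  by rewrite eq_sym lr.
case: (split_ordP (a : 'I_(4 + 3))) => c ->; case: (split_ordP (b : 'I_(4 + 3))) => c' ->;
  rewrite ?frame_eltl ?frame_eltr //= ?form_inner0l ?form_inner0r ?addr0.
- by rewrite col_form on mxE (inj_eq (@lshift_inj 4 3)).
- by rewrite mulmx0 mxE lr.
- by rewrite trmx0 !mul0mx mxE rl.
- rewrite trmx0 !mul0mx mxE add0r form_inner_conj // sum_scaled_sdform.
  by rewrite sdform_dot (inj_eq (@rshift_inj 4 3)); field.
Qed.

(** The forms [sdform] in the basis e^12 + e^34, e^13 - e^24, e^14 + e^23,
    which is read off from the first row. The two bases differ by a matrix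
    of determinant 1, and so induce the same orientation. *)
Definition sdform_matrix : 'M[R]_3 := \matrix_(d, j) sdform R d 0 (lift 0 j).

Lemma det_sdform_matrix : \det sdform_matrix = 1.
Proof.
rewrite (@det_mx3 _ _ (fun m n => nth 0 (nth [::]
  [:: [:: 0; 0; 1]; [:: 0; -1; 0]; [:: 1; 0; 0]] m) n)) /=; first by ring.
by move=> [[|[|[|//]]] ?] [[|[|[|//]]] ?]; rewrite !mxE.
Qed.

(** Rotations of R^4 preserve the orientation of the space of self-dual
    forms, as they act there by the cover of a spin element. *)
Lemma sdform_rotation_det (T : 'M[R]_4) : SO T ->
  \det (\matrix_(j < 3, c < 3) (T *m sdform R c *m T^T) 0 (lift 0 j)) = 1.
Proof.
move=> soT; have [a sa aT] := spin_cover_surj soT.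
rewrite -[LHS]mul1r -{1}det_sdform_matrix -det_mulmx.
have -> : sdform_matrix *m \matrix_(j, c) (T *m sdform R c *m T^T) 0 (lift 0 j) =
    spin_cover (pr_plus a).
  (* By [sdform_rotation], 4 times the entry d c is the pairing of the
     rotated form with the d-th one, which [selfdual_entries] reduces to
     first rows. *)
  apply/matrixP => d c; apply: (@mulfI _ 4); first by rewrite pnatr_eq0.
  rewrite -(sdform_rotation _ _ sa) aT selfdual_entries ?star_rotation //; last first.
    by rewrite !trmx_mul trmxK sdform_skew mulNmx mulmxN mulmxA.
  congr (_ * _); rewrite [RHS]big_ord_recl [sdform R d 0 0]mxE.
  rewrite (_ : nth _ _ _ = 0) ?mulr0 ?add0r.
    by rewrite mxE; apply: eq_bigr => j _; rewrite !mxE mulrC.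
  by case: d => [[|[|[|//]]] ?].
exact: (spin_cover_SO (spin_pr_plus sa)).2.
Qed.

(** Relative to another oriented orthonormal basis E, the frame is given by
    the rotation T = E^-1 e on the first summand and the induced rotation of
    self-dual forms on the second. *)
Lemma frame_elt_oriented e p (E : 'M[R]_4) : fr_dom e p ->
  oriented_orthonormal (fr_chart e) p E ->
  0 < \det (\matrix_(c, a) sum_coord E (frame_elt e a p) c 0).
Proof.
move=> ep oE; have uE := orthonormal_unit oE; have uF := fr_unit ep.
have [on d] := fr_on ep; have [onE dE] := oE.
pose T := invmx E *m fr_mx e p.
have GE : metric (fr_chart e) p = (invmx E)^T *m invmx E.
  by rewrite trmx_inv -(orthonormal_inv oE) mulKmx // unitmx_tr.
have TT : T^T *m T = 1%:M by rewrite /T trmx_mul mulmxA -(mulmxA _ _ (invmx E)) -GE.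
have soT : SO T.
  by apply: orthogonal_SO => //; rewrite det_mulmx det_inv mulr_gt0 ?invr_gt0.
have iT : invmx (fr_mx e p) *m E = T^T.
  have TF : T *m (invmx (fr_mx e p) *m E) = 1%:M.
    by rewrite /T -mulmxA mulKVmx // mulVmx.
  by rewrite -[LHS]mul1mx -TT -mulmxA TF mulmx1.
pose Q := \matrix_(j < 3, c < 3) (T *m sdform R c *m T^T) 0 (lift 0 j).
have blkE : \matrix_(c < 4 + 3, a < 4 + 3) sum_coord E (frame_elt e a p) c 0 =
    block_mx T 0 0 (sf_scale *: Q).
  apply/matrixP => b a; rewrite mxE.
  case: (split_ordP (b : 'I_(4 + 3))) => c ->; case: (split_ordP (a : 'I_(4 + 3))) => k ->.
  - rewrite sum_coord_l frame_eltl block_mxEul /T /=.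
    by rewrite !mxE; apply: eq_bigr => j _; rewrite !mxE.
  - by rewrite sum_coord_l frame_eltr // block_mxEur mulmx0 !mxE.
  - by rewrite sum_coord_r frame_eltl block_mxEdl mulmx0 mul0mx !mxE.
  rewrite sum_coord_r frame_eltr // block_mxEdr [RHS]mxE [in RHS]mxE /=.
  have -> : E^T *m ((invmx (fr_mx e p))^T *m (sf_scale *: sdform R k) *m
      invmx (fr_mx e p)) *m E = sf_scale *: (T *m sdform R k *m T^T).
    have iTt : E^T *m (invmx (fr_mx e p))^T = T by rewrite -trmx_mul iT trmxK.
    by rewrite !mulmxA iTt -(mulmxA _ (invmx _)) iT -scalemxAr -scalemxAl.
  by rewrite mxE.
suff : 0 < \det (block_mx T 0 0 (sf_scale *: Q)) by rewrite -blkE.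
rewrite det_ublock detZ sdform_rotation_det // mulr1 soT.2 mul1r exprn_gt0 //.
exact: sf_scale_gt0.
Qed.

Definition frame_sum_frame e : sum_frame M :=
  @SumFrame R M (fr_chart e) (fr_dom e) (frame_elt e) (@fr_open _ _ e)
    (@fr_sub _ _ e) (smooth_frame_elt1 e) (smooth_frame_elt2 e)
    (fun p a => @frame_elt_selfdual e p a) (fun p a b => @frame_elt_orthonormal e p a b)
    (@frame_elt_oriented e).

(** The transition matrix between two such frames is block diagonal, with
    blocks the rotation T between the orthonormal frames and its action on
    self-dual forms; [sdform_rotation] identifies the latter. *)
Lemma sf_trans_spin7 e e' p (a : clifford R 4) : fr_dom e p -> fr_dom e' p ->
  spin a -> spin_cover a = fr_trans e e' p ->
  sf_trans (frame_sum_frame e) (frame_sum_frame e') p = spin_cover (spin7_lift a).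
Proof.
move=> ep ep' sa aT; rewrite spin7_lift_cover // aT.
have [on d] := fr_on ep; have [on' d'] := fr_on ep'.
have [dm dm'] := (fr_sub ep, fr_sub ep').
pose J := jac (fr_chart e) (fr_chart e') p.
have [TT _] := fr_trans_SO ep ep'; set T := fr_trans e e' p in aT TT *.
have FT : invmx (fr_mx e' p) *m jac (fr_chart e') (fr_chart e) p =
    T^T *m invmx (fr_mx e p).
  have -> : T^T = fr_trans e' e p.
    rewrite -[RHS]mul1mx -TT -mulmxA /T fr_trans_comp // fr_trans_id // mulmx1.
    by [].
  by rewrite fr_transE // mulmxA mulmxK ?fr_unit.
apply/(@matrixP _ (4 + 3) (4 + 3)) => b c; rewrite mxE /sum_inner /sum_change /=.
case: (split_ordP (b : 'I_(4 + 3))) => k ->; case: (split_ordP (c : 'I_(4 + 3))) => l ->;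
  rewrite ?frame_eltl ?frame_eltr //= ?mulmx0 ?mul0mx ?form_inner0l ?form_inner0r.
- rewrite addr0 block_mxEul.
  rewrite (_ : jac _ _ _ *m col l _ = col l (J *m fr_mx e' p)); last first.
    by rewrite !colE mulmxA.
  by rewrite col_form /T /fr_trans.
- by rewrite addr0 block_mxEur !mxE.
- by rewrite addr0 block_mxEdl trmx0 !mul0mx !mxE.
rewrite mxE add0r block_mxEdr.
have -> : (jac (fr_chart e') (fr_chart e) p)^T *m
    ((invmx (fr_mx e' p))^T *m (sf_scale *: sdform R l) *m invmx (fr_mx e' p)) *m
    jac (fr_chart e') (fr_chart e) p =
    (invmx (fr_mx e p))^T *m (sf_scale *: (T *m sdform R l *m T^T)) *m invmx (fr_mx e p).
  have FTt : (jac (fr_chart e') (fr_chart e) p)^T *m (invmx (fr_mx e' p))^T =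
      (invmx (fr_mx e p))^T *m T.
    by rewrite -trmx_mul FT [LHS]trmx_mul trmxK.
  move: T FT FTt {aT TT} => T FT FTt.
  by rewrite !mulmxA FTt -!mulmxA FT !mulmxA -!scalemxAr -!scalemxAl !mulmxA.
rewrite form_inner_conj //.
under eq_bigr do under eq_bigr do rewrite mulrC.
by rewrite sum_scaled_sdform -aT sdform_rotation //; field.
Qed.

Lemma spin7_lift_cover_eq (a b : clifford R 4) : spin a -> spin b ->
  spin_cover a = spin_cover b -> spin7_lift a = spin7_lift b.
Proof.
move=> sa sb ab; apply/ffunP => S.
exact: (quadratic_lift (f := fun x => spin7_lift x S) (@spin7_lift_quadratic R S) sa sb ab).
Qed.

Lemma spin7_lift_SO (A B : 'M[R]_4) : SO A -> SO B -> SO (A *m B) ->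
  spin7_lift (spin_lift A) * spin7_lift (spin_lift B) =
  spin7_lift (spin_lift (A *m B)).
Proof.
move=> /spin_liftP[sa aA] /spin_liftP[sb bB] /spin_liftP[sc cC].
rewrite -(spin7_liftM sa sb); apply: (spin7_lift_cover_eq (spinM sa sb) sc).
by rewrite (spin_coverM sa sb) aA bB cC.
Qed.

(** The map [spin7_lift o spin_lift] is a homomorphism from SO(4) to
    Spin(7), by [spin7_lift_SO]; the cocycle is its composition with that of
    the orthonormal frames, so there is no obstruction to the cocycle
    identity. *)
Definition sum_spin_structure : spin_structure (TM_plus_selfdual M).
Proof.
refine (@SpinStructure R M 7 (TM_plus_selfdual M) (frame M) frame_sum_frame
  (fun e e' p => spin7_lift (spin_lift (fr_trans e e' p))) _ _ _ _ _).
- exact: fr_cover.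
- move=> e e' S.
  have soT p : (fr_dom e `&` fr_dom e') p -> SO (fr_trans e e' p).
    by move=> [ep ep']; exact: fr_trans_SO.
  exact: (smooth_quadratic_lift (open_fr_domI e e') (@spin7_lift_quadratic R S)
    (@smooth_fr_trans _ _ e e') soT).
- move=> e e' p ep ep'; apply: spin_spin7_lift.
  by have [] := spin_liftP (fr_trans_SO ep ep').
- move=> e e' p ep ep'; have [sa aT] := spin_liftP (fr_trans_SO ep ep').
  by rewrite -(sf_trans_spin7 ep ep' sa aT).
- move=> e e' e'' p ep ep' ep''; rewrite -(fr_trans_comp ep ep' ep'').
  apply: (spin7_lift_SO (fr_trans_SO ep ep') (fr_trans_SO ep' ep'')).
  by rewrite fr_trans_comp //; exact: fr_trans_SO.
Defined.

End SumFrames.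

(** * The spinor bundle *)

Section Assembly.
Variables (R : realType) (M : oriented_riemannian4 R).
Local Notation C := R[i].

Lemma SigmaM_SigmaLambda_even : even_rep (SigmaM_SigmaLambda R).
Proof. exact: tens_rep_even (@Delta4_spin_mx R) (@Delta3_pr_spin_mx R). Qed.

Lemma SigmaPlus_SigmaLambda_even : even_rep (SigmaPlus_SigmaLambda R).
Proof. exact: tens_rep_even (@Delta4_plus_spin_mx R) (@Delta3_pr_spin_mx R). Qed.

Lemma SigmaPlus_SigmaPlus_even : even_rep (SigmaPlus_SigmaPlus R).
Proof. exact: tens_rep_even (@Delta4_plus_spin_mx R) (@Delta4_plus_spin_mx R). Qed.

Lemma End_SigmaPlus_even : even_rep (End_SigmaPlus R).
Proof. exact: end_rep_even (@Delta4_plus_spin_mx R). Qed.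

(** Clifford multiplication by (a, pr_plus a) on Delta_7 is the tensor
    product action, by [Delta7_tens]. *)
Lemma spinor_trans (e e' : frame M) p (v : 'M[C]_((2 + 2) * 2, 1)) :
  fr_dom e p -> fr_dom e' p ->
  Delta7 (spin7_lift (spin_lift (fr_trans e e' p))) *m v =
  descended (SigmaM_SigmaLambda R) (fr_trans e e' p) v.
Proof.
move=> ep ep'; have [sl _] := spin_liftP (fr_trans_SO ep ep').
by rewrite /spin7_lift Delta7_tens //; exact: spin_pr_plus.
Qed.

(** The two bundles have the same transition functions, so the identity of
    the fibres is an isomorphism. *)
Lemma spinor_bundle_iso :
  @is_vbundle_iso R M (Ass M (descended (SigmaM_SigmaLambda R)))
    (spinor_bundle (sum_spin_structure M) (@Delta7 R))
    (induced_map (descended (SigmaM_SigmaLambda R)) id).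
Proof.
have rP := SigmaM_SigmaLambda_even.
have idP : rep_iso (descended (SigmaM_SigmaLambda R)) (descended (SigmaM_SigmaLambda R)) id.
  by split=> //; exists id.
have [lin bij sm compat] := @induced_iso R M _ _ _ _ _ _ id rP idP.
split; [exact: lin|exact: bij|exact: sm|].
move=> e e1 e' e1' p v ep ep1 ep' ep1'.
by rewrite (compat e e1 e' e1' p v ep ep1 ep' ep1') /= (spinor_trans _ ep1' ep').
Qed.

End Assembly.

Theorem proposition3p1 (R : realType) (M : oriented_riemannian4 R) :
  [/\ is_spin (TM_plus_selfdual M),
      descends (SigmaM_SigmaLambda R),
      is_vbundle (Ass M (descended (SigmaM_SigmaLambda R))) &
      exists (Q : spin_structure (TM_plus_selfdual M)) phi,
        is_vbundle_iso (E := Ass M (descended (SigmaM_SigmaLambda R)))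
          (F := spinor_bundle Q (@Delta7 R)) phi] /\
  [/\ descends (SigmaPlus_SigmaLambda R),
      descends (SigmaPlus_SigmaPlus R),
      descends (End_SigmaPlus R),
      [/\ is_vbundle (Ass M (descended (SigmaPlus_SigmaLambda R))),
          is_vbundle (Ass M (descended (SigmaPlus_SigmaPlus R))) &
          is_vbundle (Ass M (descended (End_SigmaPlus R)))] &
      Ass_iso M (descended (SigmaPlus_SigmaLambda R))
        (descended (SigmaPlus_SigmaPlus R)) /\
      Ass_iso M (descended (SigmaPlus_SigmaPlus R))
        (descended (End_SigmaPlus R))] /\
  is_section (E := Ass M (descended (End_SigmaPlus R))) (Id_SigmaPlus (M := M)) /\
  parallel (descended (End_SigmaPlus R)) (Id_SigmaPlus (M := M)).
Proof.
have eML := @SigmaM_SigmaLambda_even R; have ePL := @SigmaPlus_SigmaLambda_even R.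
have ePP := @SigmaPlus_SigmaPlus_even R; have eE := @End_SigmaPlus_even R.
split; [split|split; [split|split]].
- by constructor; exact: sum_spin_structure.
- exact: even_rep_descends.
- exact: Ass_vbundle.
- exists (sum_spin_structure M), (induced_map (descended (SigmaM_SigmaLambda R)) id).
  exact: spinor_bundle_iso.
- exact: even_rep_descends.
- exact: even_rep_descends.
- exact: even_rep_descends.
- by split; exact: Ass_vbundle.
- split.
    apply: (@Ass_isoI R M _ _ _ _ _ _ id) => //; first by exists id.
    move=> a v sa; rewrite /SigmaPlus_SigmaLambda /SigmaPlus_SigmaPlus.
    by rewrite /tens_rep /mx_rep /= -Delta4_plusE.
  apply: (@Ass_isoI R M _ _ _ _ _ _ (@tens_end R)) => //.
  + exact: tens_end_linear.
  + exact: tens_end_bij.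
  + by move=> a v sa; apply: tens_end_conj; exact: det_Delta4_plus.
- exact: Id_SigmaPlus_section.
- exact: Id_SigmaPlus_parallel.
Qed.
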